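(* Let $d, r \ge 1$ be integers. Let $\mathbf{Z}_1, \ldots, \mathbf{Z}_r : \mathbb{Z}^d \to \mathbb{R}$ be independent linear random fields and let $a_1, \ldots, a_r$ be independent real random variables, independent of the fields. Write $\vec a = (a_1,\ldots,a_r)$ and define $$\mathbf{X}[\vec\imath] = \sum_{l=1}^r a_l \mathbf{Z}_l[\vec\imath], \qquad \vec\imath \in \mathbb{Z}^d .$$ Let $\mathbf{X}_1, \ldots, \mathbf{X}_n$ be $n$ independent copies of $\mathbf{X}$, given by $\mathbf{X}_s[\vec\imath] = \sum_{l=1}^r a_{s,l}\mathbf{Z}_{s,l}[\vec\imath]$, $s = 1,\ldots,n$, where for each $l = 1, \ldots, r$, $\mathbf{Z}_{1,l},\ldots,\mathbf{Z}_{n,l}$ and $a_{1,l},\ldots,a_{n,l}$ are independent and identically distributed copies of $\mathbf{Z}_l$ and $a_l$, respectively. Let $\mathbf{X}^{(N)}_1, \ldots, \mathbf{X}^{(N)}_n$ be the restrictions of $\mathbf{X}_1,\ldots,\mathbf{X}_n$ to $M_N^d$. Define $$\mu_n[\vec k] = \frac1n \sum_{s=1}^n \widehat P_{\mathbf{X}^{(N)}_s}[\vec k], \qquad C_n[\vec k_1, \vec k_2] = \frac1n \sum_{s=1}^n \widehat P_{\mathbf{X}^{(N)}_s}[\vec k_1]\, \widehat P_{\mathbf{X}^{(N)}_s}[\vec k_2].$$ Then, for $\vec k, \vec k_1, \vec k_2 \in M_{N,+}^d$, $$\mu_n[\vec k] = P_{\mathbf{X}}(\vec k/N) + \epsilon_1[\vec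 k]$$ and $$\frac{1}{1+\delta_N[\vec k_1,\vec k_2]}\, C_n[\vec k_1,\vec k_2] - \mu_n[\vec k_1]\mu_n[\vec k_2] = \mathrm{Cov}\left[P_{\mathbf{X}|\vec a}(\vec k_1/N),\, P_{\mathbf{X}|\vec a}(\vec k_2/N)\right] + \epsilon_2[\vec k_1,\vec k_2],$$ where the expected magnitudes $\mathbb{E}|\epsilon_1[\vec k]|$ and $\mathbb{E}|\epsilon_2[\vec k_1,\vec k_2]|$ are each bounded by $O(n^{-1/2} + N^{-1/2})$.
   Context: **Linear fields.** A stationary field $\mathbf{Y}:\mathbb{Z}^d\to\mathbb{R}$ is *linear* if $\mathbf{Y}[\vec\imath] = \sum_{\vec\jmath\in\mathbb{Z}^d} W[\vec\jmath]\,\psi[\vec\imath-\vec\jmath]$, where $W:\mathbb{Z}^d\to\mathbb{R}$ is a stationary, zero-mean, white noise field with $\mathbb{E}|W[\vec\imath]|^2 = 1$ and $\mathbb{E}|W[\vec\imath]|^4<\infty$, and $\psi:\mathbb{Z}^d\to\mathbb{R}$ is a kernel satisfying $\sum_{\vec\imath\in\mathbb{Z}^d} |\psi[\vec\imath]|\,\|\vec\imath\|_1^{1/2} < \infty$. **Power spectrum.** For a zero-mean stationary random field $\mathbf{Y}:\mathbb{Z}^d\to\mathbb{R}$ with finite second moments, the autocovariance is $R_{\mathbf{Y}}[\vec\jmath] = \mathbb{E}\left[\mathbf{Y}[\vec\imath]\mathbf{Y}[\vec\imath+\vec\jmath]\right]$ for $\vec\jmath\in\mathbb{Z}^d$, and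 the power spectrum is $P_{\mathbf{Y}}(\vec\xi) = \sum_{\vec\imath\in\mathbb{Z}^d} R_{\mathbf{Y}}[\vec\imath]\, e^{-2\pi \mathrm{i}\langle\vec\xi,\vec\imath\rangle}$ for $\vec\xi\in[-1/2,1/2]^d$. **Conditional power spectrum.** $P_{\mathbf{X}|\vec a}$ is defined as the power spectrum above, with the expectation in the autocovariance replaced by the conditional expectation over $\mathbf{Z}_1,\ldots,\mathbf{Z}_r$ given $\vec a$. Thus $P_{\mathbf{X}|\vec a}(\vec\xi) = \sum_{l=1}^r a_l^2 P_{\mathbf{Z}_l}(\vec\xi)$, which is a random function of $\vec a$. The covariance in the claim is taken with respect to the law of $\vec a$. **Sampling domain.** For a positive integer $N$, $M_N = \{-\lceil N/2\rceil+1,\ldots,\lfloor N/2\rfloor\}$. $M_{N,+}^d$ is a chosen subset of $M_N^d$ containing exactly one representative of each pair $\{\vec k,-\vec k\}$ modulo $N$. That is, $M_{N,+}^d\cup(-M_{N,+}^d) = M_N^d$ modulo $N$, and $M_{N,+}^d$ and $-M_{N,+}^d$ overlap modulo $N$ only in self-conjugate points ($\vec k\equiv-\vec k$ mod $N$, such as $\vec 0$). **Periodogram.** For a field $\mathbf{Y}$ with restriction $\mathbf{Y}^{(N)}$ to $M_N^d$, $$\widehat P_{\mathbf{Y}^{(N)}}[\vec k] = \frac{1}{N^d}\left|\sum_{\vec\imath\in M_N^d}\mathbf{Y}^{(N)}[\vec\imath]\,e^{-2\pi \mathrm{i}\langle\vec k,\vec\imath\rangle/N}\right|^2,\qquad \vec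 k\in M_N^d .$$ **The symbol $\delta_N$.** $\delta_N[\vec k_1,\vec k_2] = 2$ if $\vec k_1=\vec k_2$ and $\vec k_1\in\frac N2\mathbb{Z}^d$. It equals $1$ if $\vec k_1=\vec k_2$ and $\vec k_1\notin\frac N2\mathbb{Z}^d$. It equals $0$ if $\vec k_1\ne\vec k_2$. **Asymptotics.** The dimension $d$, the number $r$, and the distributions of the $a_l$ and $\mathbf{Z}_l$ are fixed. The $O(\cdot)$ bound is in $n$ and $N$, with implied constants not depending on $n$, $N$ or the frequency indices.
   Formalization: The variables a_l are additionally assumed to have finite eighth moments (without this the spectra may be undefined or the n^{-1/2} rate fails), and the white noise W is taken to have mutually independent, not merely uncorrelated, values. *)

(* Defs.v *)
From HB Require Import structures.
From mathcomp Require Import all_boot all_order all_algebra.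
From mathcomp Require Import finmap.
From mathcomp Require Import complex.
From mathcomp Require Import all_classical all_reals all_analysis.
From mathcomp Require Import summability.

Set Implicit Arguments.
Unset Strict Implicit.
Unset Printing Implicit Defensive.
Import Order.TTheory GRing.Theory Num.Theory.
Import numFieldNormedType.Exports.

Local Open Scope classical_set_scope.
Local Open Scope ring_scope.

Section RandomFamilies.
Context {R : realType}.

Definition cylinders (I : Type) : set_system (I -> R) :=
  \bigcup_i preimage_set_system setT (fun y : I -> R => y i) measurable.

(* [realization Y] is the family [Y] seen as one map into the space [I -> R] of
   realizations, equipped with the product sigma-algebra. *)
Definition realization (T I : Type) (Y : I -> T -> R) :
  T -> g_sigma_algebraType (@cylinders I) := fun t i => Y i t.

Definition same_law d (T : measurableType d) d' (T' : measurableType d')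
    (I : Type) (P : probability T R) (Y : I -> T -> R)
    (P' : probability T' R) (Y' : I -> T' -> R) : Prop :=
  forall A : set (g_sigma_algebraType (@cylinders I)), measurable A ->
    pushforward P (realization Y) A = pushforward P' (realization Y') A.

Definition mutually_independent d (T : measurableType d) (P : probability T R)
    (I : choiceType) (F : I -> set_system T) : Prop :=
  forall (J : {fset I}) (E : I -> set T),
    (forall i, i \in J -> F i (E i)) ->
    P (\bigcap_(i in [set` J]) E i) = (\prod_(i <- J) P (E i))%E.

Definition fields_coefs_independent d (T : measurableType d)
    (P : probability T R) (L : choiceType) (I : Type)
    (Z : L -> I -> T -> R) (a : L -> T -> R) : Prop :=
  mutually_independent P (fun x : (L + L)%type =>
    match x with
    | inl l => g_sigma_algebra_preimage (realization (Z l))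
    | inr l => g_sigma_algebra_preimage (a l)
    end).

End RandomFamilies.

Section LinearFields.
Context {R : realType} {dim : nat} {d : measure_display} {T : measurableType d}.
Implicit Type P : probability T R.

Definition norm1 (j : 'rV[int]_dim) : R := \sum_m `|(j 0 m)%:~R|.

Definition stationary P (Y : 'rV[int]_dim -> T -> R) : Prop :=
  forall t, same_law P Y P (fun j => Y (j + t)).

(* White noise is meant in the strong sense: the values at distinct sites are
   independent, not merely uncorrelated. *)
Definition white_noise P (W : 'rV[int]_dim -> {RV P >-> R}) : Prop :=
  [/\ stationary P W,
      mutually_independent P (fun j => g_sigma_algebra_preimage (W j)),
      forall j, ('E_P[W j] = 0)%E,
      forall j, ('E_P[fun t => (`|W j t| ^+ 2)%R] = 1)%E &
      forall j, ('E_P[fun t => (`|W j t| ^+ 4)%R] < +oo)%E].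

Definition linear_field P (Y : 'rV[int]_dim -> {RV P >-> R}) : Prop :=
  stationary P Y /\
  exists (W : 'rV[int]_dim -> {RV P >-> R}) (psi : 'rV[int]_dim -> R),
    [/\ white_noise W,
        (\esum_(j in [set: 'rV[int]_dim])
            (`|psi j| * Num.sqrt (norm1 j))%:E < +oo)%E &
        forall i, {ae P, forall t,
          partial_sum (fun j => W j t * psi (i - j) : R^o) @ totally
            --> (Y i t : R^o)}].

End LinearFields.

Section Spectra.
Context {R : realType} {dim : nat}.
Local Open Scope complex_scope.

(* exp (- 2 pi i <xi, j>) *)
Definition fourier_char (xi : 'rV[R]_dim) (j : 'rV[int]_dim) : R[i] :=
  let theta := - (2 * pi * \sum_m xi 0 m * (j 0 m)%:~R) in
  cos theta +i* sin theta.

(* By stationarity the base site of the autocovariance is irrelevant; it is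
   taken to be the origin. *)
Definition autocov d (T : measurableType d) (P : probability T R)
    (Y : 'rV[int]_dim -> T -> R) (j : 'rV[int]_dim) : R :=
  fine ('E_P[fun t => (Y 0 t * Y j t)%R])%E.

(* The autocovariance is even, so the sum of the series is real. *)
Definition power_spectrum d (T : measurableType d) (P : probability T R)
    (Y : 'rV[int]_dim -> T -> R) (xi : 'rV[R]_dim) : R :=
  complex.Re (sum (fun j => (autocov P Y j)%:C * fourier_char xi j : R[i]^o)).

Definition mixture (T : Type) (r : nat) (a : 'I_r -> T -> R)
    (Z : 'I_r -> 'rV[int]_dim -> T -> R) : 'rV[int]_dim -> T -> R :=
  fun i t => \sum_(l < r) a l t * Z l i t.

(* The conditional expectation given the coefficients, which are independent of
   the fields, is the expectation over the fields with the coefficients frozen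
   at their values [alpha]. *)
Definition cond_power_spectrum d (T : measurableType d) (P : probability T R)
    (r : nat) (Z : 'I_r -> 'rV[int]_dim -> T -> R) (alpha : 'I_r -> R)
    (xi : 'rV[R]_dim) : R :=
  power_spectrum P (mixture (fun l _ => alpha l) Z) xi.

Definition box (N : nat) : set 'rV[int]_dim :=
  [set k | forall m, - (uphalf N)%:Z + 1 <= k 0 m <= (N./2)%:Z].

Definition eqmodN (N : nat) (k k' : 'rV[int]_dim) : Prop :=
  forall m, (k ord0 m = k' ord0 m %[mod N%:Z])%Z.

Definition half_box (N : nat) (M : set 'rV[int]_dim) : Prop :=
  [/\ M `<=` box N,
      forall k, box N k -> exists2 k', M k' & eqmodN N k' k \/ eqmodN N (- k') k &
      forall k k', M k -> M k' -> eqmodN N k (- k') -> eqmodN N k (- k)].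

Definition grid_freq (N : nat) (k : 'rV[int]_dim) : 'rV[R]_dim :=
  \row_m ((k 0 m)%:~R / N%:R).

Definition periodogram (N : nat) (y : 'rV[int]_dim -> R) (k : 'rV[int]_dim) : R :=
  (N ^ dim)%:R^-1 *
  complex.Re (`| \sum_(i \in box N) (y i)%:C * fourier_char (grid_freq N k) i |) ^+ 2.

Definition deltaN (N : nat) (k1 k2 : 'rV[int]_dim) : R :=
  if k1 == k2 then
    if `[< forall m, exists z : int, (k1 0 m)%:~R = N%:R / 2 * z%:~R :> R >]
    then 2 else 1
  else 0.

Definition mean_periodogram (T : Type) (n N : nat)
    (X : 'I_n -> 'rV[int]_dim -> T -> R) (k : 'rV[int]_dim) (t : T) : R :=
  n%:R^-1 * \sum_(s < n) periodogram N (fun i => X s i t) k.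

Definition second_moment_periodogram (T : Type) (n N : nat)
    (X : 'I_n -> 'rV[int]_dim -> T -> R) (k1 k2 : 'rV[int]_dim) (t : T) : R :=
  n%:R^-1 * \sum_(s < n)
    periodogram N (fun i => X s i t) k1 * periodogram N (fun i => X s i t) k2.

End Spectra.

(* The copies live on a probability space of their own. *)
Definition iid_copies {R : realType} {dim r n : nat}
    d0 (T0 : measurableType d0) (P0 : probability T0 R)
    (Z0 : 'I_r -> 'rV[int]_dim -> {RV P0 >-> R}) (a0 : 'I_r -> {RV P0 >-> R})
    d (T : measurableType d) (P : probability T R)
    (Z : 'I_n -> 'I_r -> 'rV[int]_dim -> {RV P >-> R})
    (a : 'I_n -> 'I_r -> {RV P >-> R}) : Prop :=
  [/\ forall s l, same_law P (Z s l) P0 (Z0 l),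
      forall s l (B : set R), measurable B ->
        distribution P (a s l) B = distribution P0 (a0 l) B &
      fields_coefs_independent P (fun sl : 'I_n * 'I_r => Z sl.1 sl.2)
        (fun sl => a sl.1 sl.2)].

(* Main.v *)
(* The periodogram of X_s at k is the sum, over f in {cos, sin} of the phase of
   k / N, of the squares of sum_l a_(s,l) A_l(f), where A_l(f) is the linear form
   N^(-d/2) sum_i f(i) Z_(s,l)[i] over the box.

   Bias. The weight |j|^(1/2) on the kernel makes the covariance of A_l(f) and
   A_l(g), for g at frequency k, equal to P_(Z_l)(k / N) times the normalised
   inner product of f and g up to O(N^(-1/2)); the fourth cumulants of the A_l(f)
   are O(N^(-d)). For k1, k2 in a half box, twice the sum of the squares of the
   four inner products is delta_N[k1, k2], so that the mean of the product of two
   periodograms is (1 + delta_N) E[P_(X|a)(k1 / N) P_(X|a)(k2 / N)] + O(N^(-1/2)).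

   Sampling. The periodogram is square integrable, so mu_n deviates from its mean
   by O(n^(-1/2)). The product of two periodograms need not be, the noise having
   only four moments; but clipping the noise at N^(1/2) bounds A_l(f)^4 by a part
   of mean O(N^(-1/2)) plus a part bounded in L^2, which suffices for C_n once the
   product is truncated at n^(1/2). *)

Require Import Defs.
From HB Require Import structures.
From mathcomp Require Import all_boot all_order all_algebra.
From mathcomp Require Import finmap complex.
From mathcomp Require Import all_classical all_reals all_analysis.
From mathcomp Require Import measurable_realfun summability zify ring lra.

Set Implicit Arguments.
Unset Strict Implicit.
Unset Printing Implicit Defensive.
Import Order.TTheory GRing.Theory Num.Theory.
Import numFieldNormedType.Exports.

Local Open Scope classical_set_scope.
Local Open Scope ring_scope.

(** * Expectation and independence *)

(** A field is an infinite series in the noise, so its moments are not computed directly: each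
    estimate is proved for finite partial sums, with constants free of their length, and passes to
    the limit by dominated convergence, the majorant of the fourth powers coming from the
    summability of the kernel. This is why the truncation is expressed by expectations of continuous
    functions, [light] and [heavy], of [A_l(f)^4] and not by a splitting of the field: such
    expectations survive limits and, being functionals of the law, also pass to the copies, which
    are given by their law alone.

    The covariance of the conditional spectra emerges from cumulants. An independent factor [a_l]
    multiplies the fourth moment of [A_l] by [E a_l^4], but products of two covariances by
    [(E a_l^2)^2]. Once the cumulants of the fields are discarded, the cumulant of [a_l A_l] is
    therefore [Var(a_l^2)] times the three pairings of covariances; summed over [l], this is what
    [C_n] shows beyond the product of the means, up to the factor [1 + delta_N]. *)

Definition integrableR {R : realType} d (T : measurableType d)
  (P : probability T R) (X : T -> R) : Prop :=
  P.-integrable setT (EFin \o X).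

Notation "''Er_' P [ X ]" := (Rintegral P setT X)
  (at level 5, P, X at level 4, format "''Er_' P [ X ]") : ring_scope.

Section RealExpectation.
Context {R : realType} {d : measure_display} {T : measurableType d}.
Variable P : probability T R.
Implicit Types X Y : T -> R.

(** The bridge to the extended-real expectation of the statement: [Rintegral] reads the integral
    through [fine], so it represents the expectation only for integrable variables. *)
Lemma integrableR_fin X : integrableR P X -> ('E_P[X] = ('Er_P[X])%:E)%E.
Proof.
move=> iX; rewrite unlock /Rintegral fineK//.
exact: integrable_fin_num.
Qed.

Lemma integrableR_cst (c : R) : integrableR P (cst c).
Proof. exact: finite_measure_integrable_cst. Qed.

Lemma integrableRD X Y : integrableR P X -> integrableR P Y ->
  integrableR P (fun t => X t + Y t).
Proof. by move=> iX iY; have := integrableD measurableT iX iY; apply. Qed.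

Lemma integrableRZ c X : integrableR P X -> integrableR P (fun t => c * X t).
Proof. by move=> iX; have := integrableZl measurableT c iX; apply. Qed.

Lemma integrableRN X : integrableR P X -> integrableR P (fun t => - X t).
Proof.
move=> iX; under [X in integrableR P X]funext do rewrite -mulN1r.
exact: integrableRZ.
Qed.

Lemma integrableRB X Y : integrableR P X -> integrableR P Y ->
  integrableR P (fun t => X t - Y t).
Proof. by move=> iX iY; apply: integrableRD => //; exact: integrableRN. Qed.

Lemma integrableR_sum (I : Type) (s : seq I) (Q : pred I) (X : I -> T -> R) :
  (forall i, Q i -> integrableR P (X i)) ->
  integrableR P (fun t => \sum_(i <- s | Q i) X i t).
Proof.
move=> iX; elim: s => [|i s ih].
  by under [X in integrableR P X]funext do rewrite big_nil; exact: integrableR_cst.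
under [X in integrableR P X]funext do rewrite big_cons.
by case: (boolP (Q i)) => // Qi; exact: integrableRD (iX _ Qi) ih.
Qed.

Lemma integrableR_le X Y : measurable_fun setT X -> integrableR P Y ->
  (forall t, `|X t| <= Y t) -> integrableR P X.
Proof.
move=> mX iY XY; apply: (le_integrable _ _ _ iY) => //.
  exact/measurable_EFinP.
by move=> t _ /=; rewrite lee_fin (le_trans (XY t))// ler_norm.
Qed.

Lemma integrableR_norm X : integrableR P X -> integrableR P (fun t => `|X t|).
Proof. by move=> iX; have := integrable_abse iX; apply. Qed.

Lemma integrableR_bounded X (M : R) : measurable_fun setT X ->
  (forall t, `|X t| <= M) -> integrableR P X.
Proof. by move=> mX XM; exact: integrableR_le mX (integrableR_cst M) XM. Qed.

Lemma eq_Er X Y : X =1 Y -> 'Er_P[X] = 'Er_P[Y].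
Proof. by move=> /funext ->. Qed.

Lemma eq_integrableR X Y : X =1 Y -> integrableR P X -> integrableR P Y.
Proof. by move=> /funext ->. Qed.

Lemma Er_cst (c : R) : 'Er_P[cst c] = c.
Proof. by rewrite [LHS]Rintegral_cst//= probability_setT mulr1. Qed.

Lemma ErD X Y : integrableR P X -> integrableR P Y ->
  'Er_P[fun t => X t + Y t] = 'Er_P[X] + 'Er_P[Y].
Proof. by move=> iX iY; apply: RintegralD. Qed.

Lemma ErB X Y : integrableR P X -> integrableR P Y ->
  'Er_P[fun t => X t - Y t] = 'Er_P[X] - 'Er_P[Y].
Proof. by move=> iX iY; apply: RintegralB. Qed.

Lemma ErZ c X : integrableR P X -> 'Er_P[fun t => c * X t] = c * 'Er_P[X].
Proof. by move=> iX; apply: RintegralZl. Qed.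

Lemma Er_sum (I : Type) (s : seq I) (Q : pred I) (X : I -> T -> R) :
  (forall i, Q i -> integrableR P (X i)) ->
  'Er_P[fun t => \sum_(i <- s | Q i) X i t] = \sum_(i <- s | Q i) 'Er_P[X i].
Proof.
move=> iX; elim: s => [|i s ih].
  rewrite big_nil -[RHS]Er_cst; congr Rintegral; apply/funext => t.
  by rewrite big_nil.
rewrite big_cons; under [X in 'Er_P[X]]funext do rewrite big_cons.
case: (boolP (Q i)) => // Qi; rewrite ErD ?ih//; first exact: iX.
exact: integrableR_sum.
Qed.

Lemma Er_ge0 X : (forall t, 0 <= X t) -> 0 <= 'Er_P[X].
Proof. by move=> X0; apply: Rintegral_ge0. Qed.

Lemma le_Er X Y : integrableR P X -> integrableR P Y ->
  (forall t, X t <= Y t) -> 'Er_P[X] <= 'Er_P[Y].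
Proof. by move=> iX iY XY; apply: le_Rintegral. Qed.

Lemma normr_Er X : integrableR P X -> `|'Er_P[X]| <= 'Er_P[fun t => `|X t|].
Proof. by move=> iX; apply: le_normr_Rintegral. Qed.

Lemma integrableR_ge0 X : measurable_fun setT X -> (forall t, 0 <= X t) ->
  ('E_P[X] < +oo)%E -> integrableR P X.
Proof.
move=> mX X0; rewrite unlock => EX; apply/integrableP; split.
  exact/measurable_EFinP.
by under eq_integral => t _ do rewrite /= ger0_norm//.
Qed.

(** AM-GM twice: [2 |a b c e| <= (a b)^2 + (c e)^2] and [2 (a b)^2 <= a^4 + b^4]; the squares handed
    to [lra] encode these. *)
Lemma integrableR_mul4 X1 X2 X3 X4 :
  measurable_fun setT X1 -> measurable_fun setT X2 ->
  measurable_fun setT X3 -> measurable_fun setT X4 ->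
  integrableR P (fun t => X1 t ^+ 4) -> integrableR P (fun t => X2 t ^+ 4) ->
  integrableR P (fun t => X3 t ^+ 4) -> integrableR P (fun t => X4 t ^+ 4) ->
  integrableR P (fun t => X1 t * X2 t * X3 t * X4 t).
Proof.
move=> m1 m2 m3 m4 i1 i2 i3 i4.
apply: (@integrableR_le _ (fun t => X1 t ^+ 4 + X2 t ^+ 4 + X3 t ^+ 4 + X4 t ^+ 4)).
- by repeat apply: measurable_funM.
- by repeat apply: integrableRD.
- move=> t; have p4 (x : R) : 0 <= x ^+ 4 by rewrite (exprM x 2 2) sqr_ge0.
  have := (sqr_ge0 (X1 t * X2 t - X3 t * X4 t),
           sqr_ge0 (X1 t * X2 t + X3 t * X4 t),
           sqr_ge0 (X1 t ^+ 2 - X2 t ^+ 2), sqr_ge0 (X3 t ^+ 2 - X4 t ^+ 2)).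
  have := (p4 (X1 t), p4 (X2 t), p4 (X3 t), p4 (X4 t)).
  move: (X1 t) (X2 t) (X3 t) (X4 t) => a b c e [[[h1 h2] h3] h4] [[[g1 g2] g3] g4].
  by rewrite ler_norml; apply/andP; split; lra.
Qed.

End RealExpectation.

(** * Independence of disjoint blocks of sources *)

Definition join_sigma (T I : Type) (F : I -> set_system T) (J : set I) :
  set_system T := \bigcup_(x in J) F x.

Section Independence.
Context {R : realType} {d : measure_display} {T : measurableType d}.
Variables (P : probability T R) (I : choiceType) (F : I -> set_system T).
Hypothesis FI : forall i, setI_closed (F i).
Hypothesis FT : forall i, F i setT.
Hypothesis Fm : forall i, F i `<=` measurable.
Hypothesis indF : mutually_independent P F.

Local Notation sg J := (<<s join_sigma F J >>).

(** [join_sigma] only unites generators and is not stable under intersection across indices; finite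
    intersections form a pi-system with the same generated sigma-algebra. *)
Let cyl (J : set I) : set_system T := [set A | exists (K : {fset I}) (E : I -> set T),
  [/\ [set` K] `<=` J, forall i, i \in K -> F i (E i) &
      A = \bigcap_(i in [set` K]) E i]].

Let cylI J : setI_closed (cyl J).
Proof.
move=> _ _ [K1 [E1 [K1J FE1 ->]]] [K2 [E2 [K2J FE2 ->]]].
exists (K1 `|` K2)%fset.
exists (fun i => (if i \in K1 then E1 i else setT) `&`
                 (if i \in K2 then E2 i else setT)); split.
- by move=> i /=; rewrite in_fsetU => /orP[/K1J|/K2J].
- move=> i _; apply: FI.
    by case: ifPn => [/FE1//|_]; exact: FT.
  by case: ifPn => [/FE2//|_]; exact: FT.
- apply/seteqP; split => t /=.
    move=> [h1 h2] i _; split; case: ifPn => //; [exact: h1|exact: h2].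
  move=> h; split => i /= iK.
    by have := h i; rewrite /= in_fsetU iK => /(_ isT)[].
  by have := h i; rewrite /= in_fsetU iK orbT => /(_ isT)[].
Qed.

Let cyl_measurable J : cyl J `<=` measurable.
Proof.
move=> _ [K [E [_ FE ->]]]; apply: fin_bigcap_measurable => //.
by move=> i /= iK; exact/Fm/FE.
Qed.

Let sub_cyl J : join_sigma F J `<=` cyl J.
Proof.
move=> A [i Ji FA]; exists [fset i]%fset, (fun=> A); split.
- by move=> j /=; rewrite in_fset1 => /eqP ->.
- by move=> j; rewrite in_fset1 => /eqP ->.
- apply/seteqP; split => t /=; first by move=> At j _.
  by move=> /(_ i); apply; rewrite /= in_fset1.
Qed.

Let cyl_sg J : <<s join_sigma F J >> = <<s cyl J >>.
Proof.
apply/seteqP; split.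
  apply: smallest_sub; first exact: smallest_sigma_algebra.
  by move=> A /sub_cyl; exact: sub_sigma_algebra.
apply: smallest_sub; first exact: smallest_sigma_algebra.
move=> _ [K [E [KJ FE ->]]].
have sgi i : i \in K -> sg J (E i).
  by move=> iK; apply: sub_sigma_algebra; exists i; [exact: KJ|exact: FE].
exact: (@fin_bigcap_measurable _ (g_sigma_algebraType (join_sigma F J)) _ _ E).
Qed.

Lemma join_sigma_measurable J : sg J `<=` measurable.
Proof.
apply: smallest_sub; first exact: sigma_algebra_measurable.
by move=> A [i _]; exact: Fm.
Qed.

Let indep_lambda (B : set T) : measurable B ->
  lambda_system setT [set A | measurable A /\ P (A `&` B) = (P A * P B)%E].
Proof.
move=> mB; apply/dynkin_lambda_system; split => /=.
- by split => //; rewrite setTI probability_setT mul1e.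
- move=> A [mA PAB]; split; first exact: measurableC.
  rewrite probability_setC// muleBl ?fin_num_measure//; last first.
  rewrite mul1e -PAB setIC -setDE measureD//; last first.
    by rewrite ltey_eq fin_num_measure.
  by rewrite setIC.
- move=> A tA h; split; first by apply: bigcup_measurable => k _; case: (h k).
  rewrite setI_bigcupl !measure_bigcup//=; first last.
  + exact: trivIset_setIr.
  + by move=> k _; apply: measurableI => //; case: (h k).
  + by move=> k _; case: (h k).
  rewrite muleC -[P B]fineK ?fin_num_measure// -nneseriesZl; last by [].
  apply: eq_eseriesr => k _.
  by case: (h k) => _ ->; rewrite muleC fineK ?fin_num_measure.
Qed.

(** Two applications of the pi-lambda theorem. [step1] is independence on cylinders, whose finite
    index sets are disjoint, so that the product of probabilities splits. [step2] extends the left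
    event to [sg J1] while the right one is still a cylinder, and the last application extends the
    right event. *)
Lemma indep_join_sigma J1 J2 A B : J1 `&` J2 = set0 -> sg J1 A -> sg J2 B ->
  P (A `&` B) = (P A * P B)%E.
Proof.
move=> J12; rewrite !cyl_sg => sA sB.
have mB : measurable B by move: sB; rewrite -cyl_sg; exact: join_sigma_measurable.
have step1 : forall A B, cyl J1 A -> cyl J2 B -> P (A `&` B) = (P A * P B)%E.
  move=> _ _ [K1 [E1 [K1J FE1 ->]]] [K2 [E2 [K2J FE2 ->]]].
  have K12 : [disjoint K1 & K2]%fset.
    apply/fdisjointP => i iK1; apply/negP => iK2.
    by have : (J1 `&` J2) i by [split; [exact: K1J|exact: K2J]]; rewrite J12.
  rewrite (indF FE1) (indF FE2).
  have -> : (\bigcap_(i in [set` K1]) E1 i) `&` (\bigcap_(i in [set` K2]) E2 i)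
      = \bigcap_(i in [set` (K1 `|` K2)%fset]) (if i \in K1 then E1 i else E2 i).
    apply/seteqP; split => t /=.
      move=> [h1 h2] i /=; rewrite in_fsetU; case: ifPn => [iK1 _|_ /= iK2].
        exact: h1.
      exact: h2.
    move=> h; split => i /= iK.
      by have := h i; rewrite /= in_fsetU iK => /(_ isT).
    have := h i; rewrite /= in_fsetU iK orbT => /(_ isT).
    by rewrite (negbTE (fdisjointP_sym K12 _ iK)).
  rewrite indF; last first.
    move=> i; rewrite in_fsetU; case: ifPn => [iK1 _|_ /= iK2].
      exact: FE1.
    exact: FE2.
  rewrite (@perm_big _ _ _ _ _ (K1 ++ K2)) ?big_cat; last first.
    apply: uniq_perm => [||i]; last by rewrite in_fsetU mem_cat.
      exact: fset_uniq.
    rewrite cat_uniq !fset_uniq andbT; apply/hasPn => i iK2.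
    exact: fdisjointP_sym K12 _ iK2.
  congr (_ * _)%E; apply: eq_big_seq => i iK.
    by rewrite iK.
  by rewrite (negbTE (fdisjointP_sym K12 _ iK)).
have step2 : forall A, sg J1 A -> forall B, cyl J2 B -> P (A `&` B) = (P A * P B)%E.
  move=> A' + B' cB; rewrite cyl_sg => sA'.
  have := @lambda_system_subset _ (cyl J1) (@cylI J1) setT _
    (indep_lambda (cyl_measurable cB)).
  move=> /(_ _ _ A' sA')[]// X cX; split; first exact: cyl_measurable cX.
  exact: step1.
have mA : measurable A by move: sA; rewrite -cyl_sg; exact: join_sigma_measurable.
have := @lambda_system_subset _ (cyl J2) (@cylI J2) setT _ (indep_lambda mA).
move=> /(_ _ _ B sB)[]//; last by move=> _; rewrite setIC muleC.
move=> X cX; split; first exact: cyl_measurable cX.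
by rewrite setIC muleC step2// cyl_sg.
Qed.

(** Plays the role of being a function of the sources indexed by [J]. *)
Definition join_measurable (J : set I) (X : T -> R) : Prop :=
  measurable_fun [set: g_sigma_algebraType (join_sigma F J)] X.

Lemma join_measurable_meas J X : join_measurable J X -> measurable_fun setT X.
Proof.
move=> mX _ B mB; rewrite setTI; apply: (@join_sigma_measurable J).
by have := mX measurableT B mB; rewrite setTI.
Qed.

Lemma sub_join_measurable J1 J2 X : J1 `<=` J2 ->
  join_measurable J1 X -> join_measurable J2 X.
Proof.
move=> J12 mX _ B mB; have := mX measurableT B mB; rewrite !setTI.
apply: smallest_sub; first exact: smallest_sigma_algebra.
by move=> A [i Ji FA]; apply: sub_sigma_algebra; exists i => //; exact: J12.
Qed.

Lemma join_measurable1 i (X : T -> R) :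
  (forall B, measurable B -> F i (X @^-1` B)) -> join_measurable [set i] X.
Proof.
move=> FX _ B mB; rewrite setTI; apply: sub_sigma_algebra.
by exists i => //; exact: FX.
Qed.

Lemma join_measurable_cst J (c : R) : join_measurable J (cst c).
Proof. exact: measurable_cst. Qed.

Lemma join_measurableD J (X Y : T -> R) : join_measurable J X ->
  join_measurable J Y -> join_measurable J (fun t => X t + Y t).
Proof. by move=> *; exact: measurable_funD. Qed.

Lemma join_measurableM J (X Y : T -> R) : join_measurable J X ->
  join_measurable J Y -> join_measurable J (fun t => X t * Y t).
Proof. by move=> *; exact: measurable_funM. Qed.

Lemma join_measurable_comp J (X : T -> R) (f : R -> R) :
  measurable_fun setT f -> join_measurable J X ->
  join_measurable J (fun t => f (X t)).
Proof. by move=> *; exact: measurableT_comp. Qed.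

Lemma join_measurable_sum J (K : Type) (s : seq K) (u : K -> T -> R) :
  (forall k, join_measurable J (u k)) ->
  join_measurable J (fun t => \sum_(k <- s) u k t).
Proof.
move=> mu; elim: s => [|k s ih].
  by under [X in join_measurable _ X]funext do rewrite big_nil;
    exact: join_measurable_cst.
under [X in join_measurable _ X]funext do rewrite big_cons.
exact: join_measurableD.
Qed.

Lemma join_measurable_blocks (L : eqType) (J : L -> set I) (s : seq L)
    (u : L -> T -> R) : (forall l, join_measurable (J l) (u l)) ->
  join_measurable (\bigcup_(l in [set` s]) J l) (fun t => \sum_(l <- s) u l t).
Proof.
move=> mu; elim: s => [|i s ih].
  by under [X in join_measurable _ X]funext do rewrite big_nil;
    exact: join_measurable_cst.
under [X in join_measurable _ X]funext do rewrite big_cons.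
apply: join_measurableD.
  by apply: sub_join_measurable (mu i) => j Jij; exists i; rewrite /= ?mem_head.
apply: sub_join_measurable ih => j [l /= ls Jlj]; exists l => //=.
by rewrite in_cons ls orbT.
Qed.

Lemma join_measurable_seq (s : seq I) (u : I -> T -> R) :
  (forall i, join_measurable [set i] (u i)) ->
  join_measurable [set` s] (fun t => \sum_(i <- s) u i t).
Proof.
move=> mu; apply: sub_join_measurable (@join_measurable_blocks I (fun i => [set i]) s u mu).
by move=> j [l /= ls ->].
Qed.

Section product_expectation.
Variables (J1 J2 : set I) (X Y : T -> R).
Hypotheses (J12 : J1 `&` J2 = set0).
Hypotheses (mX : join_measurable J1 X) (mY : join_measurable J2 Y).
Hypotheses (iX : integrableR P X) (iY : integrableR P Y).

Let mX' : measurable_fun setT X := join_measurable_meas mX.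
Let mY' : measurable_fun setT Y := join_measurable_meas mY.
Let X' : {mfun T >-> R} := HB.pack X (isMeasurableFun.Build _ _ _ _ X mX').
Let Y' : {mfun T >-> R} := HB.pack Y (isMeasurableFun.Build _ _ _ _ Y mY').
Let XY t := (X t, Y t).
Let mXY : measurable_fun setT XY.
Proof. exact/measurable_fun_pair. Qed.
Let XY' : {mfun T >-> (R * R)%type} := HB.pack XY (isMeasurableFun.Build _ _ _ _ XY mXY).

(** Rectangles determine the product measure, and on a rectangle this is [indep_join_sigma]. *)
Let joint A : measurable A ->
  (distribution P X' \x distribution P Y')%E A = distribution P XY' A.
Proof.
move=> mA; apply: product_measure_unique => // A1 A2 mA1 mA2.
rewrite /distribution /pushforward /= -(indep_join_sigma J12).
- by congr (P _); apply/seteqP; split => t.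
- by have := @mX measurableT _ mA1; rewrite setTI.
- by have := @mY measurableT _ mA2; rewrite setTI.
Qed.

Let iX1 : (distribution P X').-integrable setT (EFin \o id).
Proof. by apply: (@integrable_pushforward _ _ _ _ _ _ mX' P setT (EFin \o id) _ iX) => //;
  exact/measurable_EFinP. Qed.

Let iY1 : (distribution P Y').-integrable setT (EFin \o id).
Proof. by apply: (@integrable_pushforward _ _ _ _ _ _ mY' P setT (EFin \o id) _ iY) => //;
  exact/measurable_EFinP. Qed.

(** Tonelli on the product of the two laws factors [E|XY|] as [E|X| E|Y|]; with integrability known,
    Fubini then gives the factorisation of the mean in [indep_ErM]. *)
Lemma indep_integrableM : integrableR P (fun t => X t * Y t).
Proof.
apply/integrableP; split.
  by apply/measurable_EFinP; apply: measurable_funM.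
have mf : measurable_fun setT (fun z : R * R => `|z.1 * z.2|%:E).
  apply/measurable_EFinP; apply: measurableT_comp => //.
  by apply: measurable_funM; [exact: measurable_fst|exact: measurable_snd].
have -> : (\int[P]_x `|(X x * Y x)%:E| =
    \int[distribution P XY']_z `|z.1 * z.2|%:E)%E.
  by rewrite ge0_integral_distribution.
rewrite -(eq_measure_integral _ (fun A mA _ => joint mA)) fubini_tonelli1//.
rewrite /fubini_F /=.
under eq_integral => x _.
  under eq_integral => y _ do rewrite normrM EFinM.
  rewrite ge0_integralZl//; first over.
    by apply/measurable_EFinP; exact: normr_measurable.
under eq_integral => x _ do rewrite muleC.
have /integrableP[_ fX] := iX1; have /integrableP[_ fY] := iY1.
rewrite /= in fX fY.
have cX : (0 <= \int[distribution P X']_x `|x|%:E)%E.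
  by apply: integral_ge0 => x _; rewrite lee_fin.
have cY : (0 <= \int[distribution P Y']_x `|x|%:E)%E.
  by apply: integral_ge0 => x _; rewrite lee_fin.
rewrite ge0_integralZl//; last by apply/measurable_EFinP; exact: normr_measurable.
by apply: lte_mul_pinfty => //; rewrite ge0_fin_numE.
Qed.

Lemma indep_ErM : 'Er_P[fun t => X t * Y t] = 'Er_P[X] * 'Er_P[Y].
Proof.
have mf : measurable_fun setT (fun z : R * R => (z.1 * z.2)%:E).
  apply/measurable_EFinP.
  by apply: measurable_funM; [exact: measurable_fst|exact: measurable_snd].
have iM : (distribution P XY').-integrable setT (fun z : R * R => (z.1 * z.2)%:E).
  exact: (integrable_pushforward mXY mf indep_integrableM).
have iM' : (distribution P X' \x distribution P Y')%E.-integrable setT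
    (fun z : R * R => (z.1 * z.2)%:E).
  apply/integrableP; split => //.
  rewrite (eq_measure_integral _ (fun A mA _ => joint mA)).
  by have /integrableP[] := iM.
rewrite {1}/Rintegral.
have -> : (\int[P]_x (X x * Y x)%:E =
    \int[distribution P XY']_z (z.1 * z.2)%:E)%E.
  by rewrite integral_distribution//; exact: indep_integrableM.
rewrite -(eq_measure_integral _ (fun A mA _ => joint mA)).
have eX : (\int[distribution P X']_x x%:E = ('Er_P[X])%:E)%E.
  rewrite -integrableR_fin// unlock integral_distribution//.
have eY : (\int[distribution P Y']_x x%:E = ('Er_P[Y])%:E)%E.
  rewrite -integrableR_fin// unlock integral_distribution//.
rewrite -integral12_prod_meas1// /fubini_F /=.
under eq_integral => x _.
  have -> : (\int[distribution P Y']_y (x * y)%:E = x%:E * ('Er_P[Y])%:E)%E.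
    rewrite -eY -integralZl//.
  over.
under eq_integral => x _ do rewrite muleC.
by rewrite integralZl// eX -EFinM mulrC.
Qed.

End product_expectation.

End Independence.

(** * Fourth moments *)

Section FourthMoments.
Context {R : realType} {d : measure_display} {T : measurableType d}.
Variable P : probability T R.
Implicit Types X Y : T -> R.

Definition L4 X : Prop :=
  measurable_fun setT X /\ integrableR P (fun t => X t ^+ 4).

Lemma L4_mul4 X1 X2 X3 X4 : L4 X1 -> L4 X2 -> L4 X3 -> L4 X4 ->
  integrableR P (fun t => X1 t * X2 t * X3 t * X4 t).
Proof.
move=> [m1 i1] [m2 i2] [m3 i3] [m4 i4]; exact: integrableR_mul4.
Qed.

Lemma L4_cst (c : R) : L4 (cst c).
Proof. by split => //; exact: (integrableR_cst P (c ^+ 4)). Qed.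

Lemma L4_mul3 X1 X2 X3 : L4 X1 -> L4 X2 -> L4 X3 ->
  integrableR P (fun t => X1 t * X2 t * X3 t).
Proof.
move=> i1 i2 i3; have := L4_mul4 i1 i2 i3 (L4_cst 1).
by under [X in integrableR P X -> _]funext do rewrite /= mulr1.
Qed.

Lemma L4_mul2 X1 X2 : L4 X1 -> L4 X2 -> integrableR P (fun t => X1 t * X2 t).
Proof.
move=> i1 i2; have := L4_mul3 i1 i2 (L4_cst 1).
by under [X in integrableR P X -> _]funext do rewrite /= mulr1.
Qed.

Lemma L4_integrable X : L4 X -> integrableR P X.
Proof.
move=> i1; have := L4_mul2 i1 (L4_cst 1).
by under [X in integrableR P X -> _]funext do rewrite /= mulr1.
Qed.

Lemma L4D X Y : L4 X -> L4 Y -> L4 (fun t => X t + Y t).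
Proof.
move=> [mX iX] [mY iY]; split; first exact: measurable_funD.
apply: (@integrableR_le _ _ _ P _ (fun t => 8 * (X t ^+ 4 + Y t ^+ 4))).
- by apply: measurable_funX; exact: measurable_funD.
- by apply: integrableRZ; exact: integrableRD.
- move=> t; rewrite ger0_norm; last by rewrite (exprM _ 2 2) sqr_ge0.
  have := (sqr_ge0 (X t - Y t), sqr_ge0 (X t ^+ 2 - Y t ^+ 2),
    sqr_ge0 (X t - Y t) , sqr_ge0 ((X t - Y t) ^+ 2), sqr_ge0 (X t * (X t - Y t)),
    sqr_ge0 (Y t * (X t - Y t))).
  by move: (X t) (Y t) => x y [[[[[? ?] ?] ?] ?] ?]; lra.
Qed.

Lemma L4Z c X : L4 X -> L4 (fun t => c * X t).
Proof.
move=> [mX iX]; split; first exact: measurable_funM.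
by under [X in integrableR P X]funext do rewrite exprMn; exact: integrableRZ.
Qed.

Lemma L4_sum (I : Type) (s : seq I) (Q : pred I) (X : I -> T -> R) :
  (forall i, Q i -> L4 (X i)) -> L4 (fun t => \sum_(i <- s | Q i) X i t).
Proof.
move=> iX; elim: s => [|i s ih].
  by under [X in L4 X]funext do rewrite big_nil; exact: L4_cst.
under [X in L4 X]funext do rewrite big_cons.
by case: (boolP (Q i)) => // Qi; exact: L4D (iX _ Qi) ih.
Qed.

Definition cov2 X Y : R := 'Er_P[fun t => X t * Y t].

(* The fourth joint cumulant of [X, X, Y, Y] for centred [X], [Y]. *)
Definition kappa X Y : R := 'Er_P[fun t => X t * X t * Y t * Y t]
  - cov2 X X * cov2 Y Y - 2 * cov2 X Y ^+ 2.

Variables (I : choiceType) (F : I -> set_system T).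
Hypothesis FI : forall i, setI_closed (F i).
Hypothesis FT : forall i, F i setT.
Hypothesis Fm : forall i, F i `<=` measurable.
Hypothesis indF : mutually_independent P F.

Local Notation jm := (join_measurable F).

Lemma cov2_add J1 J2 X Y X' Y' : J1 `&` J2 = set0 ->
  jm J1 X -> jm J1 Y -> jm J2 X' -> jm J2 Y' ->
  L4 X -> L4 Y -> L4 X' -> L4 Y' ->
  'Er_P[X] = 0 -> 'Er_P[Y] = 0 ->
  cov2 (fun t => X t + X' t) (fun t => Y t + Y' t) = cov2 X Y + cov2 X' Y'.
Proof.
move=> J12 mX mY mX' mY' iX iY iX' iY' EX EY; rewrite /cov2.
have E1 : 'Er_P[fun t => X t * Y' t] = 0.
  by rewrite (indep_ErM FI FT Fm indF J12) ?EX ?mul0r//; exact: L4_integrable.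
have E2 : 'Er_P[fun t => Y t * X' t] = 0.
  by rewrite (indep_ErM FI FT Fm indF J12) ?EY ?mul0r//; exact: L4_integrable.
have e t : (X t + X' t) * (Y t + Y' t) =
  (X t * Y t + X' t * Y' t) + (X t * Y' t + Y t * X' t) by ring.
rewrite (eq_Er _ e).
have := (L4_mul2 iX iY, L4_mul2 iX' iY', L4_mul2 iX iY', L4_mul2 iY iX').
move=> [[[? ?] ?] ?].
by rewrite !ErD ?E1 ?E2 ?addr0//; repeat apply: integrableRD.
Qed.

(** In the expansion of the fourth moment, every term containing one of the two pairs to the first
    power vanishes ([T1] to [T4]). The surviving mixed terms [T5], [T6], [T7] are those produced by
    expanding the products of covariances, so they cancel in the cumulant. *)
Lemma kappa_add J1 J2 X Y X' Y' : J1 `&` J2 = set0 ->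
  jm J1 X -> jm J1 Y -> jm J2 X' -> jm J2 Y' ->
  L4 X -> L4 Y -> L4 X' -> L4 Y' ->
  'Er_P[X] = 0 -> 'Er_P[Y] = 0 -> 'Er_P[X'] = 0 -> 'Er_P[Y'] = 0 ->
  kappa (fun t => X t + X' t) (fun t => Y t + Y' t) = kappa X Y + kappa X' Y'.
Proof.
move=> J12 mX mY mX' mY' iX iY iX' iY' EX EY EX' EY'.
rewrite {1}/kappa !(cov2_add J12)//.
have prodE U V : jm J1 U -> jm J2 V -> integrableR P U -> integrableR P V ->
  'Er_P[fun t => U t * V t] = 'Er_P[U] * 'Er_P[V].
  by move=> *; rewrite (indep_ErM FI FT Fm indF J12).
have prodI U V : jm J1 U -> jm J2 V -> integrableR P U -> integrableR P V ->
  integrableR P (fun t => U t * V t).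
  by move=> *; apply: (indep_integrableM FI FT Fm indF J12).
have [e1 e2 e3 e4] := And4 (L4_integrable iX) (L4_integrable iY)
  (L4_integrable iX') (L4_integrable iY').
have mXX := join_measurableM mX mX; have mXY := join_measurableM mX mY.
have mYY := join_measurableM mY mY; have mXX' := join_measurableM mX' mX'.
have mXY' := join_measurableM mX' mY'; have mYY' := join_measurableM mY' mY'.
have mXXY := join_measurableM mXX mY; have mXYY := join_measurableM mXY mY.
have mXXY' := join_measurableM mXX' mY'; have mXYY' := join_measurableM mXY' mY'.
have [iXX iXY iYY] := And3 (L4_mul2 iX iX) (L4_mul2 iX iY) (L4_mul2 iY iY).
have [iXX' iXY' iYY'] := And3 (L4_mul2 iX' iX') (L4_mul2 iX' iY') (L4_mul2 iY' iY').
have [iXXY iXYY] := conj (L4_mul3 iX iX iY) (L4_mul3 iX iY iY).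
have [iXXY' iXYY'] := conj (L4_mul3 iX' iX' iY') (L4_mul3 iX' iY' iY').
have T1 : 'Er_P[fun t => X t * X t * Y t * Y' t] = 0.
  by rewrite (prodE _ _ mXXY mY' iXXY e4) EY' mulr0.
have T2 : 'Er_P[fun t => X t * Y t * Y t * X' t] = 0.
  by rewrite (prodE _ _ mXYY mX' iXYY e3) EX' mulr0.
have T3 : 'Er_P[fun t => X t * (X' t * Y' t * Y' t)] = 0.
  by rewrite (prodE _ _ mX mXYY' e1 iXYY') EX mul0r.
have T4 : 'Er_P[fun t => Y t * (X' t * X' t * Y' t)] = 0.
  by rewrite (prodE _ _ mY mXXY' e2 iXXY') EY mul0r.
have T5 : 'Er_P[fun t => (X t * X t) * (Y' t * Y' t)] = cov2 X X * cov2 Y' Y'.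
  exact: (prodE _ _ mXX mYY' iXX iYY').
have T6 : 'Er_P[fun t => (Y t * Y t) * (X' t * X' t)] = cov2 Y Y * cov2 X' X'.
  exact: (prodE _ _ mYY mXX' iYY iXX').
have T7 : 'Er_P[fun t => (X t * Y t) * (X' t * Y' t)] = cov2 X Y * cov2 X' Y'.
  exact: (prodE _ _ mXY mXY' iXY iXY').
have i3 := prodI _ _ mX mXYY' e1 iXYY'.
have i4 := prodI _ _ mY mXXY' e2 iXXY'.
have i5 := prodI _ _ mXX mYY' iXX iYY'.
have i6 := prodI _ _ mYY mXX' iYY iXX'.
have i7 := prodI _ _ mXY mXY' iXY iXY'.
have i1 := L4_mul4 iX iX iY iY'.
have i2 := L4_mul4 iX iY iY iX'.
have i8 := L4_mul4 iX iX iY iY.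
have i9 := L4_mul4 iX' iX' iY' iY'.
have e t : (X t + X' t) * (X t + X' t) * (Y t + Y' t) * (Y t + Y' t) =
    ((X t * X t * Y t * Y t + X' t * X' t * Y' t * Y' t)
    + 2 * ((X t * X t * Y t * Y' t + X t * Y t * Y t * X' t)
         + (X t * (X' t * Y' t * Y' t) + Y t * (X' t * X' t * Y' t)))
    + (((X t * X t) * (Y' t * Y' t) + (Y t * Y t) * (X' t * X' t))
       + 4 * ((X t * Y t) * (X' t * Y' t)))) by ring.
rewrite (eq_Er _ e).
have a1 := integrableRD i8 i9; have a2 := integrableRD i1 i2.
have a3 := integrableRD i3 i4; have a4 := integrableRD i5 i6.
have a5 := integrableRD a2 a3; have a6 := integrableRZ 2 a5.
have a7 := integrableRZ 4 i7; have a8 := integrableRD a4 a7.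
have a9 := integrableRD a1 a6.
rewrite (ErD a9 a8) (ErD a1 a6) (ErZ 2 a5) (ErD a2 a3) (ErD i1 i2) (ErD i3 i4).
rewrite (ErD a4 a7) (ErD i5 i6) (ErZ 4 i7) (ErD i8 i9) T1 T2 T3 T4 T5 T6 T7.
by rewrite /kappa; ring.
Qed.

Section block_sums.
Variables (L : eqType) (J : L -> set I) (x y : L -> T -> R).
Hypothesis Jdisj : forall l l', l != l' -> J l `&` J l' = set0.
Hypotheses (mx : forall i, jm (J i) (x i)) (my : forall i, jm (J i) (y i)).
Hypotheses (Lx : forall i, L4 (x i)) (Ly : forall i, L4 (y i)).
Hypotheses (Ex0 : forall i, 'Er_P[x i] = 0) (Ey0 : forall i, 'Er_P[y i] = 0).

Let Er_sum0 (s : seq L) (u : L -> T -> R) : (forall i, L4 (u i)) ->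
  (forall i, 'Er_P[u i] = 0) -> 'Er_P[fun t => \sum_(i <- s) u i t] = 0.
Proof.
move=> Lu u0; rewrite Er_sum ?big1// => i _; exact: L4_integrable.
Qed.

Let step i (s : seq L) (u : L -> T -> R) :
  (fun t => \sum_(j <- i :: s) u j t) =
  (fun t => u i t + (fun t => \sum_(j <- s) u j t) t).
Proof. by apply/funext => t; rewrite big_cons. Qed.

Let disj i (s : seq L) : i \notin s -> J i `&` \bigcup_(l in [set` s]) J l = set0.
Proof.
move=> si; rewrite setI_bigcupr bigcup0// => l /= ls; apply: Jdisj.
by apply: contraNneq si => ->.
Qed.

(** Blocks [J l] rather than single indices, because a component [a_l Z_l] of the mixture depends on
    two sources, its coefficient and its field. *)
Lemma cov2_blocks (s : seq L) : uniq s ->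
  cov2 (fun t => \sum_(i <- s) x i t) (fun t => \sum_(i <- s) y i t)
  = \sum_(i <- s) cov2 (x i) (y i).
Proof.
elim: s => [_|i s ih /= /andP[si us]].
  rewrite big_nil /cov2 -[RHS](Er_cst P 0); congr Rintegral.
  by apply/funext => t; rewrite !big_nil mul0r.
rewrite !step (cov2_add (disj si))// ?big_cons ?ih//; first last.
  1,2: by apply: L4_sum.
  1,2: exact: join_measurable_blocks.
Qed.

Lemma kappa_blocks (s : seq L) : uniq s ->
  kappa (fun t => \sum_(i <- s) x i t) (fun t => \sum_(i <- s) y i t)
  = \sum_(i <- s) kappa (x i) (y i).
Proof.
elim: s => [_|i s ih /= /andP[si us]].
  have z (u : L -> T -> R) v : cov2 (fun t => \sum_(i <- [::]) u i t) v = 0.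
    rewrite -[RHS](Er_cst P 0); apply: eq_Er => t.
    by rewrite big_nil mul0r.
  rewrite big_nil /kappa !z mul0r expr0n /= mulr0 !subr0 -[RHS](Er_cst P 0).
  by apply: eq_Er => t; rewrite !big_nil !mul0r.
rewrite !step (kappa_add (disj si))// ?big_cons ?ih//; first last.
  1,2: exact: Er_sum0.
  1,2: by apply: L4_sum.
  1,2: exact: join_measurable_blocks.
Qed.

End block_sums.

Section sums.
Variables (x y : I -> T -> R).
Hypotheses (mx : forall i, jm [set i] (x i)) (my : forall i, jm [set i] (y i)).
Hypotheses (Lx : forall i, L4 (x i)) (Ly : forall i, L4 (y i)).
Hypotheses (Ex0 : forall i, 'Er_P[x i] = 0) (Ey0 : forall i, 'Er_P[y i] = 0).

Let disj (i j : I) : i != j -> [set i] `&` [set j] = set0.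
Proof. by move=> /eqP ij; apply/seteqP; split => k //= [-> /ij]. Qed.

Lemma cov2_sum (s : seq I) : uniq s ->
  cov2 (fun t => \sum_(i <- s) x i t) (fun t => \sum_(i <- s) y i t)
  = \sum_(i <- s) cov2 (x i) (y i).
Proof. by move=> us; apply: (@cov2_blocks _ (fun i => [set i])). Qed.

Lemma kappa_sum (s : seq I) : uniq s ->
  kappa (fun t => \sum_(i <- s) x i t) (fun t => \sum_(i <- s) y i t)
  = \sum_(i <- s) kappa (x i) (y i).
Proof. by move=> us; apply: (@kappa_blocks _ (fun i => [set i])). Qed.

End sums.

End FourthMoments.

(** * Truncated linear forms *)

Section Truncation.
Context {R : realType} {d : measure_display} {T : measurableType d}.
Variable P : probability T R.

(** From [1 - x <= exp(- x)] follows [exp x <= 1 / (1 - x)], and the geometric series is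
    quadratically controlled on [|x| <= 1/2]. *)
Lemma expR_le_quadratic (x : R) : `|x| <= 1 / 2 -> expR x <= 1 + x + 2 * x ^+ 2.
Proof.
rewrite ler_norml => /andP[x1 x2].
have h : 1 - x <= expR (- x) by have := expR_ge1Dx (- x).
have x0 : 0 < 1 - x by lra.
have : expR x <= (1 - x)^-1.
  by rewrite -[leLHS]invrK -expRN lef_pV2// posrE ?expR_gt0//.
move=> /le_trans; apply; rewrite -[(1 - x)^-1]mulr1 ler_pdivrMl//.
have : 0 <= x ^+ 2 * (1 - 2 * x) by rewrite mulr_ge0// ?sqr_ge0//; lra.
by rewrite !expr2; nra.
Qed.

(** The eighth power of [|x| / 8 <= exp(|x| / 8)]. *)
Lemma expr8_le_expR (x : R) : x ^+ 8 <= 8 ^+ 8 * (expR x + expR (- x)).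
Proof.
have h : (`|x| / 8) ^+ 8 <= expR `|x|.
  have -> : expR `|x| = expR (`|x| / 8) ^+ 8.
    by rewrite -expRM_natl; congr expR; field.
  apply: lerXn2r; rewrite ?nnegrE ?expR_ge0//.
  by have := expR_ge1Dx (`|x| / 8); lra.
have h2 : expR `|x| <= expR x + expR (- x).
  have := expR_ge0 x; have := expR_ge0 (- x).
  by case: (ger0P x) => _; lra.
have <- : `|x| ^+ 8 = x ^+ 8 by rewrite -normrX ger0_norm// (exprM x 4 2) sqr_ge0.
have -> : `|x| ^+ 8 = 8 ^+ 8 * (`|x| / 8) ^+ 8.
  by rewrite exprMn exprVn mulrCA divff ?mulr1// expf_neq0.
by rewrite ler_pM2l ?exprn_gt0//; exact: le_trans h h2.
Qed.

Definition clip (B w : R) : R := Num.max (- B) (Num.min B w).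

Lemma measurable_clip B : measurable_fun setT (clip B).
Proof. by apply: measurable_maxr => //; exact: measurable_minr. Qed.

Lemma clip_le B w : 0 <= B -> `|clip B w| <= B.
Proof.
move=> B0; rewrite ler_norml /clip le_max lexx /= ge_max ge_min lexx /=; lra.
Qed.

Lemma clip_le_id B w : 0 <= B -> clip B w ^+ 2 <= w ^+ 2.
Proof.
move=> B0; rewrite /clip; case: (leP B w) => h.
  by rewrite max_r; [rewrite !expr2; nra|lra].
by case: (leP (- B) w) => h2 //; rewrite !expr2; nra.
Qed.

Definition excess B w := w - clip B w.

Lemma measurable_excess B : measurable_fun setT (excess B).
Proof. by apply: measurable_funB => //; exact: measurable_clip. Qed.

Lemma excess_le B w : 0 <= B -> `|excess B w| <= `|w|.
Proof.
move=> B0; rewrite /excess /clip; case: (leP B w) => h.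
  by rewrite max_r; [rewrite !ger0_norm; lra|lra].
case: (leP (- B) w) => h2; first by rewrite subrr normr0.
by rewrite !ler0_norm; lra.
Qed.

(** Where the excess is nonzero, [B < |w|], hence [(|w| - B) B <= |w| B <= w^2]. This converts the
    fourth moment of the noise into a small variance of its excess. *)
Lemma excess_sqr_le B w : 0 < B -> excess B w ^+ 2 <= w ^+ 4 / B ^+ 2.
Proof.
move=> B0; rewrite /excess /clip ler_pdivlMr ?exprn_gt0//.
rewrite (exprM w 2 2) -exprMn.
have E (u : R) : (u * B) ^+ 2 = (`|u| * B) ^+ 2.
  by rewrite !exprMn -normrX ger0_norm ?sqr_ge0.
rewrite E; apply: lerXn2r; rewrite ?nnegrE ?sqr_ge0 ?mulr_ge0 ?normr_ge0 ?(ltW B0)//.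
case: (leP B w) => h.
  rewrite max_r; last lra.
  by rewrite ger0_norm; [rewrite expr2; nra|lra].
case: (leP (- B) w) => h2; first by rewrite subrr normr0 mul0r sqr_ge0.
by rewrite ler0_norm; [rewrite expr2; nra|lra].
Qed.

(** A split at level [M] into [min x M] and [(x - M)^+] instead of by the indicator of [M < x]: both
    parts are continuous in [x], so their expectations pass to dominated almost sure limits. *)
Definition light (M x : R) : R := Num.min x M.
Definition heavy (M x : R) : R := Num.max (x - M) 0.

Lemma light_heavy M x : light M x + heavy M x = x.
Proof. by rewrite /light /heavy; case: (leP x M); case: (leP (x - M) 0) => *; lra. Qed.

Lemma heavy_ge0 M x : 0 <= heavy M x.
Proof. by rewrite /heavy le_max lexx orbT. Qed.

Lemma light_ge0 M x : 0 <= M -> 0 <= x -> 0 <= light M x.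
Proof. by move=> M0 x0; rewrite /light le_min x0. Qed.

Lemma light_le M x : light M x <= M.
Proof. by rewrite /light ge_min lexx orbT. Qed.

Lemma measurable_light M : measurable_fun setT (light M).
Proof. exact: measurable_minr. Qed.

Lemma measurable_heavy M : measurable_fun setT (heavy M).
Proof. by apply: measurable_maxr => //; exact: measurable_funD. Qed.

(** The pair [u], [v] stands for a part small in mean and a part bounded in L^2. The excess of
    [u + v] over [M] is at most [u + (v - M)^+], and [v - M <= v^2 / M]. *)
Lemma heavy_le_split M x u v : 0 < M -> 0 <= u -> 0 <= v -> x <= u + v ->
  heavy M x <= u + v ^+ 2 / M.
Proof.
move=> M0 u0 v0 xuv; rewrite /heavy ge_max; apply/andP; split; last first.
  by rewrite addr_ge0// divr_ge0 ?sqr_ge0 ?ltW.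
have : v - M <= v ^+ 2 / M.
  rewrite ler_pdivlMr//; have := sqr_ge0 (v - M).
  by rewrite expr2; nra.
lra.
Qed.

(** The part [u] enters the square only through [(min u M)^2 <= M u], so it need not be square
    integrable; the price is the factor [M] on its mean. *)
Lemma light_sqr_le_split M x u v : 0 <= M -> 0 <= x -> 0 <= u -> 0 <= v ->
  x <= u + v -> light M x ^+ 2 <= 2 * M * u + 2 * v ^+ 2.
Proof.
move=> M0 x0 u0 v0 xuv.
have h : light M x <= light M u + v.
  by rewrite /light; case: (leP x M); case: (leP u M) => *; lra.
have hu : light M u ^+ 2 <= M * u.
  by rewrite /light; case: (leP u M) => *; rewrite expr2; nra.
have l0 := light_ge0 M0 x0; have lu := light_ge0 M0 u0.
have : light M x ^+ 2 <= (light M u + v) ^+ 2.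
  by apply: lerXn2r => //; rewrite nnegrE// addr_ge0.
have := sqr_ge0 (light M u - v).
lra.
Qed.

Variables (I : choiceType) (F : I -> set_system T).
Hypothesis FI : forall i, setI_closed (F i).
Hypothesis FT : forall i, F i setT.
Hypothesis Fm : forall i, F i `<=` measurable.
Hypothesis indF : mutually_independent P F.

Local Notation jm := (join_measurable F).

(** Independence factors the exponential moment. For a centred term the quadratic bound leaves
    [1 + 2 v_i], which is at most [exp(2 v_i)]. *)
Lemma mgf_sum_le (x : I -> T -> R) (v : I -> R) (s : seq I) : uniq s ->
  (forall i, jm [set i] (x i)) -> (forall i t, `|x i t| <= 1 / 2) ->
  (forall i, 'Er_P[x i] = 0) -> (forall i, 'Er_P[fun t => x i t ^+ 2] <= v i) ->
  'Er_P[fun t => expR (\sum_(i <- s) x i t)] <= expR (2 * \sum_(i <- s) v i).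
Proof.
move=> + mx x1 Ex Ev.
have mxT i : measurable_fun setT (x i) := join_measurable_meas Fm (mx i).
have mS s' : jm [set` s'] (fun t => expR (\sum_(i <- s') x i t)).
  by apply: join_measurable_comp; [exact: measurable_expR|exact: join_measurable_seq].
have iS s' : integrableR P (fun t => expR (\sum_(i <- s') x i t)).
  apply: (@integrableR_bounded _ _ _ _ _ (expR (\sum_(i <- s') (1 / 2)))).
    exact: join_measurable_meas (mS s').
  move=> t; rewrite ger0_norm ?expR_ge0// ler_expR; apply: ler_sum => i _.
  by rewrite (le_trans (ler_norm _)).
elim: s => [_|i s ih /= /andP[si us]].
  rewrite big_nil mulr0 expR0 (@eq_Er _ _ _ _ _ (cst 1)) ?Er_cst// => t.
  by rewrite big_nil expR0.
rewrite big_cons mulrDr expRD.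
have e t : expR (\sum_(j <- i :: s) x j t) = expR (x i t) * expR (\sum_(j <- s) x j t).
  by rewrite big_cons expRD.
rewrite (eq_Er _ e).
have mi : jm [set i] (fun t => expR (x i t)).
  by apply: join_measurable_comp; [exact: measurable_expR|exact: mx].
have ii : integrableR P (fun t => expR (x i t)).
  apply: eq_integrableR (iS [:: i]) => t; by rewrite big_seq1.
have dis : [set i] `&` [set` s] = set0.
  by move/negP: si => si; apply/seteqP; split => j //= [-> js].
rewrite (indep_ErM FI FT Fm indF dis mi (mS s) ii (iS s)).
apply: ler_pM; [by apply: Er_ge0 => t; exact: expR_ge0|
  by apply: Er_ge0 => t; exact: expR_ge0| |exact: ih].
have i1 : integrableR P (x i) by apply: integrableR_bounded (x1 i).
have i2 : integrableR P (fun t => x i t ^+ 2).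
  apply: (@integrableR_bounded _ _ _ _ _ 1); first exact: measurable_funX.
  move=> t; rewrite normrX -(expr1n _ 2).
  by apply: lerXn2r; rewrite ?nnegrE//; have := x1 i t; lra.
have iq := integrableRD (integrableRD (integrableR_cst P 1) i1) (integrableRZ 2 i2).
apply: (le_trans (le_Er ii iq (fun t => expR_le_quadratic (x1 i t)))).
rewrite (ErD (integrableRD (integrableR_cst P 1) i1) (integrableRZ 2 i2)).
rewrite (ErD (integrableR_cst P 1) i1) (ErZ 2 i2) Ex Er_cst addr0.
apply: le_trans (expR_ge1Dx _).
by rewrite lerD2l ler_pM2l// Ev.
Qed.

(** The exponential bound applied to the sum and to its opposite. The point is that the result sees
    only the total variance, not the number of terms. *)
Lemma moment8_sum_le (x : I -> T -> R) (v : I -> R) (s : seq I) : uniq s ->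
  (forall i, jm [set i] (x i)) -> (forall i t, `|x i t| <= 1 / 2) ->
  (forall i, 'Er_P[x i] = 0) -> (forall i, 'Er_P[fun t => x i t ^+ 2] <= v i) ->
  'Er_P[fun t => (\sum_(i <- s) x i t) ^+ 8] <=
    8 ^+ 8 * (2 * expR (2 * \sum_(i <- s) v i)).
Proof.
move=> us mx x1 Ex Ev.
have mxT i : measurable_fun setT (x i) := join_measurable_meas Fm (mx i).
have mS : measurable_fun setT (fun t => \sum_(i <- s) x i t).
  by apply: measurable_sum.
have bS t : `|\sum_(i <- s) x i t| <= \sum_(i <- s) (1 / 2).
  by apply: (le_trans (ler_norm_sum _ _ _)); apply: ler_sum.
have iX (u : T -> R) c : measurable_fun setT u -> (forall t, `|u t| <= c) ->
    integrableR P (fun t => expR (u t)).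
  move=> mu uc; apply: (@integrableR_bounded _ _ _ _ _ (expR c)).
    exact: measurableT_comp.
  by move=> t; rewrite ger0_norm ?expR_ge0// ler_expR (le_trans (ler_norm _)).
have i1 := iX _ _ mS bS.
have i2 : integrableR P (fun t => expR (- \sum_(i <- s) x i t)).
  apply: (iX (fun t => - \sum_(i <- s) x i t)).
    exact: measurable_funN mS.
  by move=> t; rewrite normrN; exact: bS.
have i8 : integrableR P (fun t => (\sum_(i <- s) x i t) ^+ 8).
  apply: (@integrableR_le _ _ _ _ _ (fun t => 8 ^+ 8 *
    (expR (\sum_(i <- s) x i t) + expR (- \sum_(i <- s) x i t)))).
  - exact: measurable_funX.
  - by apply: integrableRZ; exact: integrableRD.
  - move=> t; rewrite ger0_norm; first exact: expr8_le_expR.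
    by rewrite (exprM _ 4 2) sqr_ge0.
apply: (le_trans (le_Er i8 (integrableRZ _ (integrableRD i1 i2))
  (fun t => expr8_le_expR _))).
rewrite (ErZ _ (integrableRD i1 i2)) (ErD i1 i2) ler_pM2l ?exprn_gt0//.
rewrite mulr_natl mulr2n; apply: lerD; first exact: mgf_sum_le.
have e t : expR (- \sum_(i <- s) x i t) = expR (\sum_(i <- s) - x i t).
  by rewrite sumrN.
rewrite (eq_Er _ e); apply: mgf_sum_le => //.
- by move=> i; apply: (@join_measurable_comp _ _ _ _ _ _ _ (fun z => - z));
    [exact: measurable_funN|exact: mx].
- by move=> i t; rewrite normrN.
- move=> i; rewrite (@eq_Er _ _ _ _ _ (fun t => -1 * x i t)); last first.
    by move=> t; rewrite mulN1r.
  by rewrite ErZ ?Ex ?mulr0//; exact: integrableR_bounded (x1 i).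
- move=> i; rewrite (@eq_Er _ _ _ _ _ (fun t => x i t ^+ 2)) ?Ev// => t.
  by rewrite sqrrN.
Qed.

Section linear_form.
Variables (W : I -> T -> R) (c4 : R).
Hypotheses (mW : forall i, jm [set i] (W i)) (LW : forall i, L4 P (W i)).
Hypotheses (EW : forall i, 'Er_P[W i] = 0).
Hypotheses (EW2 : forall i, 'Er_P[fun t => W i t ^+ 2] = 1).
Hypotheses (c40 : 0 <= c4) (EW4 : forall i, 'Er_P[fun t => W i t ^+ 4] <= c4).
Variables (b : I -> R) (s : seq I) (m K : R).
Hypotheses (us : uniq s) (m1 : 1 <= m) (K0 : 0 < K).
Hypotheses (bm : forall i, `|b i| <= K / m) (bK : \sum_(i <- s) b i ^+ 2 <= K ^+ 2).

Let m0 : 0 < m. Proof. exact: lt_le_trans m1. Qed.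
Let mWT i : measurable_fun setT (W i) := join_measurable_meas Fm (@mW i).
Let phi i t := clip m (W i t).
Let e i := 'Er_P[phi i].
(** Clipping a centred variable need not leave it centred; moving the mean [e i] from one half to
    the other centres both, as the moment bounds require. *)
Let W1 i t := phi i t - e i.
Let W2 i t := excess m (W i t) + e i.
Let L1 t := \sum_(i <- s) b i * W1 i t.
Let L2 t := \sum_(i <- s) b i * W2 i t.
Let mphi i : measurable_fun setT (phi i).
Proof. exact: measurableT_comp (measurable_clip m) (mWT i). Qed.

Let bphi i t : `|phi i t| <= m.
Proof. exact/clip_le/ltW. Qed.

Let iphi i : integrableR P (phi i).
Proof. exact: integrableR_bounded (mphi i) (bphi i). Qed.

Let Lphi i : L4 P (phi i).
Proof.
split => //; apply: (@integrableR_bounded _ _ _ _ _ (m ^+ 4)).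
  exact: measurable_funX.
by move=> t; rewrite normrX; apply: lerXn2r; rewrite ?nnegrE// ltW.
Qed.

Let iW2 i : integrableR P (fun t => W i t ^+ 2).
Proof.
by apply: eq_integrableR (L4_mul2 (LW i) (LW i)) => t; rewrite expr2.
Qed.

Let e_le i : `|e i| <= m.
Proof.
apply: (le_trans (normr_Er (iphi i))).
rewrite -[leRHS](Er_cst P); apply: le_Er => //; first exact: integrableR_norm.
exact: integrableR_cst.
Qed.

Let EW1_sqrE i :
  'Er_P[fun t => W1 i t ^+ 2] = 'Er_P[fun t => phi i t ^+ 2] - e i ^+ 2.
Proof.
have i2 : integrableR P (fun t => phi i t ^+ 2).
  by apply: eq_integrableR (L4_mul2 (Lphi i) (Lphi i)) => t; rewrite expr2.
have q t : W1 i t ^+ 2 = phi i t ^+ 2 + (- 2 * e i) * phi i t + e i ^+ 2.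
  by rewrite /W1; ring.
rewrite (eq_Er _ q).
have i3 := integrableRZ (- 2 * e i) (iphi i).
rewrite (ErD (integrableRD i2 i3) (integrableR_cst P (e i ^+ 2))) (ErD i2 i3) (ErZ _ (iphi i)).
by rewrite Er_cst -/(e i); ring.
Qed.

Let Ephi_sqr i : 'Er_P[fun t => phi i t ^+ 2] <= 1.
Proof.
have i2 : integrableR P (fun t => phi i t ^+ 2).
  by apply: eq_integrableR (L4_mul2 (Lphi i) (Lphi i)) => t; rewrite expr2.
by rewrite -(EW2 i); apply: le_Er => // t; exact/clip_le_id/ltW.
Qed.

Let e_le1 i : e i ^+ 2 <= 1.
Proof.
have : 0 <= 'Er_P[fun t => W1 i t ^+ 2] by apply: Er_ge0 => t; exact: sqr_ge0.
by rewrite EW1_sqrE; have := Ephi_sqr i; lra.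
Qed.

Let LW2 i : L4 P (W2 i).
Proof.
apply: L4D (L4_cst P (e i)).
have [mw iw] := LW i; split; first exact: measurableT_comp (measurable_excess m) _.
apply: integrableR_le iw _.
  by apply: measurable_funX; exact: measurableT_comp (measurable_excess m) _.
move=> t; rewrite normrX.
have -> : W i t ^+ 4 = `|W i t| ^+ 4.
  by rewrite -normrX ger0_norm// (exprM _ 2 2) sqr_ge0.
by apply: lerXn2r; rewrite ?nnegrE//; exact/excess_le/ltW.
Qed.

Let EW1 i : 'Er_P[W1 i] = 0.
Proof. by rewrite (ErB (iphi i) (integrableR_cst P _)) Er_cst subrr. Qed.

Let iexcess i : integrableR P (fun t => excess m (W i t)).
Proof. exact: integrableRB (L4_integrable (LW i)) (iphi i). Qed.

Let Eexcess i : 'Er_P[fun t => excess m (W i t)] = - e i.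
Proof. by rewrite (ErB (L4_integrable (LW i)) (iphi i)) EW sub0r. Qed.

Let EW2' i : 'Er_P[W2 i] = 0.
Proof.
by rewrite (ErD (iexcess i) (integrableR_cst P _)) Er_cst Eexcess addNr.
Qed.

Let EW1_sqr i : 'Er_P[fun t => W1 i t ^+ 2] <= 1.
Proof. by rewrite EW1_sqrE; have := (Ephi_sqr i, sqr_ge0 (e i)) => -[]; lra. Qed.

(** Centring only lowers the second moment of the excess, and [excess_sqr_le] supplies the factor
    [m^-2]. *)
Let cov_W2 i : cov2 P (W2 i) (W2 i) <= c4 / m ^+ 2.
Proof.
rewrite /cov2.
have [mw iw] := LW i.
have ie2 : integrableR P (fun t => excess m (W i t) ^+ 2).
  apply: (@integrableR_le _ _ _ _ _ (fun t => (m ^+ 2)^-1 * W i t ^+ 4)).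
  - by apply: measurable_funX; exact: measurableT_comp (measurable_excess m) _.
  - exact: integrableRZ.
  - by move=> t; rewrite ger0_norm ?sqr_ge0// mulrC; exact: excess_sqr_le.
have q t : W2 i t * W2 i t = excess m (W i t) ^+ 2 + (2 * e i) * excess m (W i t) + e i ^+ 2.
  by rewrite /W2; ring.
rewrite (eq_Er _ q).
have i3 := integrableRZ (2 * e i) (iexcess i).
rewrite (ErD (integrableRD ie2 i3) (integrableR_cst P (e i ^+ 2))) (ErD ie2 i3) (ErZ _ (iexcess i)).
rewrite Er_cst Eexcess.
have : 'Er_P[fun t => excess m (W i t) ^+ 2] <= (m ^+ 2)^-1 * c4.
  apply: (@le_trans _ _ ('Er_P[fun t => (m ^+ 2)^-1 * W i t ^+ 4])).
    apply: le_Er => //; first exact: integrableRZ.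
    by move=> t; rewrite mulrC; exact: excess_sqr_le.
  by rewrite (ErZ _ iw) ler_pM2l ?invr_gt0 ?exprn_gt0.
rewrite [_^-1 * _]mulrC.
have := sqr_ge0 (e i); lra.
Qed.

Let moment4_W2 i : 'Er_P[fun t => W2 i t ^+ 4] <= 8 * (c4 + 1).
Proof.
have [mw iw] := LW i; have [_ iw2] := LW2 i.
have icst := integrableR_cst P 1.
apply: (@le_trans _ _ ('Er_P[fun t => 8 * (W i t ^+ 4 + 1)])).
  apply: le_Er => //; first by apply: integrableRZ; exact: integrableRD.
  move=> t; rewrite /W2.
  have h : excess m (W i t) ^+ 4 <= W i t ^+ 4.
    have E4 (x : R) : x ^+ 4 = `|x| ^+ 4.
      by rewrite -normrX ger0_norm// (exprM _ 2 2) sqr_ge0.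
    rewrite E4 (E4 (W i t)); apply: lerXn2r; rewrite ?nnegrE//.
    exact/excess_le/ltW.
  have h2 : e i ^+ 4 <= 1.
    by rewrite (exprM _ 2 2) exprn_ile1 ?sqr_ge0.
  move: h h2; set x := excess m (W i t); set y := e i => h h2.
  have := (sqr_ge0 (x ^+ 2 - y ^+ 2), sqr_ge0 ((x - y) ^+ 2),
           sqr_ge0 (x * (x - y)), sqr_ge0 (y * (x - y))) => -[[[? ?] ?] ?].
  have : (x + y) ^+ 4 <= 8 * (x ^+ 4 + y ^+ 4) by lra.
  lra.
rewrite (ErZ _ (integrableRD iw icst)) (ErD iw icst) Er_cst ler_pM2l//.
by rewrite lerD2r.
Qed.

(** [(4 K)^8] undoes a rescaling by [1 / (4 K)]. After it the total variance is at most [1/16], so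
    the exponent in [moment8_sum_le] is at most [1/8], rounded up to [1]. *)
Let c8 : R := (4 * K) ^+ 8 * (8 ^+ 8 * (2 * expR 1)).

Let mW1 i : jm [set i] (W1 i).
Proof.
apply: (@join_measurable_comp _ _ _ _ _ _ _ (fun w => clip m w - e i)) (@mW i).
by apply: measurable_funB => //; exact: measurable_clip.
Qed.

Let jmW2 i : jm [set i] (W2 i).
Proof.
apply: (@join_measurable_comp _ _ _ _ _ _ _ (fun w => excess m w + e i)) (@mW i).
by apply: measurable_funD => //; exact: measurable_excess.
Qed.

Let mL1 : measurable_fun setT L1.
Proof.
apply: measurable_sum => i; apply: measurable_funM => //.
exact: join_measurable_meas (@mW1 i).
Qed.

Let moment8_L1 : 'Er_P[fun t => L1 t ^+ 8] <= c8.
Proof.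
(* The recentred clipped noise is at most [2 m] and [|b i| <= K / m], so this factor brings every
   term below [1/2], the range of the exponential bound. *)
pose lam : R := (4 * K)^-1.
have l0 : 0 < lam by rewrite invr_gt0 mulr_gt0.
pose x i t := lam * b i * W1 i t.
have i1 i : integrableR P (W1 i) by exact: integrableRB (iphi i) (integrableR_cst P _).
have h := @moment8_sum_le x (fun i => lam ^+ 2 * b i ^+ 2) s us.
have E t : L1 t ^+ 8 = (4 * K) ^+ 8 * (\sum_(i <- s) x i t) ^+ 8.
  rewrite -exprMn mulr_sumr; congr (_ ^+ 8); apply: eq_bigr => i _.
  by rewrite /x /lam !mulrA divff ?mul1r// mulf_neq0// gt_eqF.
have bx i t : `|x i t| <= 1 / 2.
  rewrite /x !normrM (gtr0_norm l0).
  have w : `|W1 i t| <= 2 * m.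
    rewrite /W1 (le_trans (ler_normB _ _))//.
    by have := bphi i t; have := e_le i; lra.
  apply: (@le_trans _ _ (lam * (K / m) * (2 * m))).
    apply: ler_pM => //; first by rewrite mulr_ge0// ltW.
    by rewrite ler_pM2l.
  rewrite /lam le_eqVlt; apply/orP; left; apply/eqP; field.
  by rewrite !gt_eqF.
have mx i : jm [set i] (x i).
  by apply: join_measurableM => //; exact: join_measurable_cst.
have iS : integrableR P (fun t => (\sum_(i <- s) x i t) ^+ 8).
  have bS t : `|\sum_(i <- s) x i t| <= \sum_(i <- s) (1 / 2).
    by apply: (le_trans (ler_norm_sum _ _ _)); apply: ler_sum.
  apply: (@integrableR_bounded _ _ _ _ _ ((\sum_(i <- s) (1 / 2)) ^+ 8)).
    apply: measurable_funX; apply: measurable_sum => i.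
    exact: join_measurable_meas (mx i).
  move=> t; rewrite normrX; apply: lerXn2r; rewrite ?nnegrE//.
  by apply: sumr_ge0.
rewrite (eq_Er _ E) (ErZ _ iS) ler_pM2l ?exprn_gt0 ?mulr_gt0//.
apply: (le_trans (h _ _ _ _)) => //.
- move=> i; rewrite (ErZ _ (i1 i)) EW1 mulr0//.
- move=> i; have q t : x i t ^+ 2 = (lam ^+ 2 * b i ^+ 2) * W1 i t ^+ 2.
    by rewrite /x !exprMn.
  have iq : integrableR P (fun t => W1 i t ^+ 2).
    have L : L4 P (W1 i) by apply: L4D (Lphi i) (L4_cst P (- e i)).
    by apply: eq_integrableR (L4_mul2 L L) => t; rewrite expr2.
  rewrite (eq_Er _ q) (ErZ _ iq) -[leRHS]mulr1.
  by apply: ler_wpM2l (EW1_sqr i); rewrite mulr_ge0// sqr_ge0.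
rewrite ler_pM2l ?exprn_gt0// ler_pM2l// ler_expR -mulr_sumr.
apply: (@le_trans _ _ (2 * (lam ^+ 2 * K ^+ 2))).
  by rewrite ler_pM2l// ler_pM2l// exprn_gt0.
rewrite -exprMn /lam.
have -> : (4 * K)^-1 * K = 1 / 4 :> R by field; rewrite gt_eqF.
by rewrite expr2; lra.
Qed.

Let iL1 : integrableR P (fun t => L1 t ^+ 8).
Proof.
have bS t : `|L1 t| <= \sum_(i <- s) `|b i| * (2 * m).
  apply: (le_trans (ler_norm_sum _ _ _)); apply: ler_sum => i _.
  rewrite normrM; apply: ler_wpM2l => //.
  rewrite /W1 (le_trans (ler_normB _ _))//.
  by have := bphi i t; have := e_le i; lra.
apply: (@integrableR_bounded _ _ _ _ _ ((\sum_(i <- s) `|b i| * (2 * m)) ^+ 8)).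
  exact: measurable_funX.
move=> t; rewrite normrX; apply: lerXn2r; rewrite ?nnegrE//.
by apply: sumr_ge0 => i _; rewrite mulr_ge0// mulr_ge0// ltW.
Qed.

Let bW2 i t := b i * W2 i t.

Let LbW2 i : L4 P (bW2 i). Proof. exact: L4Z. Qed.

Let LL2 : L4 P L2. Proof. by apply: L4_sum => i _; exact: LbW2. Qed.

Let c4' : R := K ^+ 4 * (8 * (c4 + 1)) + 3 * K ^+ 4 * c4 ^+ 2.

(** The fourth moment is the cumulant plus [3 V^2], with [V] the variance of [L2]. The cumulant is
    at most the sum of the [b_i^4 E W2_i^4], where two of the factors [b_i] are bounded by [K / m]
    and the squares of the others sum to at most [K^2]; and [V <= K^2 c4 / m^2]. These give the two
    terms of [c4']. *)
Let moment4_L2 : 'Er_P[fun t => L2 t ^+ 4] <= c4' / m ^+ 2.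
Proof.
have jb i : jm [set i] (bW2 i).
  by apply: join_measurableM => //; exact: join_measurable_cst.
have E0 i : 'Er_P[bW2 i] = 0.
  by rewrite (ErZ _ (L4_integrable (LW2 i))) EW2' mulr0.
have hk := kappa_sum FI FT Fm indF jb jb LbW2 LbW2 E0 E0 us.
have hc := cov2_sum FI FT Fm indF jb jb LbW2 LbW2 E0 E0 us.
move: hk; rewrite /kappa hc => hk.
rewrite (@eq_Er _ _ _ P _ (fun t => (\sum_(i <- s) bW2 i t) *
  (\sum_(i <- s) bW2 i t) * (\sum_(i <- s) bW2 i t) *
  (\sum_(i <- s) bW2 i t))); last by move=> t; rewrite /L2 /bW2; ring.
set V := \sum_(i <- s) cov2 P (bW2 i) (bW2 i) in hk.
have covb i : cov2 P (bW2 i) (bW2 i) = b i ^+ 2 * cov2 P (W2 i) (W2 i).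
  rewrite /cov2 -(ErZ _ (L4_mul2 (LW2 i) (LW2 i))); apply: eq_Er => t.
  by rewrite /bW2; ring.
have covW0 i : 0 <= cov2 P (W2 i) (W2 i).
  by apply: Er_ge0 => t; rewrite -expr2 sqr_ge0.
have V0 : 0 <= V by apply: sumr_ge0 => i _; rewrite covb mulr_ge0// sqr_ge0.
have VK : V <= K ^+ 2 * (c4 / m ^+ 2).
  apply: (@le_trans _ _ (\sum_(i <- s) b i ^+ 2 * (c4 / m ^+ 2))).
    by apply: ler_sum => i _; rewrite covb; apply: ler_wpM2l; rewrite ?sqr_ge0.
  rewrite -mulr_suml; apply: ler_wpM2r => //.
  by rewrite divr_ge0// exprn_ge0// ltW.
have kap : \sum_(i <- s) ('Er_P[fun t => bW2 i t * bW2 i t * bW2 i t * bW2 i t]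
    - cov2 P (bW2 i) (bW2 i) * cov2 P (bW2 i) (bW2 i)
    - 2 * cov2 P (bW2 i) (bW2 i) ^+ 2) <= K ^+ 4 * (8 * (c4 + 1)) / m ^+ 2.
  apply: (@le_trans _ _ (\sum_(i <- s) b i ^+ 2 * (K ^+ 2 * (8 * (c4 + 1)) / m ^+ 2))).
    apply: ler_sum => i _.
    apply: (@le_trans _ _ ('Er_P[fun t => bW2 i t * bW2 i t * bW2 i t * bW2 i t])).
      have := sqr_ge0 (cov2 P (bW2 i) (bW2 i)); rewrite expr2; lra.
    rewrite (@eq_Er _ _ _ P _ (fun t => (b i ^+ 2 * b i ^+ 2) * W2 i t ^+ 4)); last first.
      by move=> t; rewrite /bW2; ring.
    have [_ iw2] := LW2 i.
    rewrite (ErZ _ iw2) -mulrA; apply: ler_wpM2l; first exact: sqr_ge0.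
    rewrite [leRHS](_ : _ = (K / m) ^+ 2 * (8 * (c4 + 1))); last first.
      by field; rewrite gt_eqF.
    apply: ler_pM => //; rewrite ?sqr_ge0//.
      by apply: Er_ge0 => t; rewrite (exprM _ 2 2) sqr_ge0.
    rewrite -[b i ^+ 2]ger0_norm ?sqr_ge0// normrX.
    by apply: lerXn2r; rewrite ?nnegrE// divr_ge0// ltW.
  rewrite -mulr_suml [leRHS](_ : _ = K ^+ 2 * (K ^+ 2 * (8 * (c4 + 1)) / m ^+ 2)); last first.
    by field; rewrite gt_eqF.
  apply: ler_wpM2r => //.
  by rewrite divr_ge0 ?sqr_ge0// mulr_ge0 ?sqr_ge0// mulr_ge0// addr_ge0.
have V2 : V ^+ 2 <= K ^+ 4 * c4 ^+ 2 / m ^+ 2.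
  apply: (@le_trans _ _ ((K ^+ 2 * (c4 / m ^+ 2)) ^+ 2)).
    by apply: lerXn2r; rewrite ?nnegrE// mulr_ge0 ?sqr_ge0// divr_ge0// exprn_ge0// ltW.
  rewrite [leLHS](_ : _ = K ^+ 4 * c4 ^+ 2 / m ^+ 2 * (m ^+ 2)^-1); last first.
    by field; rewrite gt_eqF.
  rewrite -[leRHS]mulr1; apply: ler_wpM2l.
    by rewrite divr_ge0 ?sqr_ge0// mulr_ge0 ?sqr_ge0// exprn_ge0// ltW.
  by rewrite invf_le1 ?exprn_gt0// exprn_ege1.
rewrite /c4' mulrDl -!mulrA in kap V2 *; rewrite !mulrA in kap V2 *.
move: hk kap V2; rewrite expr2; lra.
Qed.

(* [W] is split at level [m] into a bounded part, whose linear form has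
   exponential moments, hence an eighth moment, and a centred excess of variance
   at most [c4 / m ^ 2], whose linear form has fourth moment [O(m ^- 2)]. *)
Lemma linear_form_heavy_light :
  let L t := \sum_(i <- s) b i * W i t in
  let C := 128 * (K ^+ 4 * (8 * (c4 + 1)) + 3 * K ^+ 4 * c4 ^+ 2 +
                  (4 * K) ^+ 8 * (8 ^+ 8 * (2 * expR 1))) in
  'Er_P[fun t => heavy m (L t ^+ 4)] <= C / m /\
  'Er_P[fun t => light m (L t ^+ 4) ^+ 2] <= C.
Proof.
move=> L C.
have LE t : L t = L1 t + L2 t.
  rewrite /L /L1 /L2 -big_split; apply: eq_bigr => i _ /=.
  by rewrite -mulrDr /W1 /W2 /excess /phi; congr (_ * _); ring.
have LL : L4 P L by apply: L4_sum => i _; exact: L4Z.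
have [mL iL] := LL; have [mL2 iL2] := LL2.
have p4 (x : R) : 0 <= x ^+ 4 by rewrite (exprM _ 2 2) sqr_ge0.
have p84 (x : R) : 0 <= 8 * x ^+ 4 by rewrite mulr_ge0.
have split4 t : L t ^+ 4 <= 8 * L2 t ^+ 4 + 8 * L1 t ^+ 4.
  rewrite LE; move: (L1 t) (L2 t) => x y.
  have := (sqr_ge0 (x ^+ 2 - y ^+ 2), sqr_ge0 ((x - y) ^+ 2),
           sqr_ge0 (x * (x - y)), sqr_ge0 (y * (x - y))) => -[[[? ?] ?] ?].
  lra.
have mL4 : measurable_fun setT (fun t => L t ^+ 4) by exact: measurable_funX.
have heavyI : integrableR P (fun t => heavy m (L t ^+ 4)).
  apply: integrableR_le iL _; first exact: measurableT_comp (measurable_heavy m) _.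
  move=> t; rewrite ger0_norm ?heavy_ge0// /heavy ge_max p4 andbT.
  by rewrite lerBlDr lerDl ltW.
have lightI : integrableR P (fun t => light m (L t ^+ 4) ^+ 2).
  apply: (@integrableR_bounded _ _ _ _ _ (m ^+ 2)).
    by apply: measurable_funX; exact: measurableT_comp (measurable_light m) _.
  move=> t; rewrite ger0_norm ?sqr_ge0//; apply: lerXn2r; rewrite ?nnegrE ?light_le//.
    by rewrite light_ge0 ?p4// ltW.
  exact: ltW.
have c40' : 0 <= c4'.
  apply: addr_ge0; first by rewrite mulr_ge0 ?p4// mulr_ge0// addr_ge0.
  by rewrite mulr_ge0 ?sqr_ge0// mulr_ge0 ?p4.
have c80 : 0 <= c8.
  by rewrite mulr_ge0 ?exprn_ge0 ?mulr_ge0 ?expR_ge0// ltW.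
have mVm : c4' / m ^+ 2 <= c4' / m.
  apply: ler_wpM2l => //; rewrite lef_pV2 ?posrE ?exprn_gt0//.
  by rewrite expr2 ler_peMl// ltW.
have h2 := moment4_L2; have h1 := moment8_L1.
(* Both splittings use [u = 8 L2^4], of mean [O(m^-2)], and [v = 8 L1^4], bounded in L^2. In the
   light half [u] costs a factor [m], which its mean absorbs; in the heavy half [v^2 / m] is the
   leading term. *)
split.
  have i1 := integrableRZ 8 iL2; have i2 := integrableRZ (64 / m) iL1.
  apply: (@le_trans _ _ ('Er_P[fun t => 8 * L2 t ^+ 4 + (64 / m) * L1 t ^+ 8])).
    apply: le_Er => //; first exact: integrableRD.
    move=> t; have := @heavy_le_split m _ (8 * L2 t ^+ 4) (8 * L1 t ^+ 4) m0
      _ _ (split4 t).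
    move=> /(_ (p84 _) (p84 _)) /le_trans; apply.
    by rewrite lerD2l le_eqVlt; apply/orP; left; apply/eqP; field; rewrite gt_eqF.
  rewrite (ErD i1 i2) (ErZ _ iL2) (ErZ _ iL1).
  apply: (@le_trans _ _ (8 * (c4' / m) + (64 / m) * c8)).
    apply: lerD; first by rewrite ler_pM2l// (le_trans h2).
    by rewrite ler_pM2l// divr_gt0.
  rewrite [leLHS](_ : _ = (8 * c4' + 64 * c8) / m); last by field; rewrite gt_eqF.
  rewrite ler_pM2r ?invr_gt0// /C -/c4' -/c8; lra.
have i1 := integrableRZ (16 * m) iL2; have i2 := integrableRZ 128 iL1.
apply: (@le_trans _ _ ('Er_P[fun t => (16 * m) * L2 t ^+ 4 + 128 * L1 t ^+ 8])).
  apply: le_Er => //; first exact: integrableRD.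
  move=> t; have := @light_sqr_le_split m _ (8 * L2 t ^+ 4) (8 * L1 t ^+ 4) (ltW m0)
    (p4 _) _ _ (split4 t).
  move=> /(_ (p84 _) (p84 _)) /le_trans; apply.
  by rewrite le_eqVlt; apply/orP; left; apply/eqP; ring.
rewrite (ErD i1 i2) (ErZ _ iL2) (ErZ _ iL1).
apply: (@le_trans _ _ ((16 * m) * (c4' / m) + 128 * c8)).
  apply: lerD; last by rewrite ler_pM2l.
  by rewrite ler_pM2l ?mulr_gt0// (le_trans h2).
rewrite [leLHS](_ : _ = 16 * c4' + 128 * c8); last by field; rewrite gt_eqF.
rewrite /C -/c4' -/c8; lra.
Qed.

End linear_form.

End Truncation.

(** * Transfer of laws and dominated limits *)

Lemma distribution_Er {R : realType} dE (E : measurableType dE)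
    d (T : measurableType d) (P : probability T R)
    d' (T' : measurableType d') (P' : probability T' R)
    (X : {mfun T >-> E}) (X' : {mfun T' >-> E}) (f : E -> R) :
  (forall A, measurable A -> distribution P X A = distribution P' X' A) ->
  measurable_fun setT f -> integrableR P (fun t => f (X t)) ->
  integrableR P' (fun t => f (X' t)) /\
  'Er_P[fun t => f (X t)] = 'Er_P'[fun t => f (X' t)].
Proof.
move=> meq mf iX.
have mfE : measurable_fun setT (EFin \o f) by exact/measurable_EFinP.
have i' : integrableR P' (fun t => f (X' t)).
  apply/integrableP; split.
    by apply/measurable_EFinP; apply: measurableT_comp mf _.
  have /integrableP[_] := iX.
  have mfn : measurable_fun setT (fun y => `|f y|%:E).
    by apply/measurable_EFinP; apply: measurableT_comp.
  rewrite (_ : (\int[P]_x _)%E = (\int[distribution P X]_y `|f y|%:E)%E); last first.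
    by rewrite ge0_integral_distribution.
  rewrite (eq_measure_integral _ (fun A mA _ => meq A mA)).
  by rewrite ge0_integral_distribution.
split => //; rewrite /Rintegral; congr fine.
transitivity (\int[distribution P X]_y (f y)%:E)%E.
  by rewrite integral_distribution.
rewrite (eq_measure_integral _ (fun A mA _ => meq A mA)).
by rewrite integral_distribution.
Qed.

Section LawTransfer.
Context {R : realType} {I : Type}.

Lemma measurable_realization d (T : measurableType d) (Y : I -> T -> R) :
  (forall i, measurable_fun setT (Y i)) -> measurable_fun setT (realization Y).
Proof.
move=> mY; apply: (@measurability _ _ T (g_sigma_algebraType (@cylinders R I)) setT
  (realization Y) (@cylinders R I)) => // _ [A [i _ [B mB <-]] <-].
rewrite !setTI; have := mY i measurableT B mB.
by rewrite setTI.
Qed.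

Lemma measurable_coordinate (i : I) :
  measurable_fun setT (fun y : g_sigma_algebraType (@cylinders R I) => y i).
Proof.
move=> _ B mB; apply: sub_sigma_algebra; exists i => //.
by exists B.
Qed.

Lemma same_law_Er d (T : measurableType d) (P : probability T R)
    d' (T' : measurableType d') (P' : probability T' R)
    (Y : I -> T -> R) (Y' : I -> T' -> R)
    (f : g_sigma_algebraType (@cylinders R I) -> R) :
  (forall i, measurable_fun setT (Y i)) ->
  (forall i, measurable_fun setT (Y' i)) ->
  same_law P Y P' Y' -> measurable_fun setT f ->
  integrableR P (fun t => f (realization Y t)) ->
  integrableR P' (fun t => f (realization Y' t)) /\
  'Er_P[fun t => f (realization Y t)] = 'Er_P'[fun t => f (realization Y' t)].
Proof.
move=> mY mY' YY' mf iY.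
have mr := measurable_realization mY; have mr' := measurable_realization mY'.
pose r : {mfun T >-> g_sigma_algebraType (@cylinders R I)} :=
  HB.pack (realization Y) (isMeasurableFun.Build _ _ _ _ _ mr).
pose r' : {mfun T' >-> g_sigma_algebraType (@cylinders R I)} :=
  HB.pack (realization Y') (isMeasurableFun.Build _ _ _ _ _ mr').
exact: (@distribution_Er _ _ _ _ _ P _ _ P' r r').
Qed.

End LawTransfer.

Lemma cvgn_le {R : realType} (u : nat -> R) l c :
  u @ \oo --> l -> (forall n, u n <= c) -> l <= c.
Proof.
move=> ul uc; rewrite -(cvg_lim _ ul)//; apply: limr_le.
  by apply/cvg_ex; exists l.
exact: nearW.
Qed.

Section DominatedFourth.
Context {R : realType} {d : measure_display} {T : measurableType d}.
Variable P : probability T R.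

(** The convergence under which all moments up to the fourth pass to the limit. The majorant is
    extended-real valued because it arises as a monotone limit, possibly infinite on a null set. *)
Definition dcvg4 (X_ : nat -> T -> R) (X : T -> R) : Prop :=
  [/\ forall n, measurable_fun setT (X_ n), measurable_fun setT X,
      {ae P, forall t, X_ n t @[n --> \oo] --> X t} &
      exists2 H : T -> \bar R, P.-integrable setT H &
        {ae P, forall t n, (((X_ n t) ^+ 4)%:E <= H t)%E}].

Let p4 (x : R) : 0 <= x ^+ 4. Proof. by rewrite (exprM _ 2 2) sqr_ge0. Qed.

Lemma dcvg4_Er (X_ : nat -> T -> R) (X : T -> R) (g : R -> R) (c : R) :
  0 <= c -> dcvg4 X_ X -> continuous g -> measurable_fun setT g ->
  (forall x, `|g x| <= c * (1 + x ^+ 4)) ->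
  [/\ integrableR P (fun t => g (X t)),
      forall n, integrableR P (fun t => g (X_ n t)) &
      'Er_P[fun t => g (X_ n t)] @[n --> \oo] --> 'Er_P[fun t => g (X t)]].
Proof.
move=> c0 [mX_ mX cX [H iH XH]] cg mg gc.
have iG : P.-integrable setT (fun t => c%:E * (1 + H t))%E.
  apply: (integrableZl measurableT); apply: integrableD => //.
  exact: (integrableR_cst P 1).
have gG : {ae P, forall t n, setT t -> (`|(g (X_ n t))%:E| <= c%:E * (1 + H t))%E}.
  move: XH; apply: filterS => t h n _.
  rewrite (@le_trans _ _ (c * (1 + X_ n t ^+ 4))%:E)//; first by rewrite lee_fin.
  by rewrite EFinM EFinD; apply: lee_wpmul2l; rewrite ?lee_fin// leeD2l.
have mgX_ n : measurable_fun setT (fun t => (g (X_ n t))%:E).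
  by apply/measurable_EFinP; apply: measurableT_comp.
have mgX : measurable_fun setT (fun t => (g (X t))%:E).
  by apply/measurable_EFinP; apply: measurableT_comp.
have gcvg : {ae P, forall t, setT t -> (g (X_ n t))%:E @[n --> \oo] --> (g (X t))%:E}.
  move: cX; apply: filterS => t h _; apply: cvg_EFin; first exact: nearW.
  exact: continuous_cvg (cg _) h.
have [i1 _ i3] := dominated_convergence measurableT mgX_ mgX gcvg iG gG.
(* The domination holds only almost everywhere, so the integrability of each term is read off
   dominated convergence for a constant sequence. *)
have i2 n : integrableR P (fun t => g (X_ n t)).
  have gcst : {ae P, forall t, setT t -> (g (X_ n t))%:E @[_ --> \oo] --> (g (X_ n t))%:E}.
    by apply: aeW => t _; exact: cvg_cst.
  have gG' : {ae P, forall t (m : nat), setT t -> (`|(g (X_ n t))%:E| <= c%:E * (1 + H t))%E}.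
    by move: gG; apply: filterS => t h m _; exact: h.
  by have [] := dominated_convergence measurableT (fun=> mgX_ n) (mgX_ n) gcst iG gG'.
split => //.
apply: fine_cvg; rewrite fineK; last exact: integrable_fin_num.
exact: i3.
Qed.

Lemma dcvg4_mul4 (X1_ X2_ X3_ X4_ : nat -> T -> R) X1 X2 X3 X4 :
  dcvg4 X1_ X1 -> dcvg4 X2_ X2 -> dcvg4 X3_ X3 -> dcvg4 X4_ X4 ->
  'Er_P[fun t => X1_ n t * X2_ n t * X3_ n t * X4_ n t] @[n --> \oo] -->
  'Er_P[fun t => X1 t * X2 t * X3 t * X4 t].
Proof.
move=> [m1_ m1 c1 [H1 i1 b1]] [m2_ m2 c2 [H2 i2 b2]].
move=> [m3_ m3 c3 [H3 i3 b3]] [m4_ m4 c4 [H4 i4 b4]].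
have iG : P.-integrable setT (fun t => (H1 t + H2 t) + (H3 t + H4 t))%E.
  by repeat apply: integrableD => //.
have gG : {ae P, forall t n, setT t ->
    (`|(X1_ n t * X2_ n t * X3_ n t * X4_ n t)%:E| <= (H1 t + H2 t) + (H3 t + H4 t))%E}.
  have b12 : {ae P, forall t, (forall n, (((X1_ n t) ^+ 4)%:E <= H1 t)%E) /\
    (forall n, (((X2_ n t) ^+ 4)%:E <= H2 t)%E)}.
    by move: b1 b2; apply: filterS2.
  move: b12 b3 b4; apply: filterS3 => t [h1 h2] h3 h4 n _.
  apply: (@le_trans _ _ (((X1_ n t ^+ 4)%:E + (X2_ n t ^+ 4)%:E) +
    ((X3_ n t ^+ 4)%:E + (X4_ n t ^+ 4)%:E))%E); last by repeat apply: leeD.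
  rewrite -!EFinD lee_fin.
  move: (X1_ n t) (X2_ n t) (X3_ n t) (X4_ n t) => a b c e.
  have := (sqr_ge0 (a * b - c * e), sqr_ge0 (a * b + c * e),
           sqr_ge0 (a ^+ 2 - b ^+ 2), sqr_ge0 (c ^+ 2 - e ^+ 2)).
  have := (p4 a, p4 b, p4 c, p4 e).
  move=> [[[? ?] ?] ?] [[[? ?] ?] ?].
  by rewrite ler_norml; apply/andP; split; lra.
have mgX_ n : measurable_fun setT (fun t => (X1_ n t * X2_ n t * X3_ n t * X4_ n t)%:E).
  by apply/measurable_EFinP; repeat apply: measurable_funM.
have mgX : measurable_fun setT (fun t => (X1 t * X2 t * X3 t * X4 t)%:E).
  by apply/measurable_EFinP; repeat apply: measurable_funM.
have gcvg : {ae P, forall t, setT t ->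
    (X1_ n t * X2_ n t * X3_ n t * X4_ n t)%:E @[n --> \oo] -->
    (X1 t * X2 t * X3 t * X4 t)%:E}.
  have c12 : {ae P, forall t, X1_ n t @[n --> \oo] --> X1 t /\
    X2_ n t @[n --> \oo] --> X2 t}.
    by move: c1 c2; apply: filterS2.
  move: c12 c3 c4; apply: filterS3 => t [h1 h2] h3 h4 _.
  apply: cvg_EFin; first exact: nearW.
  by repeat apply: cvgM.
have [i0 _ i5] := dominated_convergence measurableT mgX_ mgX gcvg iG gG.
apply: fine_cvg; rewrite fineK; last exact: integrable_fin_num.
exact: i5.
Qed.

Lemma dcvg4_const X : L4 P X -> dcvg4 (fun=> X) X.
Proof.
move=> [mX iX]; split => //; first by apply: aeW => t; exact: cvg_cst.
by exists (EFin \o (fun t => X t ^+ 4)) => //; apply: aeW => t n.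
Qed.

Let quartic_growth : [/\ continuous (fun x : R => x ^+ 4),
  measurable_fun setT (fun x : R => x ^+ 4) &
  forall x : R, `|x ^+ 4| <= 1 * (1 + x ^+ 4)].
Proof.
split; first by move=> x; exact: exprn_continuous.
  exact: measurable_funX.
by move=> x; rewrite ger0_norm ?p4// mul1r lerDr.
Qed.

Lemma dcvg4_L4 X_ X : dcvg4 X_ X -> L4 P X.
Proof.
move=> h; have [c m g] := quartic_growth.
by have [iX _ _] := dcvg4_Er ler01 h c m g; case: h => _ mX _ _; split.
Qed.

Lemma dcvg4D X_ X Y_ Y : dcvg4 X_ X -> dcvg4 Y_ Y ->
  dcvg4 (fun n t => X_ n t + Y_ n t) (fun t => X t + Y t).
Proof.
move=> [m1_ m1 c1 [H1 i1 b1]] [m2_ m2 c2 [H2 i2 b2]]; split.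
- by move=> n; exact: measurable_funD.
- exact: measurable_funD.
- by move: c1 c2; apply: filterS2 => t h1 h2; exact: cvgD.
- exists (fun t => 8%:E * (H1 t + H2 t))%E.
    by apply: (integrableZl measurableT); exact: integrableD.
  move: b1 b2; apply: filterS2 => t h1 h2 n.
  apply: (@le_trans _ _ (8%:E * ((X_ n t ^+ 4)%:E + (Y_ n t ^+ 4)%:E))%E).
    rewrite -EFinD -EFinM lee_fin.
    move: (X_ n t) (Y_ n t) => x y.
    have := (sqr_ge0 (x ^+ 2 - y ^+ 2), sqr_ge0 ((x - y) ^+ 2),
             sqr_ge0 (x * (x - y)), sqr_ge0 (y * (x - y))) => -[[[? ?] ?] ?].
    lra.
  by apply: lee_wpmul2l; rewrite ?lee_fin// leeD.
Qed.

Lemma dcvg4Z c X_ X : dcvg4 X_ X ->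
  dcvg4 (fun n t => c * X_ n t) (fun t => c * X t).
Proof.
move=> [m1_ m1 c1 [H1 i1 b1]]; split.
- by move=> n; exact: measurable_funM.
- exact: measurable_funM.
- by move: c1; apply: filterS => t h1; apply: cvgM => //; exact: cvg_cst.
- exists (fun t => (c ^+ 4)%:E * H1 t)%E.
    exact: (integrableZl measurableT).
  move: b1; apply: filterS => t h1 n.
  by rewrite exprMn EFinM; apply: lee_wpmul2l; rewrite ?lee_fin.
Qed.

Lemma dcvg4_sum (K : Type) (s : seq K) X_ X : (forall k, dcvg4 (X_ k) (X k)) ->
  dcvg4 (fun n t => \sum_(k <- s) X_ k n t) (fun t => \sum_(k <- s) X k t).
Proof.
move=> h; elim: s => [|k s ih].
  rewrite (_ : (fun n t => _) = (fun=> cst 0)); last first.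
    by apply/funext => n; apply/funext => t; rewrite big_nil.
  rewrite (_ : (fun t => _) = cst 0); last by apply/funext => t; rewrite big_nil.
  exact/dcvg4_const/L4_cst.
rewrite (_ : (fun n t => _) = (fun n t => X_ k n t + \sum_(k <- s) X_ k n t)); last first.
  by apply/funext => n; apply/funext => t; rewrite big_cons.
rewrite (_ : (fun t => _) = (fun t => X k t + \sum_(k <- s) X k t)); last first.
  by apply/funext => t; rewrite big_cons.
exact: dcvg4D.
Qed.

Lemma dcvg4_Er_id X_ X : dcvg4 X_ X ->
  'Er_P[X_ n] @[n --> \oo] --> 'Er_P[X].
Proof.
move=> h; have [|||_ _ h3] := @dcvg4_Er _ _ id 1 ler01 h; [by move=> x;
  exact: cvg_id|by []| |exact: h3].
move=> x; rewrite mul1r /=; have := sqr_ge0 (x ^+ 2 - 1); have := sqr_ge0 (x - 1).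
by have := sqr_ge0 (x + 1); have := p4 x; rewrite ler_norml => *; apply/andP; split; lra.
Qed.

Lemma dcvg4_cov2 X_ X Y_ Y : dcvg4 X_ X -> dcvg4 Y_ Y ->
  cov2 P (X_ n) (Y_ n) @[n --> \oo] --> cov2 P X Y.
Proof.
move=> hX hY; have h1 := dcvg4_const (L4_cst P 1).
have := dcvg4_mul4 hX hY h1 h1.
rewrite (@eq_Er _ _ _ _ _ (fun t => X t * Y t)); last by move=> t; rewrite /= !mulr1.
rewrite (_ : (fun n => _) = (fun n => cov2 P (X_ n) (Y_ n)))//; apply/funext => n.
by apply: eq_Er => t; rewrite /= !mulr1.
Qed.

Lemma dcvg4_kappa X_ X Y_ Y : dcvg4 X_ X -> dcvg4 Y_ Y ->
  kappa P (X_ n) (Y_ n) @[n --> \oo] --> kappa P X Y.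
Proof.
move=> hX hY; apply: cvgB; first apply: cvgB.
- exact: dcvg4_mul4.
- by apply: cvgM; exact: dcvg4_cov2.
- apply: cvgM; first exact: cvg_cst.
  by rewrite expr2; under [X in X @ _ --> _]eq_fun do rewrite expr2; apply: cvgM; exact: dcvg4_cov2.
Qed.

Lemma continuous_light (M : R) : continuous (light M).
Proof. by move=> x; apply: continuous_min => //; exact: cvg_cst. Qed.

Lemma continuous_heavy (M : R) : continuous (heavy M).
Proof.
move=> x; apply: (@continuous_max _ _ (fun x => x - M) (cst 0)); last exact: cvg_cst.
by apply: cvgB => //; exact: cvg_cst.
Qed.

Lemma dcvg4_heavy (M : R) X_ X : 0 <= M -> dcvg4 X_ X ->
  'Er_P[fun t => heavy M (X_ n t ^+ 4)] @[n --> \oo] -->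
  'Er_P[fun t => heavy M (X t ^+ 4)].
Proof.
move=> M0 h; have [|||_ _] := @dcvg4_Er _ _ (fun x => heavy M (x ^+ 4)) 1 ler01 h => //.
- move=> x; apply: (@continuous_comp _ _ _ (fun x : R => x ^+ 4) (heavy M)).
    exact: exprn_continuous.
  exact: continuous_heavy.
- apply: measurableT_comp; [exact: measurable_heavy|exact: measurable_funX].
- move=> x; rewrite ger0_norm ?heavy_ge0// mul1r /heavy ge_max.
  by have := p4 x => ?; apply/andP; split; lra.
Qed.

Lemma dcvg4_light (M : R) X_ X : 0 <= M -> dcvg4 X_ X ->
  'Er_P[fun t => light M (X_ n t ^+ 4) ^+ 2] @[n --> \oo] -->
  'Er_P[fun t => light M (X t ^+ 4) ^+ 2].
Proof.
move=> M0 h.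
have [|||_ _] := @dcvg4_Er _ _ (fun x => light M (x ^+ 4) ^+ 2) (M ^+ 2) (sqr_ge0 M) h => //.
- move=> x.
  apply: (@continuous_comp _ _ _ (fun x : R => light M (x ^+ 4)) (fun x : R => x ^+ 2)).
    apply: (@continuous_comp _ _ _ (fun x : R => x ^+ 4) (light M)).
      exact: exprn_continuous.
    exact: continuous_light.
  exact: exprn_continuous.
- apply: measurable_funX.
  apply: measurableT_comp; [exact: measurable_light|exact: measurable_funX].
- move=> x; rewrite ger0_norm ?sqr_ge0//.
  apply: (@le_trans _ _ (M ^+ 2)).
    by apply: lerXn2r; rewrite ?nnegrE ?light_le// light_ge0.
  by rewrite ler_peMr ?sqr_ge0// lerDl.
Qed.

End DominatedFourth.

(** * Linear fields *)

Section PreimageSigmaAlgebras.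
Context {R : realType} {d : measure_display} {T : measurableType d}.
Context {I : Type} {d' : measure_display} {T' : measurableType d'}.
Variables (f : I -> T -> T') (mf : forall i, measurable_fun setT (f i)).

Lemma preimage_sigmaI i : setI_closed (g_sigma_algebra_preimage (f i)).
Proof.
move=> _ _ [A mA <-] [B mB <-]; exists (A `&` B); first exact: measurableI.
by rewrite !setTI preimage_setI.
Qed.

Lemma preimage_sigmaT i : g_sigma_algebra_preimage (f i) setT.
Proof. by exists setT => //; rewrite preimage_setT setIT. Qed.

Lemma preimage_sigma_sub i : g_sigma_algebra_preimage (f i) `<=` measurable.
Proof. by move=> _ [A mA <-]; exact: mf. Qed.

End PreimageSigmaAlgebras.

Section WeightedSums.
Context {R : realType} {I : Type}.

Lemma cauchy_weighted (s : seq I) (p y : I -> R) : (forall i, 0 <= p i) ->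
  (\sum_(i <- s) p i * y i) ^+ 2 <=
  (\sum_(i <- s) p i) * \sum_(i <- s) p i * y i ^+ 2.
Proof.
move=> p0; elim: s => [|i s ih]; first by rewrite !big_nil expr0n /= mul0r.
rewrite !big_cons; move: ih.
have : 0 <= \sum_(i <- s) p i * y i ^+ 2.
  by apply: sumr_ge0 => j _; rewrite mulr_ge0// sqr_ge0.
have : 0 <= \sum_(i <- s) p i by apply: sumr_ge0.
move: (\sum_(i <- s) p i) (\sum_(i <- s) p i * y i ^+ 2) (\sum_(i <- s) p i * y i).
move: (p i) (p0 i) (y i) => q q0 z P Q A P0 Q0 APQ.
(* AM-GM with [A^2 <= P Q], argued on squares by contradiction so that no square root is taken. *)
have h : 2 * A * z <= P * z ^+ 2 + Q.
  rewrite leNgt; apply/negP => h.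
  have h0 : 0 <= P * z ^+ 2 + Q by rewrite addr_ge0// mulr_ge0// sqr_ge0.
  have h1 : (P * z ^+ 2 + Q) ^+ 2 < (2 * A * z) ^+ 2.
    by rewrite ltr_sqr// nnegrE// ltW// (le_lt_trans h0).
  have h2 : A ^+ 2 * z ^+ 2 <= P * Q * z ^+ 2 by apply: ler_wpM2r => //; exact: sqr_ge0.
  have := sqr_ge0 (P * z ^+ 2 - Q).
  by lra.
have := ler_wpM2l q0 h.
by move: APQ; lra.
Qed.

(** Cauchy-Schwarz twice with the weights [|a i|]: the bound needs only the l^1 norm of the
    coefficients and is linear in the fourth powers. *)
Lemma power4_weighted (s : seq I) (a x : I -> R) :
  (\sum_(i <- s) a i * x i) ^+ 4 <=
  (\sum_(i <- s) `|a i|) ^+ 3 * \sum_(i <- s) `|a i| * x i ^+ 4.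
Proof.
have a0 : 0 <= \sum_(i <- s) `|a i| by apply: sumr_ge0.
have h1 := @cauchy_weighted s (fun i => `|a i|) (fun i => `|x i|) (fun i => normr_ge0 _).
have h2 := @cauchy_weighted s (fun i => `|a i|) (fun i => x i ^+ 2) (fun i => normr_ge0 _).
have h3 : (\sum_(i <- s) a i * x i) ^+ 2 <=
    (\sum_(i <- s) `|a i|) * \sum_(i <- s) `|a i| * x i ^+ 2.
  rewrite -[leLHS]ger0_norm ?sqr_ge0// normrX.
  apply: (@le_trans _ _ ((\sum_(i <- s) `|a i| * `|x i|) ^+ 2)).
    apply: lerXn2r; rewrite ?nnegrE//.
      by apply: sumr_ge0 => i _; rewrite mulr_ge0.
    by apply: (le_trans (ler_norm_sum _ _ _)); apply: ler_sum => i _; rewrite normrM.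
  apply: (le_trans h1); apply: ler_wpM2l => //.
  by apply: ler_sum => i _; rewrite -normrX [X in _ * X]ger0_norm// sqr_ge0.
rewrite (exprM _ 2 2).
apply: (@le_trans _ _ (((\sum_(i <- s) `|a i|) * \sum_(i <- s) `|a i| * x i ^+ 2) ^+ 2)).
  apply: lerXn2r; rewrite ?nnegrE ?sqr_ge0// mulr_ge0// sumr_ge0// => i _.
  by rewrite mulr_ge0// sqr_ge0.
rewrite exprMn [leRHS](_ : _ = (\sum_(i <- s) `|a i|) ^+ 2 *
  ((\sum_(i <- s) `|a i|) * \sum_(i <- s) `|a i| * x i ^+ 4)); last by ring.
 apply: ler_wpM2l; first exact: sqr_ge0.
apply: (le_trans h2); apply: ler_wpM2l => //.
by apply: ler_sum => i _; rewrite -exprM.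
Qed.

End WeightedSums.

Section Norm1.
Context {R : realType} {dim : nat}.
Implicit Types i j : 'rV[int]_dim.

Lemma norm1_ge0 j : 0 <= norm1 j :> R.
Proof. by apply: sumr_ge0. Qed.

Lemma norm1N j : norm1 (- j) = norm1 j :> R.
Proof. by apply: eq_bigr => m _; rewrite mxE mulrNz normrN. Qed.

Lemma ler_norm1D i j : norm1 (i + j) <= norm1 i + norm1 j :> R.
Proof.
rewrite /norm1 -big_split; apply: ler_sum => m _ /=.
by rewrite mxE intrD ler_normD.
Qed.

Lemma sqrt_norm1D i j :
  Num.sqrt (norm1 (i + j)) <= Num.sqrt (norm1 i) + Num.sqrt (norm1 j) :> R.
Proof.
rewrite -(ler_pXn2r (_ : 0 < 2)%N) ?nnegrE ?addr_ge0 ?sqrtr_ge0//.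
rewrite sqrrD !sqr_sqrtr ?norm1_ge0//.
have := ler_norm1D i j; have : 0 <= Num.sqrt (norm1 i) * Num.sqrt (norm1 j) :> R.
  by rewrite mulr_ge0 ?sqrtr_ge0.
by rewrite mulr2n; lra.
Qed.

End Norm1.

Section LinearField.
Context {R : realType} {dim : nat} {d : measure_display} {T : measurableType d}.
Variable P : probability T R.
Local Notation site := 'rV[int]_dim.
Variables (W Y : site -> T -> R) (psi : site -> R) (c4 K0 K1 : R).
Hypotheses (mW : forall j, measurable_fun setT (W j)).
Hypothesis indW : mutually_independent P (fun j => g_sigma_algebra_preimage (W j)).
Hypotheses (LW : forall j, L4 P (W j)) (EW : forall j, 'Er_P[W j] = 0).
Hypothesis EW2 : forall j, 'Er_P[fun t => W j t ^+ 2] = 1.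
Hypothesis EW4 : forall j, 'Er_P[fun t => W j t ^+ 4] <= c4.
Hypothesis psi0 : forall s : seq site, uniq s -> \sum_(j <- s) `|psi j| <= K0.
Hypothesis psi1 : forall s : seq site, uniq s ->
  \sum_(j <- s) `|psi j| * Num.sqrt (norm1 j) <= K1.
Hypothesis mY : forall i, measurable_fun setT (Y i).
Hypothesis YE : forall i, {ae P, forall t,
  partial_sum (fun j => W j t * psi (i - j) : R^o) @ totally --> (Y i t : R^o)}.

Let p4 (x : R) : 0 <= x ^+ 4. Proof. by rewrite (exprM _ 2 2) sqr_ge0. Qed.

Let K0_ge0 : 0 <= K0.
Proof. by have := psi0 (isT : uniq [::]); rewrite big_nil. Qed.

Let K1_ge0 : 0 <= K1.
Proof. by have := psi1 (isT : uniq [::]); rewrite big_nil. Qed.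

Let c4_ge0 : 0 <= c4.
Proof. by apply: le_trans (EW4 0); apply: Er_ge0. Qed.

(** The series defining the field converges along the net of finite sets of sites, while dominated
    convergence needs a sequence. The sites with code below [m] are cofinal in that net. *)
Lemma exhaustion : exists F_ : nat -> {fset site},
  (forall m n, (m <= n)%N -> (F_ m `<=` F_ n)%fset) /\
  forall A : {fset site}, exists m, (A `<=` F_ m)%fset.
Proof.
pose F_ m := seq_fset tt (pmap (@choice.unpickle site) (iota 0 m)).
have memF m j : (j \in F_ m) = (Some j \in [seq choice.unpickle i | i <- iota 0 m]).
  by rewrite seq_fsetE mem_pmap.
exists F_; split=> [m n mn|A].
  apply/fsubsetP => j; rewrite !memF => /mapP[k].
  rewrite mem_iota add0n /= => km ->; apply: map_f.
  by rewrite mem_iota add0n /= (leq_trans km).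
exists (\sum_(j <- A) (choice.pickle j).+1)%N; apply/fsubsetP => j jA.
rewrite memF; apply/mapP; exists (choice.pickle j).
  rewrite mem_iota add0n /= (big_rem j)//=; exact: leq_addr.
by rewrite choice.pickleK.
Qed.

Let first_sites := sval (cid exhaustion).

Let first_sites_sub m n : (m <= n)%N -> (first_sites m `<=` first_sites n)%fset.
Proof. exact: (svalP (cid exhaustion)).1. Qed.

Let first_sites_cofinal (A : {fset site}) : exists m, (A `<=` first_sites m)%fset.
Proof. exact: (svalP (cid exhaustion)).2. Qed.

Let first_sites_cvg : first_sites @ \oo --> @totally site.
Proof.
move=> B [A _ AB]; have [m Am] := first_sites_cofinal A.
exists m => // n /= mn; apply: AB => /=.
exact: fsubset_trans Am (first_sites_sub mn).
Qed.

Let Z i m t := \sum_(j <- first_sites m) psi (i - j) * W j t.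

Let psi_shift i (s : seq site) : uniq s -> \sum_(j <- s) `|psi (i - j)| <= K0.
Proof.
move=> us; have := @psi0 [seq i - j | j <- s]; rewrite big_map; apply.
by rewrite map_inj_uniq// => j k /addrI /oppr_inj.
Qed.

Let psi_shift' i (s : seq site) : uniq s -> \sum_(j <- s) `|psi (j - i)| <= K0.
Proof.
move=> us; have := @psi0 [seq j - i | j <- s]; rewrite big_map; apply.
by rewrite map_inj_uniq// => j k /addIr.
Qed.

(** [power4_weighted] bounds the fourth power of every partial sum by [K0^3] times the sum of the
    [|psi (i - j)| W_j^4], which increases with the set of sites. By monotone convergence its limit
    [H] has mean at most [K0^4 c4]: four moments of the noise and a summable kernel suffice for the
    majorant. *)
Let ZY i : dcvg4 P (Z i) (Y i).
Proof.
pose h m t : \bar R := (K0 ^+ 3 * \sum_(j <- first_sites m) `|psi (i - j)| * W j t ^+ 4)%:E.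
pose H (t : T) : \bar R := limn (h ^~ t).
have mWr m : measurable_fun setT
    (fun t => K0 ^+ 3 * \sum_(j <- first_sites m) `|psi (i - j)| * W j t ^+ 4).
  apply: measurable_funM => //; apply: measurable_sum => j.
  by apply: measurable_funM => //; exact: measurable_funX.
have mh m : measurable_fun setT (h m) by exact/measurable_EFinP.
have h0 m t : (0 <= h m t)%E.
  by rewrite lee_fin mulr_ge0 ?exprn_ge0// sumr_ge0// => j _; rewrite mulr_ge0.
have hnd t : {homo h ^~ t : n m / (n <= m)%N >-> (n <= m)%E}.
  move=> n m nm; rewrite lee_fin; apply: ler_wpM2l; first by rewrite exprn_ge0.
  rewrite [leRHS](big_fsetID _ (mem (first_sites n)))/=.
  have -> : [fset x in first_sites m | x \in mem (first_sites n)]%fset = first_sites n.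
    apply/fsetP => x; rewrite !inE /= andbC; case: (boolP (x \in first_sites n)) => //= xn.
    exact: (fsubsetP (first_sites_sub nm)).
  by rewrite lerDl sumr_ge0// => j _; rewrite mulr_ge0.
have hH t : h ^~ t @ \oo --> H t.
  by apply/cvg_ex; exists (ereal_sup (range (h ^~ t))); exact: ereal_nondecreasing_cvgn.
have hleH m t : (h m t <= H t)%E.
  rewrite /H; have /cvg_lim -> // := ereal_nondecreasing_cvgn (hnd t).
  by apply: ereal_sup_ubound; exists m.
have mH : measurable_fun setT H by apply: (@emeasurable_fun_cvg _ _ _ setT h H mh) => t _;
  exact: hH.
have H0 t : (0 <= H t)%E by exact: le_trans (h0 0%N t) (hleH 0%N t).
have Eh m : (\int[P]_t h m t <= (K0 ^+ 4 * c4)%:E)%E.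
  have iW j : integrableR P (fun t => `|psi (i - j)| * W j t ^+ 4).
    by apply: integrableRZ; case: (LW j).
  have ih : integrableR P
      (fun t => K0 ^+ 3 * \sum_(j <- first_sites m) `|psi (i - j)| * W j t ^+ 4).
    by apply: integrableRZ; exact: integrableR_sum.
  have := integrableR_fin ih; rewrite unlock => ->; rewrite lee_fin.
  rewrite ErZ; last exact: integrableR_sum.
  rewrite Er_sum// (_ : K0 ^+ 4 * c4 = K0 ^+ 3 * (K0 * c4)); last by ring.
  apply: ler_wpM2l; first by rewrite exprn_ge0.
  apply: (@le_trans _ _ (\sum_(j <- first_sites m) `|psi (i - j)| * c4)).
    apply: ler_sum => j _; rewrite ErZ; last by case: (LW j).
    exact: ler_wpM2l.
  rewrite -mulr_suml; apply: ler_wpM2r => //; exact/psi_shift/fset_uniq.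
have iH : P.-integrable setT H.
  apply/integrableP; split => //.
  under eq_integral => t _ do rewrite gee0_abs//.
  rewrite /H (monotone_convergence P measurableT mh)//.
  apply: le_lt_trans (ltry (K0 ^+ 4 * c4)); apply: lime_le; last exact: nearW.
  apply: ereal_nondecreasing_is_cvgn => n m nm.
  apply: ge0_le_integral => //.
  by move=> t _; exact: hnd.
split.
- move=> m; apply: measurable_sum => j; exact: measurable_funM.
- exact: mY.
- move: (YE i); apply: filterS => t ht; move: (cvg_comp _ _ first_sites_cvg ht).
  apply: cvg_trans; apply: near_eq_cvg; apply: nearW => m /=.
  rewrite /partial_sum -(big_seq_fsetE _ (first_sites m) predT (fun j => W j t * psi (i - j))).
  by apply: eq_bigr => j _; rewrite mulrC.
- exists H => //; apply: aeW => t m; apply: le_trans (hleH m t).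
  rewrite lee_fin; apply: (le_trans (power4_weighted _ _ _)).
  apply: ler_wpM2r; first by rewrite sumr_ge0// => j _; rewrite mulr_ge0.
  by apply: lerXn2r; rewrite ?nnegrE ?sumr_ge0// psi_shift// fset_uniq.
Qed.

Lemma linear_field_L4 i : L4 P (Y i).
Proof. exact: dcvg4_L4 (ZY i). Qed.

Let F j := g_sigma_algebra_preimage (W j).
Let FI j : setI_closed (F j). Proof. exact: preimage_sigmaI. Qed.
Let FT j : F j setT. Proof. exact: preimage_sigmaT. Qed.
Let Fm j : F j `<=` measurable. Proof. exact: preimage_sigma_sub. Qed.
Let jmW j : join_measurable F [set j] (W j).
Proof. by apply: join_measurable1 => B mB; exists B => //; rewrite setTI. Qed.

Let iW2 j : integrableR P (fun t => W j t * W j t).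
Proof. exact: L4_mul2. Qed.

Let covW a b j : cov2 P (fun t => a * W j t) (fun t => b * W j t) = a * b.
Proof.
rewrite /cov2 (@eq_Er _ _ _ _ _ (fun t => (a * b) * (W j t * W j t))); last first.
  by move=> t; ring.
rewrite ErZ// (@eq_Er _ _ _ _ _ (fun t => W j t ^+ 2)) ?EW2 ?mulr1//.
Qed.

Let EaW a j : 'Er_P[fun t => a * W j t] = 0.
Proof. by rewrite ErZ ?EW ?mulr0//; exact: L4_integrable. Qed.

Let jmaW (a : site -> R) j : join_measurable F [set j] (fun t => a j * W j t).
Proof. by apply: join_measurableM => //; exact: join_measurable_cst. Qed.

Lemma linear_field_mean i : 'Er_P[Y i] = 0.
Proof.
have h := dcvg4_Er_id (ZY i).
have z m : 'Er_P[Z i m] = 0.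
  rewrite Er_sum; last by move=> j _; exact: L4_integrable (L4Z _ (LW j)).
  by rewrite big1.
apply/eqP; rewrite eq_le; apply/andP; split.
  by apply: cvgn_le h _ => m; rewrite z.
rewrite -oppr_le0; apply: cvgn_le (cvgN h) _ => m.
by rewrite fctE /= z oppr0.
Qed.

(** The autocovariance is the autocorrelation of the kernel, and the square root of [norm1] is
    subadditive, so the weight at [j] is shared between the factors at [- k] and at [j - k]. The
    bound on partial sums is uniform and passes to the limit. *)
Lemma linear_field_autocov (J : seq site) : uniq J ->
  \sum_(j <- J) `|cov2 P (Y 0) (Y j)| * (1 + Num.sqrt (norm1 j)) <=
    K0 * (K0 + K1) + K1 * K0.
Proof.
move=> uJ.
have hm : (fun m => \sum_(j <- J) `|cov2 P (Z 0 m) (Z j m)| * (1 + Num.sqrt (norm1 j)))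
    @ \oo --> \sum_(j <- J) `|cov2 P (Y 0) (Y j)| * (1 + Num.sqrt (norm1 j)).
  apply: cvg_big => [|j _]; first exact: add_continuous.
  apply: cvgM; last exact: cvg_cst.
  by apply: cvg_norm; exact: (dcvg4_cov2 (ZY 0) (ZY j)).
apply: cvgn_le hm _ => m.
have um := fset_uniq (first_sites m).
have Ecov j : cov2 P (Z 0 m) (Z j m) =
    \sum_(k <- first_sites m) psi (0 - k) * psi (j - k).
  rewrite (cov2_sum FI FT Fm indW (jmaW (fun k => psi (0 - k)))
    (jmaW (fun k => psi (j - k))))//.
  - by apply: eq_bigr => k _; rewrite covW.
  - by move=> k; exact: L4Z.
  - by move=> k; exact: L4Z.
apply: (@le_trans _ _ (\sum_(k <- first_sites m) `|psi (0 - k)| *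
    \sum_(j <- J) `|psi (j - k)| *
      (1 + Num.sqrt (norm1 (0 - k)) + Num.sqrt (norm1 (j - k))))).
  under [leRHS]eq_bigr do rewrite big_distrr/=.
  rewrite exchange_big /=; apply: ler_sum => j _.
  rewrite Ecov.
  apply: (@le_trans _ _ ((\sum_(k <- first_sites m) `|psi (0 - k)| * `|psi (j - k)|)
      * (1 + Num.sqrt (norm1 j)))).
    apply: ler_wpM2r; first by rewrite addr_ge0// sqrtr_ge0.
    apply: (le_trans (ler_norm_sum _ _ _)).
    by apply: ler_sum => k _; rewrite normrM.
  rewrite big_distrl/=; apply: ler_sum => k _; rewrite -mulrA.
  apply: ler_wpM2l => //; apply: ler_wpM2l => //; rewrite -addrA lerD2l.
  have -> : norm1 (0 - k) = norm1 k :> R by rewrite sub0r norm1N.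
  by rewrite -{1}(addrNK k j) [_ + k]addrC sqrt_norm1D.
have step k : \sum_(j <- J) `|psi (j - k)| *
      (1 + Num.sqrt (norm1 (0 - k)) + Num.sqrt (norm1 (j - k))) <=
    K0 * (1 + Num.sqrt (norm1 (0 - k))) + K1.
  under eq_bigr do rewrite mulrDr.
  rewrite big_split /= -mulr_suml; apply: lerD.
    by apply: ler_wpM2r; rewrite ?psi_shift'// addr_ge0// sqrtr_ge0.
  have := @psi1 [seq j - k | j <- J]; rewrite big_map; apply.
  by rewrite map_inj_uniq// => x y /addIr.
apply: (@le_trans _ _ (\sum_(k <- first_sites m)
    (`|psi (0 - k)| * (K0 + K1) + `|psi (0 - k)| * Num.sqrt (norm1 (0 - k)) * K0))).
  apply: ler_sum => k _; apply: (@le_trans _ _ (`|psi (0 - k)| *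
      (K0 * (1 + Num.sqrt (norm1 (0 - k))) + K1))); first exact: ler_wpM2l.
  by rewrite le_eqVlt; apply/orP; left; apply/eqP; ring.
rewrite big_split /= -!mulr_suml; apply: lerD.
  by apply: ler_wpM2r; [exact: addr_ge0|exact: psi_shift].
apply: ler_wpM2r => //.
have := @psi1 [seq 0 - k | k <- first_sites m]; rewrite big_map; apply.
by rewrite map_inj_uniq// => x y /addrI /oppr_inj.
Qed.

Section linear_combination.
Variables (s : seq site) (us : uniq s).

(** The coefficient of [W j] in the form with coefficients [c]. It inherits from [c] a supremum
    bound ([b_le]) and a bound on its l^1 norm ([b_sum]). *)
Let b (c : site -> R) j := \sum_(i <- s) c i * psi (i - j).

Let AE (c : site -> R) m t :
  \sum_(i <- s) c i * Z i m t = \sum_(j <- first_sites m) b c j * W j t.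
Proof.
rewrite /Z; under eq_bigr do rewrite big_distrr/=.
rewrite exchange_big /=; apply: eq_bigr => j _.
by rewrite big_distrl /=; apply: eq_bigr => i _; rewrite mulrA.
Qed.

Let AY (c : site -> R) : dcvg4 P (fun m t => \sum_(j <- first_sites m) b c j * W j t)
  (fun t => \sum_(i <- s) c i * Y i t).
Proof.
rewrite (_ : (fun m t => _) = (fun m t => \sum_(i <- s) c i * Z i m t)); last first.
  by apply/funext => m; apply/funext => t; rewrite AE.
by apply: dcvg4_sum => i; exact: dcvg4Z (ZY i).
Qed.

Let b_le (c : site -> R) g j : (forall i, `|c i| <= g) -> `|b c j| <= g * K0.
Proof.
move=> cg; apply: (le_trans (ler_norm_sum _ _ _)).
have g0 : 0 <= g by exact: le_trans (cg 0).
apply: (@le_trans _ _ (\sum_(i <- s) g * `|psi (i - j)|)).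
  by apply: ler_sum => i _; rewrite normrM; exact: ler_wpM2r.
by rewrite -mulr_sumr; apply: ler_wpM2l => //; exact: psi_shift'.
Qed.

Let b_sum (c : site -> R) g (J : seq site) : uniq J -> (forall i, `|c i| <= g) ->
  \sum_(j <- J) `|b c j| <= g * K0 * (size s)%:R.
Proof.
move=> uJ cg; have g0 : 0 <= g by exact: le_trans (cg 0).
apply: (@le_trans _ _ (\sum_(j <- J) \sum_(i <- s) g * `|psi (i - j)|)).
  apply: ler_sum => j _; apply: (le_trans (ler_norm_sum _ _ _)).
  by apply: ler_sum => i _; rewrite normrM; exact: ler_wpM2r.
rewrite exchange_big /=.
apply: (@le_trans _ _ (\sum_(i <- s) g * K0)).
  apply: ler_sum => i _; rewrite -mulr_sumr; apply: ler_wpM2l => //.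
  exact: psi_shift.
by rewrite big_const_seq count_predT iter_addr_0 mulr_natr.
Qed.

(** By additivity the cumulant is the sum of [b_j^2 b'_j^2 (E W_j^4 - 3)]. Three of the four
    coefficients are bounded by [K0] and the last is summed, so the growth is linear in the number
    of sites, not quadratic. *)
Lemma linear_field_kappa (c c' : site -> R) :
  (forall i, `|c i| <= 1) -> (forall i, `|c' i| <= 1) ->
  `|kappa P (fun t => \sum_(i <- s) c i * Y i t) (fun t => \sum_(i <- s) c' i * Y i t)|
    <= (c4 + 3) * K0 ^+ 4 * (size s)%:R.
Proof.
move=> c1 c1'; apply: cvgn_le (cvg_norm (dcvg4_kappa (AY c) (AY c'))) _ => m /=.
have um := fset_uniq (first_sites m).
rewrite (kappa_sum FI FT Fm indW (jmaW (b c)) (jmaW (b c')))//; last 2 first.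
- by move=> k; exact: L4Z.
- by move=> k; exact: L4Z.
have kW j : `|kappa P (fun t => b c j * W j t) (fun t => b c' j * W j t)| <=
    (c4 + 3) * (K0 ^+ 3 * `|b c' j|).
  rewrite /kappa !covW.
  rewrite (@eq_Er _ _ _ _ _ (fun t => (b c j ^+ 2 * b c' j ^+ 2) * W j t ^+ 4)); last first.
    by move=> t; ring.
  rewrite ErZ; last by case: (LW j).
  rewrite [X in `|X|](_ : _ = b c j ^+ 2 * b c' j ^+ 2 * ('Er_P[fun t => W j t ^+ 4] - 3));
    last by ring.
  rewrite normrM mulrC; apply: ler_pM => //.
    apply: (le_trans (ler_normB _ _)); rewrite ger0_norm; last exact: Er_ge0.
    by rewrite ger0_norm// lerD2r.
  rewrite normrM !normrX [X in X <= _](_ : _ = `|b c j| ^+ 2 * `|b c' j| * `|b c' j|); last by ring.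
  apply: ler_wpM2r => //; rewrite [leRHS](_ : _ = K0 ^+ 2 * K0); last by ring.
  have := b_le j c1; have := b_le j c1'; rewrite !mul1r => h1 h2.
  by apply: ler_pM => //; exact: lerXn2r.
apply: (le_trans (ler_norm_sum _ _ _)).
apply: (@le_trans _ _ (\sum_(j <- first_sites m) (c4 + 3) * (K0 ^+ 3 * `|b c' j|))).
  by apply: ler_sum => j _; exact: kW.
rewrite -!mulr_sumr -mulrA; apply: ler_wpM2l; first by rewrite addr_ge0.
rewrite [leRHS](_ : _ = K0 ^+ 3 * (K0 * (size s)%:R)); last by ring.
apply: ler_wpM2l; first by rewrite exprn_ge0.
by have := b_sum um c1'; rewrite mul1r.
Qed.

(** The condition [m^2 <= size s] makes each normalised coefficient at most [K0 / m], as the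
    truncation of linear forms at level [m] requires. Taking [K0 + 1] keeps the constant positive
    when the kernel vanishes. *)
Lemma linear_field_heavy_light (c : site -> R) (m : R) :
  (forall i, `|c i| <= 1) -> 1 <= m -> m ^+ 2 <= (size s)%:R ->
  let A t := \sum_(i <- s) c i / Num.sqrt (size s)%:R * Y i t in
  let K := K0 + 1 in
  let C := 128 * (K ^+ 4 * (8 * (c4 + 1)) + 3 * K ^+ 4 * c4 ^+ 2 +
                  (4 * K) ^+ 8 * (8 ^+ 8 * (2 * expR 1))) in
  'Er_P[fun t => heavy m (A t ^+ 4)] <= C / m /\
  'Er_P[fun t => light m (A t ^+ 4) ^+ 2] <= C.
Proof.
move=> c1 m1 ms A K C.
have m0 : 0 < m by exact: lt_le_trans m1.
have N0 : 0 < (size s)%:R :> R by apply: lt_le_trans ms; exact: exprn_gt0.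
set q := Num.sqrt (size s)%:R in A *.
have q0 : 0 < q by rewrite sqrtr_gt0.
have qq : q * q = (size s)%:R by rewrite -expr2 sqr_sqrtr// ltW.
have mq : m <= q.
  by rewrite -(ler_pXn2r (_ : 0 < 2)%N) ?nnegrE ?(ltW m0) ?(ltW q0)// expr2 [leRHS]expr2 qq -expr2.
pose c' i := c i / q.
have c1' i : `|c' i| <= q^-1.
  by rewrite normrM (ger0_norm (ltW (_ : 0 < q^-1))) ?invr_gt0// ler_piMl// invr_ge0 ltW.
have K_gt0 : 0 < K by rewrite ltr_wpDl.
have bm j : `|b c' j| <= K / m.
  apply: (le_trans (b_le j c1')); rewrite mulrC; apply: ler_pM => //.
  - by rewrite invr_ge0 ltW.
  - by rewrite lerDl.
  - by rewrite lef_pV2.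
have bK n : \sum_(j <- first_sites n) b c' j ^+ 2 <= K ^+ 2.
  apply: (@le_trans _ _ (\sum_(j <- first_sites n) (q^-1 * K0) * `|b c' j|)).
    apply: ler_sum => j _; rewrite -[b c' j ^+ 2]ger0_norm ?sqr_ge0// normrX expr2.
    by apply: ler_wpM2r => //; exact: b_le.
  rewrite -mulr_sumr; apply: (@le_trans _ _ (q^-1 * K0 * (q^-1 * K0 * (size s)%:R))).
    apply: ler_wpM2l; first by rewrite mulr_ge0// invr_ge0 ltW.
    by apply: b_sum => //; exact: fset_uniq.
  rewrite -qq [leLHS](_ : _ = K0 ^+ 2); last by field; rewrite gt_eqF.
  by apply: lerXn2r; rewrite ?nnegrE// ?lerDl// ltW.
have h n := linear_form_heavy_light FI FT Fm indW jmW LW EW EW2 c4_ge0 EW4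
  (fset_uniq (first_sites n)) m1 K_gt0 bm (bK n).
split.
  apply: cvgn_le (dcvg4_heavy (ltW m0) (AY c')) _ => n.
  by have [] := h n.
apply: cvgn_le (dcvg4_light (ltW m0) (AY c')) _ => n.
by have [] := h n.
Qed.

End linear_combination.

End LinearField.

(** * Bounds available for every linear field *)

Section LinearFieldBounds.
Context {R : realType} {dim : nat} {d : measure_display} {T : measurableType d}.
Variable P : probability T R.
Local Notation site := 'rV[int]_dim.

(* What the theorem uses of a linear field. The last two bounds replace eighth
   moments, which are not available. *)
Record field_bounds (Y : site -> T -> R) (K : R) : Prop := FieldBounds {
  field_bound_ge1 : 1 <= K;
  field_L4 : forall i, L4 P (Y i);
  field_mean : forall i, 'Er_P[Y i] = 0;
  field_cov : forall i j, cov2 P (Y i) (Y j) = cov2 P (Y 0) (Y (j - i));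
  field_cov_even : forall j, cov2 P (Y 0) (Y (- j)) = cov2 P (Y 0) (Y j);
  field_autocov : forall J : seq site, uniq J ->
    \sum_(j <- J) `|cov2 P (Y 0) (Y j)| * (1 + Num.sqrt (norm1 j)) <= K;
  field_kappa : forall (s : seq site) (c c' : site -> R), uniq s ->
    (forall i, `|c i| <= 1) -> (forall i, `|c' i| <= 1) ->
    `|kappa P (fun t => \sum_(i <- s) c i * Y i t)
              (fun t => \sum_(i <- s) c' i * Y i t)| <= K * (size s)%:R;
  field_heavy : forall (s : seq site) (c : site -> R) (m : R), uniq s ->
    (forall i, `|c i| <= 1) -> 1 <= m -> m ^+ 2 <= (size s)%:R ->
    'Er_P[fun t => heavy m
      ((\sum_(i <- s) c i / Num.sqrt (size s)%:R * Y i t) ^+ 4)] <= K / m;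
  field_light : forall (s : seq site) (c : site -> R) (m : R), uniq s ->
    (forall i, `|c i| <= 1) -> 1 <= m -> m ^+ 2 <= (size s)%:R ->
    'Er_P[fun t => light m
      ((\sum_(i <- s) c i / Num.sqrt (size s)%:R * Y i t) ^+ 4) ^+ 2] <= K }.

Lemma norm1_ge1 (j : site) : j != 0 -> 1 <= norm1 j :> R.
Proof.
move=> j0; have [m jm] : exists m, j 0 m != 0.
  apply/existsP; rewrite -negb_forall; apply: contraNN j0 => /forallP h.
  by apply/eqP/rowP => m; rewrite mxE; apply/eqP.
rewrite /norm1 (bigD1 m)//=; apply: ler_wpDr; first exact: sumr_ge0.
by rewrite -intr_norm ler1z -gtz0_ge1 normr_gt0.
Qed.

(** The weight vanishes at the origin, so [psi 0] is added by hand; elsewhere the weight is at least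
    [1] and the weighted sum controls the plain one. *)
Lemma weight_bounds (psi : site -> R) :
  (\esum_(j in [set: site]) (`|psi j| * Num.sqrt (norm1 j))%:E < +oo)%E ->
  exists K0 K1, forall s : seq site, uniq s ->
    \sum_(j <- s) `|psi j| <= K0 /\
    \sum_(j <- s) `|psi j| * Num.sqrt (norm1 j) <= K1.
Proof.
move=> fin; set e := (\esum_(j in _) _)%E in fin.
have e0 : (0 <= e)%E.
  by apply: esum_ge0 => j _; rewrite lee_fin mulr_ge0// sqrtr_ge0.
have eE : e = (fine e)%:E by rewrite fineK// ge0_fin_numE.
have h1 s : uniq s -> \sum_(j <- s) `|psi j| * Num.sqrt (norm1 j) <= fine e.
  move=> us; rewrite -lee_fin -eE; apply: esum_ge; exists [set` s].
    by split => //; exact: finite_seq.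
  by rewrite -fsbig_seq// sumEFin.
exists (`|psi 0| + fine e), (fine e) => s us; split; last exact: h1.
apply: (@le_trans _ _ (\sum_(j <- s) (if j == 0 then `|psi 0| else 0) +
    \sum_(j <- s) `|psi j| * Num.sqrt (norm1 j))).
  rewrite -big_split; apply: ler_sum => j _ /=; case: eqP => [->|/eqP j0].
    by rewrite lerDl mulr_ge0// sqrtr_ge0.
  rewrite add0r ler_peMr// -sqrtr1 ler_sqrt ?norm1_ge1//.
  exact: norm1_ge0.
apply: lerD; last exact: h1.
rewrite -big_mkcond /=; have [s0|s0] := boolP (0 \in s).
  by rewrite -big_filter filter_pred1_uniq// big_seq1.
by rewrite big_seq_cond big1// => j /andP[js /eqP j0]; rewrite j0 (negbTE s0) in js.
Qed.

Lemma linear_field_bounds (Y : site -> {RV P >-> R}) :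
  linear_field Y -> exists K, field_bounds Y K.
Proof.
move=> [stY [W [psi [[stW indW W1 W2 W4] fin YE]]]].
have [K0 [K1 hK]] := weight_bounds fin.
have p4 (x : R) : `|x| ^+ 4 = x ^+ 4.
  by rewrite -normrX ger0_norm// (exprM _ 2 2) sqr_ge0.
have mW j : measurable_fun setT (W j) by [].
have mY j : measurable_fun setT (Y j) by [].
have LW j : L4 P (W j).
  split => //; apply: eq_integrableR (integrableR_ge0 _ _ (W4 j)) => [t||t].
  - exact: p4.
  - by apply: measurable_funX; exact: measurableT_comp.
  - by rewrite exprn_ge0.
have EW j : 'Er_P[W j] = 0 by have := W1 j; rewrite unlock /Rintegral => ->.
have EW2 j : 'Er_P[fun t => W j t ^+ 2] = 1.
  have := W2 j; rewrite unlock /Rintegral => h.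
  rewrite (_ : (\int[P]_x _)%E = 1%E)// -h; apply: eq_integral => t _.
  by rewrite real_normK// num_real.
(* The noise is stationary in law, so its fourth moment at the origin serves for every site. *)
pose c4 := 'Er_P[fun t => W 0 t ^+ 4].
have EW4 j : 'Er_P[fun t => W j t ^+ 4] <= c4.
  have mc : measurable_fun setT
      (fun y : g_sigma_algebraType (@cylinders R site) => y 0 ^+ 4).
    by apply: measurable_funX; exact: measurable_coordinate.
  have [_ ] := same_law_Er mW (fun k => mW (k + j)) (stW j) mc (LW 0).2.
  rewrite /realization /c4 => ->.
  by rewrite add0r.
have psi0 s us := (hK s us).1; have psi1 s us := (hK s us).2.
have LY := linear_field_L4 mW LW EW4 psi0 mY YE.
set C := 128 * ((K0 + 1) ^+ 4 * (8 * (c4 + 1)) + 3 * (K0 + 1) ^+ 4 * c4 ^+ 2 +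
                  (4 * (K0 + 1)) ^+ 8 * (8 ^+ 8 * (2 * expR 1))).
set K2 := K0 * (K0 + K1) + K1 * K0.
set K3 := (c4 + 3) * K0 ^+ 4.
pose K := 1 + `|C| + `|K2| + `|K3|.
have KC : C <= K by rewrite /K; have := ler_norm C; have := normr_ge0 K2; have := normr_ge0 K3; lra.
have K2K : K2 <= K by rewrite /K; have := ler_norm K2; have := normr_ge0 C;
  have := normr_ge0 K3; lra.
have K3K : K3 <= K by rewrite /K; have := ler_norm K3; have := normr_ge0 C;
  have := normr_ge0 K2; lra.
have covst i j t : cov2 P (Y i) (Y j) = cov2 P (Y (i + t)) (Y (j + t)).
  have mc : measurable_fun setT
      (fun y : g_sigma_algebraType (@cylinders R site) => y i * y j).
    by apply: measurable_funM; exact: measurable_coordinate.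
  by have [_ ] := same_law_Er mY (fun k => mY (k + t)) (stY t) mc (L4_mul2 (LY i) (LY j)).
exists K; split.
- by rewrite /K; have := normr_ge0 K2; have := normr_ge0 K3; have := normr_ge0 C; lra.
- exact: LY.
- exact: linear_field_mean mW LW EW EW4 psi0 mY YE.
- by move=> i j; rewrite (covst i j (- i)) subrr.
- move=> j; rewrite (covst 0 (- j) j) add0r addNr /cov2; apply: eq_Er => t.
  by rewrite mulrC.
- move=> J uJ; apply: le_trans K2K.
  exact: linear_field_autocov mW indW LW EW EW2 EW4 psi0 psi1 mY YE _ uJ.
- move=> s c c' us c1 c1'.
  have := linear_field_kappa mW indW LW EW EW2 EW4 psi0 mY YE us c1 c1'.
  by move=> /le_trans; apply; apply: ler_wpM2r.
- move=> s c m us c1 m1 ms.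
  have [] := linear_field_heavy_light mW indW LW EW EW2 EW4 psi0 mY YE us c1 m1 ms.
  move=> /le_trans + _; apply; apply: ler_wpM2r => //.
  by rewrite invr_ge0 (le_trans _ m1).
- move=> s c m us c1 m1 ms.
  have [_] := linear_field_heavy_light mW indW LW EW EW2 EW4 psi0 mY YE us c1 m1 ms.
  by move=> /le_trans; apply.
Qed.

End LinearFieldBounds.

(** * Spectra *)

Section Spectrum.
Context {R : realType} {dim : nat}.
Local Notation site := 'rV[int]_dim.
Local Open Scope complex_scope.

Local Existing Instance totally_filter.

Lemma partial_sum_fset (V : zmodType) (f : site -> V) (A : {fset site}) :
  partial_sum f A = \sum_(j <- A) f j.
Proof. by rewrite /partial_sum -(big_seq_fsetE _ A predT f). Qed.

Lemma ler_sum_fsubset (f : site -> R) (A B : {fset site}) :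
  (forall j, 0 <= f j) -> (A `<=` B)%fset ->
  \sum_(j <- A) f j <= \sum_(j <- B) f j.
Proof.
move=> f0 AB; rewrite [leRHS](big_fsetID _ (mem A))/=.
have -> : [fset x in B | x \in mem A]%fset = A.
  apply/fsetP => x; rewrite !inE /= andbC; case: (boolP (x \in A)) => //= xn.
  exact: (fsubsetP AB).
by rewrite lerDl sumr_ge0.
Qed.

Lemma summable_ge0_cvg (f : site -> R) (K : R) : (forall j, 0 <= f j) ->
  (forall A : {fset site}, \sum_(j <- A) f j <= K) ->
  exists l : R, partial_sum f @ totally --> l.
Proof.
move=> f0 fK; set D := range (fun A : {fset site} => \sum_(j <- A) f j).
have hD : has_sup D.
  split; first by exists (\sum_(j <- fset0 : {fset site}) f j); exists fset0.
  by exists K => _ [A _ <-].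
exists (sup D); apply/cvgrPdist_le => e e0.
have [_ [A _ <-] hA] := sup_adherent e0 hD.
exists A => // B /= AB; rewrite partial_sum_fset.
have h1 : \sum_(j <- B) f j <= sup D by apply: sup_upper_bound => //; exists B.
have h2 := ler_sum_fsubset f0 AB.
by rewrite ger0_norm ?subr_ge0//; lra.
Qed.

Lemma summable_cvg (f : site -> R) (K : R) :
  (forall A : {fset site}, \sum_(j <- A) `|f j| <= K) ->
  exists l : R, partial_sum f @ totally --> l.
Proof.
move=> fK.
have [l1 h1] : exists l : R, partial_sum (fun j => (`|f j| + f j) / 2) @ totally --> l.
  apply: (@summable_ge0_cvg _ K) => [j|A].
    by have := ler_norm (- f j); rewrite normrN; lra.
  apply: le_trans (fK A); apply: ler_sum => j _.
  by have := ler_norm (f j); lra.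
have [l2 h2] : exists l : R, partial_sum (fun j => (`|f j| - f j) / 2) @ totally --> l.
  apply: (@summable_ge0_cvg _ K) => [j|A].
    by have := ler_norm (f j); lra.
  apply: le_trans (fK A); apply: ler_sum => j _.
  by have := ler_norm (- f j); rewrite normrN; lra.
exists (l1 - l2).
have h : (fun A => partial_sum (fun j => (`|f j| + f j) / 2) A -
    partial_sum (fun j => (`|f j| - f j) / 2) A) @ totally --> l1 - l2.
  exact: cvgB h1 h2.
apply: cvg_trans h; apply: near_eq_cvg; apply: nearW => A; rewrite !partial_sum_fset -sumrB;
  apply: eq_bigr => j _.
by lra.
Qed.

Definition phase (xi : 'rV[R]_dim) (j : site) : R :=
  - (2 * pi * \sum_m xi 0 m * (j 0 m)%:~R).

Lemma phaseD xi i j : phase xi (i + j) = phase xi i + phase xi j.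
Proof.
rewrite /phase -opprD -mulrDr -big_split; congr (- (_ * _)).
by apply: eq_bigr => m _; rewrite mxE intrD mulrDr.
Qed.

Lemma phaseN xi j : phase xi (- j) = - phase xi j.
Proof.
rewrite /phase -[in RHS]mulrN -sumrN; congr (- (2 * pi * _)).
by apply: eq_bigr => m _; rewrite mxE mulrNz mulrN.
Qed.

Lemma phase_freqD xi zeta j : phase (xi + zeta) j = phase xi j + phase zeta j.
Proof.
rewrite /phase -opprD -mulrDr -big_split; congr (- (_ * _)).
by apply: eq_bigr => m _; rewrite mxE mulrDl.
Qed.

Lemma phase_freqN xi j : phase (- xi) j = - phase xi j.
Proof.
rewrite /phase -[in RHS]mulrN -sumrN; congr (- (2 * pi * _)).
by apply: eq_bigr => m _; rewrite mxE mulNr.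
Qed.

Lemma fourier_charE xi j : fourier_char xi j = cos (phase xi j) +i* sin (phase xi j).
Proof. by []. Qed.

Lemma complex_cvg (u v : {fset site} -> R) (a b : R) :
  u @ totally --> a -> v @ totally --> b ->
  (fun A => (u A +i* v A : R[i]^o)) @ totally --> (a +i* b : R[i]^o).
Proof.
move=> ua vb; apply/cvgrPdist_lt => e e0.
have e1 : 0 < complex.Re e by case: e e0 => er ei; rewrite ltcE /= => /andP[].
have eE : e = (complex.Re e)%:C.
  by case: e e0 {e1} => er ei; rewrite ltcE /= => /andP[/eqP -> _].
have e2 : 0 < complex.Re e / 2 by rewrite divr_gt0.
have /cvgrPdist_lt/(_ _ e2) hu := ua; have /cvgrPdist_lt/(_ _ e2) hv := vb.
move: hu hv; apply: filterS2 => A hu hv.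
rewrite eE; set x := a - u A in hu; set y := b - v A in hv.
have -> : (a +i* b - (u A +i* v A) : R[i]) = x +i* y by [].
rewrite normc_def ltcR /=.
apply: (@le_lt_trans _ _ (`|x| + `|y|)); last by rewrite (splitr (complex.Re e)) ltrD.
rewrite -[leRHS]ger0_norm ?addr_ge0// -sqrtr_sqr ler_sqrt ?sqr_ge0//.
have sq (z : R) : z ^+ 2 = `|z| ^+ 2 by rewrite -normrX ger0_norm ?sqr_ge0.
rewrite (sq x) (sq y); have : 0 <= `|x| * `|y| by exact: mulr_ge0.
by move: `|x| `|y| => p q; lra.
Qed.

Lemma partial_sum_complex (rho : site -> R) xi (A : {fset site}) :
  partial_sum (fun j => (rho j)%:C * fourier_char xi j : R[i]^o) A =
  (\sum_(j <- A) rho j * cos (phase xi j)) +i*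
  (\sum_(j <- A) rho j * sin (phase xi j)).
Proof.
rewrite partial_sum_fset; elim/big_rec3: _ => //= j z y x _ ->.
by rewrite fourier_charE; apply/eqP; rewrite eq_complex /= !mul0r subr0 addr0 !eqxx.
Qed.

Definition spectrum (rho : site -> R) xi : R :=
  complex.Re (sum (fun j => (rho j)%:C * fourier_char xi j : R[i]^o)).

(** The complex [sum] is a limit along finite sets and is meaningful only if that limit exists.
    Absolute summability makes the cosine and sine sums converge separately, and the real part is
    the cosine sum. *)
Lemma spectrum_cvg (rho : site -> R) (K : R) xi :
  (forall A : {fset site}, \sum_(j <- A) `|rho j| <= K) ->
  partial_sum (fun j => rho j * cos (phase xi j)) @ totally --> spectrum rho xi.
Proof.
move=> rK.
have [a ha] : exists l : R, partial_sum (fun j => rho j * cos (phase xi j)) @ totally --> l.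
  apply: (@summable_cvg _ K) => A; apply: le_trans (rK A); apply: ler_sum => j _.
  by rewrite normrM ler_piMr// ler_norml cos_geN1 cos_le1.
have [b hb] : exists l : R, partial_sum (fun j => rho j * sin (phase xi j)) @ totally --> l.
  apply: (@summable_cvg _ K) => A; apply: le_trans (rK A); apply: ler_sum => j _.
  by rewrite normrM ler_piMr// ler_norml sin_geN1 sin_le1.
have h := complex_cvg ha hb.
suff -> : spectrum rho xi = a by [].
rewrite /spectrum /sum.
have -> : partial_sum (fun j => (rho j)%:C * fourier_char xi j : R[i]^o) =
    (fun A => (partial_sum (fun j => rho j * cos (phase xi j)) A +i*
               partial_sum (fun j => rho j * sin (phase xi j)) A : R[i]^o)).
  by apply/funext => A; rewrite partial_sum_complex !partial_sum_fset.
by rewrite (cvg_lim _ h).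
Qed.

(** The set [B] is closed under negation so that sine sums against an even [rho] cancel over it, and
    contains a prescribed [A] so that no shift of interest is lost. *)
Lemma spectrum_near (rho : site -> R) (K : R) xi (A : {fset site}) (e : R) :
  (forall A : {fset site}, \sum_(j <- A) `|rho j| <= K) -> 0 < e ->
  exists B : {fset site}, [/\ (A `<=` B)%fset, (forall j, (- j \in B) = (j \in B)) &
    `|spectrum rho xi - \sum_(j <- B) rho j * cos (phase xi j)| <= e].
Proof.
move=> rK e0; have /cvgrPdist_le/(_ _ e0)[C _ hC] := spectrum_cvg (xi := xi) rK.
pose D := (A `|` C)%fset; pose B := (D `|` [fset - j | j in D])%fset.
have DB : (D `<=` B)%fset by exact: fsubsetUl.
exists B; split.
- by apply: fsubset_trans DB; exact: fsubsetUl.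
- move=> j; rewrite /B 2!(in_fsetU D) orbC.
  have E i : (i \in [fset - j | j in D]%fset) = (- i \in D).
    apply/imfsetP/idP => [[k kD ->]|iD]; first by rewrite opprK.
    by exists (- i); rewrite ?opprK.
  by rewrite E opprK E.
- have := hC B; rewrite partial_sum_fset; apply => /=.
  by apply: fsubset_trans DB; exact: fsubsetUr.
Qed.

Lemma spectrum_sum (L : finType) (c : L -> R) (rho : L -> site -> R) (K : R) xi :
  (forall l (A : {fset site}), \sum_(j <- A) `|rho l j| <= K) ->
  spectrum (fun j => \sum_l c l * rho l j) xi = \sum_l c l * spectrum (rho l) xi.
Proof.
move=> rK.
have h1 : partial_sum (fun j => (\sum_l c l * rho l j) * cos (phase xi j)) @ totally
    --> \sum_l c l * spectrum (rho l) xi.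
  have h : (fun A => \sum_l c l * partial_sum (fun j => rho l j * cos (phase xi j)) A)
      @ totally --> \sum_l c l * spectrum (rho l) xi.
    apply: cvg_big => [|l _]; first exact: add_continuous.
    apply: cvgM; first exact: cvg_cst.
    exact: spectrum_cvg (rK l).
  apply: cvg_trans h; apply: near_eq_cvg; apply: nearW => A.
  rewrite partial_sum_fset; under eq_bigr do rewrite partial_sum_fset big_distrr/=.
  rewrite exchange_big /=; apply: eq_bigr => j _; rewrite big_distrl/=.
  by apply: eq_bigr => l _; rewrite mulrA.
have h2 : partial_sum (fun j => (\sum_l c l * rho l j) * cos (phase xi j)) @ totally
    --> spectrum (fun j => \sum_l c l * rho l j) xi.
  apply: (@spectrum_cvg _ (\sum_l `|c l| * K)) => A.
  apply: (@le_trans _ _ (\sum_(j <- A) \sum_l `|c l| * `|rho l j|)).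
    apply: ler_sum => j _; apply: (le_trans (ler_norm_sum _ _ _)).
    by apply: ler_sum => l _; rewrite normrM.
  rewrite exchange_big /=; apply: ler_sum => l _; rewrite -mulr_sumr.
  exact: ler_wpM2l.
exact: (cvg_unique _ h2 h1).
Qed.

Lemma spectrum_le (rho : site -> R) (K : R) xi :
  (forall A : {fset site}, \sum_(j <- A) `|rho j| <= K) -> `|spectrum rho xi| <= K.
Proof.
move=> rK.
have h : (fun A => `|partial_sum (fun j => rho j * cos (phase xi j)) A|) @ totally
    --> `|spectrum rho xi|.
  by apply: cvg_norm; exact: spectrum_cvg rK.
rewrite -(cvg_lim _ h)//; apply: limr_le; first by apply/cvg_ex; exists `|spectrum rho xi|.
apply: nearW => A; rewrite partial_sum_fset; apply: le_trans (rK A).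
apply: (le_trans (ler_norm_sum _ _ _)); apply: ler_sum => j _.
by rewrite normrM ler_piMr// ler_norml cos_geN1 cos_le1.
Qed.

Lemma power_spectrumE d (T : measurableType d) (P : probability T R)
    (Y : site -> T -> R) xi :
  power_spectrum P Y xi = spectrum (fun j => cov2 P (Y 0) (Y j)) xi.
Proof.
rewrite /power_spectrum /spectrum.
have -> // : autocov P Y = (fun j => cov2 P (Y 0) (Y j)).
by apply/funext => j; rewrite /autocov unlock.
Qed.

End Spectrum.

(** * Sums over the box *)

Section Characters.
Context {R : realType}.
Local Open Scope complex_scope.

Definition expi (x : R) : R[i] := cos x +i* sin x.

Lemma expiD x y : expi (x + y) = expi x * expi y.
Proof.
rewrite /expi cosD sinD; apply/eqP; rewrite eq_complex /= eqxx /=.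
by apply/eqP; ring.
Qed.

Lemma expi0 : expi 0 = 1.
Proof. by rewrite /expi cos0 sin0. Qed.

Lemma expi_sum (I : finType) (f : I -> R) : expi (\sum_i f i) = \prod_i expi (f i).
Proof. by apply: (big_morph expi expiD expi0). Qed.

Lemma expiMn x n : expi (x *+ n) = expi x ^+ n.
Proof.
by elim: n => [|n ih]; rewrite ?mulr0n ?expi0// mulrS expiD ih exprS.
Qed.

Lemma expi_2pi_int (k : int) : expi (2 * pi * k%:~R) = 1.
Proof.
have h (n : nat) : expi (2 * pi * n%:R) = 1.
  rewrite mulr_natr expiMn (_ : 2 * pi = pi *+ 2); last by rewrite mulr_natl.
  by rewrite /expi cos2pi sin2pi expr1n.
case: k => n; first exact: h.
have := h n.+1; rewrite NegzE mulrNz mulrN => h1.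
have := expiD (2 * pi * n.+1%:R) (- (2 * pi * n.+1%:R)).
by rewrite subrr expi0 h1 mul1r => <-.
Qed.

(** After reduction of [k] to a remainder [0 < r < N], the real part is [1 - 2 sin(pi r / N)^2], and
    this sine is positive. *)
Lemma expi_neq1 (N : nat) (k : int) : (0 < N)%N -> ~~ (N%:Z %| k)%Z ->
  expi (2 * pi * (k%:~R / N%:R)) != 1.
Proof.
move=> N0 Nk; have NR : N%:R != 0 :> R by rewrite pnatr_eq0 -lt0n.
have -> : 2 * pi * (k%:~R / N%:R) =
    2 * pi * ((k %/ N%:Z)%Z)%:~R + 2 * pi * (((k %% N%:Z)%Z)%:~R / N%:R) :> R.
  rewrite {1}(divz_eq k N%:Z) intrD intrM; field.
  by [].
rewrite expiD expi_2pi_int mul1r.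
have r0 : 0 <= (k %% N%:Z)%Z by rewrite modz_ge0// -lt0n.
have rN : (k %% N%:Z)%Z < N%:Z by rewrite ltz_pmod.
have rn0 : (k %% N%:Z)%Z != 0 by apply: contraNneq Nk => h; exact/dvdz_mod0P.
move: r0 rN rn0; set r := (k %% N%:Z)%Z => r0 rN rn0.
have r0' : 0 < r%:~R :> R by rewrite ltr0z lt_neqAle eq_sym rn0.
have rN' : r%:~R < N%:R :> R by rewrite -[N%:R]/((N%:Z)%:~R) ltr_int.
have NR0 : 0 < N%:R :> R by rewrite ltr0n.
pose x := pi * (r%:~R / N%:R) : R.
have x0 : 0 < x < pi.
  by rewrite mulr_gt0 ?divr_gt0 ?pi_gt0//= gtr_pMr ?pi_gt0// ltr_pdivrMr// mul1r.
have -> : 2 * pi * (r%:~R / N%:R) = x *+ 2 by rewrite /x mulr2n; ring.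
have := sin_gt0_pi x0 => sx.
rewrite /expi eq_complex /= negb_and; apply/orP; left.
rewrite cos_mulr2n cos2sin2 -subr_eq0.
have : 0 < sin x ^+ 2 by rewrite exprn_gt0.
by rewrite mulr2n => ?; apply/eqP; lra.
Qed.

(** Orthogonality of the characters modulo [N], by a geometric sum whose ratio is an [N]-th root of
    unity. The offset [c] is there because the box does not start at [0]. *)
Lemma sum_expi (N : nat) (k c : int) : (0 < N)%N ->
  \sum_(y < N) expi (- (2 * pi * (k%:~R / N%:R)) * (y%:Z - c)%:~R) =
  if (N%:Z %| k)%Z then N%:R else 0.
Proof.
move=> N0; have NR : N%:R != 0 :> R by rewrite pnatr_eq0 -lt0n.
case: ifPn => Nk.
  have /dvdzP[q ->] := Nk.
  rewrite (eq_bigr (fun=> 1)) ?sumr_const ?card_ord// => y _.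
  have -> : - (2 * pi * ((q * N)%:~R / N%:R)) * (y%:Z - c)%:~R =
      2 * pi * (- q * (y%:Z - c))%:~R :> R.
    by rewrite !intrM intrN; field.
  exact: expi_2pi_int.
set th := 2 * pi * (k%:~R / N%:R).
have th1 : expi (- th) != 1.
  have -> : - th = 2 * pi * ((- k)%:~R / N%:R) by rewrite /th intrN; field.
  by apply: expi_neq1 => //; rewrite rpredN.
under eq_bigr => y _.
  have -> : - th * (y%:Z - c)%:~R = th * c%:~R + (- th) *+ y.
    by rewrite intrB -[(- th) *+ y]mulr_natr; ring.
  rewrite expiD expiMn; over.
rewrite -big_distrr /=; apply/eqP; rewrite mulf_eq0; apply/orP; right.
have xN : expi (- th) ^+ N = 1.
  rewrite -expiMn (_ : _ *+ N = 2 * pi * (- k)%:~R); first exact: expi_2pi_int.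
  by rewrite -mulr_natr /th intrN; field.
have := subrX1 (expi (- th)) N; rewrite xN subrr => /esym/eqP.
by rewrite mulf_eq0 subr_eq0 (negbTE th1).
Qed.

End Characters.

Section Box.
Context {dim : nat}.
Variable N : nat.
Local Notation site := 'rV[int]_dim.

(** The least coordinate of the box is [- uphalf N + 1], whence the offset. Indexing by finite
    functions lets sums of products over the box factor over the coordinates. *)
Definition box_point (x : {ffun 'I_dim -> 'I_N}) : site :=
  \row_m ((x m)%:Z - ((uphalf N)%:Z - 1)).

Definition box_seq : seq site := [seq box_point x | x : {ffun 'I_dim -> 'I_N}].

Lemma box_point_inj : injective box_point.
Proof.
move=> x y /rowP h; apply/ffunP => m; apply/val_inj/eqP.
by have := h m; rewrite !mxE => /addIr/eqP; rewrite eqz_nat.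
Qed.

Lemma box_seq_uniq : uniq box_seq.
Proof. by rewrite map_inj_uniq ?enum_uniq//; exact: box_point_inj. Qed.

Lemma size_box_seq : size box_seq = (N ^ dim)%N.
Proof. by rewrite size_map -cardE card_ffun !card_ord. Qed.

Lemma mem_box_seq (k : site) : (k \in box_seq) <-> box N k.
Proof.
split.
  move=> /mapP[x _ ->] m; rewrite !mxE.
  have := ltn_ord (x m); have := uphalf_half N; have := odd_double_half N.
  by move: (odd N) (N./2) (uphalf N) (nat_of_ord (x m)) => [] *; lia.
move=> kb; have kN m : (absz (k ord0 m + ((uphalf N)%:Z - 1))%R < N)%N.
  have := kb m; have := uphalf_half N; have := odd_double_half N.
  by move: (k 0 m) (odd N) (N./2) (uphalf N) => ? []; lia.
apply/mapP; exists [ffun m => Ordinal (kN m)]; first by rewrite mem_enum.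
apply/rowP => m; rewrite !mxE ffunE /=.
by have := kb m; move: (k 0 m) (uphalf N) (N./2) => *; lia.
Qed.

Lemma box_seqE : box N = [set` box_seq].
Proof. by apply/seteqP; split => k /=; rewrite mem_box_seq. Qed.

Lemma big_box_seq (V : nmodType) (f : site -> V) :
  \sum_(i <- box_seq) f i = \sum_(x : {ffun 'I_dim -> 'I_N}) f (box_point x).
Proof. by rewrite big_map big_enum. Qed.

Definition in_box (j : site) : bool := j \in box_seq.

Definition outside (y : nat) (j : int) : bool := ~~ (0 <= y%:Z + j < N%:Z).

Lemma in_box_shift (x : {ffun 'I_dim -> 'I_N}) (j : site) :
  ~~ in_box (box_point x + j) ->
  exists m, outside (x m) (j 0 m).
Proof.
move=> h; apply/existsP; apply: contraNT h; rewrite negb_exists => /forallP h.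
apply/mem_box_seq => m; have := h m; rewrite /outside negbK; rewrite !mxE.
have := uphalf_half N; have := odd_double_half N.
by move: (odd N) (N./2) (uphalf N) (nat_of_ord (x m)) (j 0 m) => [] *; lia.
Qed.

Lemma count_out1 (j : int) :
  (\sum_(y < N) outside y j <= `|j|)%N.
Proof.
rewrite /outside; case: j => n.
  apply: (@leq_trans (\sum_(y < N | (N - n <= y)%N) 1)).
    rewrite [leqRHS]big_mkcond; apply: leq_sum => y _ /=.
    case: ifP => [_|/negbT h]; first exact: leq_b1.
    by rewrite leqn0 eqb0 negbK; have := ltn_ord y; lia.
  rewrite -(big_mkord (fun y => (N - n <= y)%N) (fun=> 1%N)).
  rewrite (eq_bigl (fun y => predT y && (N - n <= y)%N))//.
  rewrite -big_nat_widenl// sum_nat_const_nat muln1 /=; lia.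
(* [Negz n] is [- n.+1], so the positions that leave are the first [n.+1]. *)
apply: (@leq_trans (\sum_(y < N | (y < n.+1)%N) 1)).
  rewrite [leqRHS]big_mkcond; apply: leq_sum => y _ /=.
  case: ifP => [_|/negbT h]; first exact: leq_b1.
  by rewrite leqn0 eqb0 negbK NegzE; have := ltn_ord y; lia.
rewrite -(big_mkord (fun y => (y < n.+1)%N) (fun=> 1%N)).
rewrite (@big_nat_widen _ _ _ 0 N (maxn N n.+1)) ?leq_maxl//.
apply: (@leq_trans (\sum_(0 <= y < maxn N n.+1 | (y < n.+1)%N) 1)).
  rewrite big_mkcond [leqRHS]big_mkcond; apply: leq_sum => y _ /=.
  by case: (y < n.+1)%N => //=; case: (_ < _)%N.
rewrite (eq_bigl (fun y => predT y && (y < n.+1)%N))//.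
by rewrite -big_nat_widen ?leq_maxr// sum_nat_const_nat muln1 subn0.
Qed.

(** Each value of one coordinate is shared by [N^(dim - 1)] points; multiplying by [N] avoids the
    subtraction in the exponent. *)
Lemma sum_one_coordinate (m : 'I_dim) (p : 'I_N -> nat) :
  (N * \sum_(x : {ffun 'I_dim -> 'I_N}) p (x m) = N ^ dim * \sum_y p y)%N.
Proof.
pose G m' y := (if m' == m then p y else 1)%N.
have -> : (\sum_(x : {ffun 'I_dim -> 'I_N}) p (x m) =
    \sum_(x : {ffun 'I_dim -> 'I_N}) \prod_m' G m' (x m'))%N.
  apply: eq_bigr => x _; rewrite (bigD1 m)//= big1 ?muln1 /G ?eqxx// => m' /negbTE ->.
  by [].
rewrite -bigA_distr_bigA (bigD1 m)//=.
have -> : (\sum_j G m j = \sum_y p y)%N by apply: eq_bigr => y _; rewrite /G eqxx.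
rewrite [X in (_ * (_ * X))%N](eq_bigr (fun=> N)); last first.
  move=> m' /negbTE m'm; rewrite (eq_bigr (fun=> 1%N)) ?sum1_card ?card_ord// => y _.
  by rewrite /G m'm.
rewrite prod_nat_const cardC1 card_ord mulnCA mulnC; congr (_ * _)%N.
by rewrite -expnS prednK// (leq_ltn_trans _ (ltn_ord m)).
Qed.

Lemma count_out (j : site) :
  (N * \sum_(i <- box_seq) ~~ in_box (i + j) <= N ^ dim * \sum_m `|j ord0 m|)%N.
Proof.
rewrite big_map big_enum /=.
apply: (@leq_trans (N * \sum_(x : {ffun 'I_dim -> 'I_N})
    \sum_m outside (x m) (j ord0 m)))%N.
  rewrite leq_mul2l; apply/orP; right; apply: leq_sum => x _.
  case: (boolP (in_box _)) => //= /in_box_shift[m hm].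
  by rewrite (bigD1 m)//= hm.
rewrite exchange_big /= big_distrr big_distrr /=; apply: leq_sum => m _.
rewrite (sum_one_coordinate m (fun y => outside y (j ord0 m))).
by rewrite leq_mul2l count_out1 orbT.
Qed.

End Box.

Section BoxSums.
Context {R : realType} {dim : nat}.
Variables (N : nat) (N0 : (0 < N)%N).
Local Notation site := 'rV[int]_dim.
Local Notation ND := ((N ^ dim)%:R : R).
Local Notation box := (@box_seq dim N).
Local Open Scope complex_scope.

Let NR0 : 0 < N%:R :> R. Proof. by rewrite ltr0n. Qed.
Let ND0 : 0 < ND. Proof. by rewrite ltr0n expn_gt0 N0. Qed.

(** The count is at most [N^dim x] with [x = |j|_1 / N], and also at most [N^dim]; the minimum of
    [1] and [x] is at most the square root of [x]. The square root matches the weight available on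
    the autocovariance, and this is the source of the rate [N^(-1/2)] of the bias. *)
Lemma out_of_box_le (j : site) :
  \sum_(i <- box) (~~ in_box N (i + j))%:R <= ND * (Num.sqrt (norm1 j) / Num.sqrt N%:R).
Proof.
set S := \sum_(i <- box) _.
have SN : S = (\sum_(i <- box) ~~ in_box N (i + j))%:R by rewrite /S natr_sum.
have h1 : N%:R * S <= ND * norm1 j.
  rewrite SN -natrM /norm1.
  have -> : \sum_m `|(j 0 m)%:~R| = (\sum_m `|j ord0 m|)%N%:R :> R.
    by rewrite natr_sum; apply: eq_bigr => m _; rewrite natr_absz intr_norm.
  by rewrite -natrM ler_nat count_out.
have h2 : S <= ND.
  rewrite -(size_box_seq (dim := dim)) -sum1_size natr_sum.
  by apply: ler_sum => i _; rewrite ler_nat leq_b1.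
have S0 : 0 <= S by apply: sumr_ge0.
have x0 : 0 <= norm1 j / N%:R :> R by rewrite divr_ge0 ?norm1_ge0// ltW.
rewrite -sqrtrV ?ler0n// -sqrtrM ?norm1_ge0//.
set x := norm1 j / N%:R in x0 *.
have h3 : S <= ND * x by rewrite /x mulrA ler_pdivlMr// mulrC.
have [x1|x1] := leP 1 (Num.sqrt x).
  by apply: (le_trans h2); rewrite ler_peMr// ltW.
apply: (le_trans h3); rewrite ler_pM2l// -{1}(sqr_sqrtr x0) expr2.
by rewrite ler_piMr ?sqrtr_ge0// ltW.
Qed.

Lemma sum_phase (k : site) :
  \sum_(i <- box) cos (phase (grid_freq N k : 'rV[R]_dim) i) =
    (if [forall m, (N%:Z %| k ord0 m)%Z] then ND else 0) /\
  \sum_(i <- box) sin (phase (grid_freq N k : 'rV[R]_dim) i) = 0.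
Proof.
have E : \sum_(i <- box) expi (phase (grid_freq N k : 'rV[R]_dim) i) =
    (if [forall m, (N%:Z %| k ord0 m)%Z] then ND else 0)%:C.
  rewrite big_box_seq.
  have ph (x : {ffun 'I_dim -> 'I_N}) :
      expi (phase (grid_freq N k : 'rV[R]_dim) (box_point x)) =
      \prod_m expi (- (2 * pi * ((k ord0 m)%:~R / N%:R)) *
        ((x m)%:Z - ((uphalf N)%:Z - 1))%:~R).
    rewrite -expi_sum /phase mulr_sumr -sumrN; congr expi; apply: eq_bigr => m _.
    by rewrite /grid_freq /box_point !mxE; ring.
  under eq_bigr do rewrite ph.
  rewrite -(bigA_distr_bigA (fun m (y : 'I_N) =>
    expi (- (2 * pi * ((k ord0 m)%:~R / N%:R)) * (y%:Z - ((uphalf N)%:Z - 1))%:~R))).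
  under eq_bigr do rewrite sum_expi//.
  case: ifPn => [/forallP h|].
    under eq_bigr do rewrite h.
    by rewrite prodr_const card_ord natrX rmorphXn /= rmorph_nat.
  rewrite negb_forall => /existsP[m hm].
  by rewrite (bigD1 m)//= (negbTE hm) mul0r.
have ReE : complex.Re (\sum_(i <- box) expi (phase (grid_freq N k : 'rV[R]_dim) i)) =
    \sum_(i <- box) cos (phase (grid_freq N k : 'rV[R]_dim) i).
  by elim/big_rec2: _ => //= i y z _ <-; case: z.
have ImE : complex.Im (\sum_(i <- box) expi (phase (grid_freq N k : 'rV[R]_dim) i)) =
    \sum_(i <- box) sin (phase (grid_freq N k : 'rV[R]_dim) i).
  by elim/big_rec2: _ => //= i y z _ <-; case: z.
by rewrite -ReE -ImE E.
Qed.

(* The values of an even summable autocovariance [rho] seen from a site of the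
   box only miss the shifts leaving the box, which are controlled by
   [out_of_box_le]. *)
Lemma covariance_transform (rho : site -> R) (K : R) (xi : 'rV[R]_dim)
    (f g g' : site -> R) : 1 <= K ->
  (forall A : {fset site}, \sum_(j <- A) `|rho j| * (1 + Num.sqrt (norm1 j)) <= K) ->
  (forall j, rho (- j) = rho j) ->
  (forall i, `|f i| <= 1) -> (forall i, `|g i| <= 1) -> (forall i, `|g' i| <= 1) ->
  (forall i j, g (i + j) = cos (phase xi j) * g i + sin (phase xi j) * g' i) ->
  `|ND^-1 * \sum_(i <- box) \sum_(i' <- box) rho (i' - i) * (f i * g i') -
     spectrum rho xi * (ND^-1 * \sum_(i <- box) f i * g i)| <= 3 * K / Num.sqrt N%:R.
Proof.
move=> K1 rK rE f1 g1 g1' gD.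
have q0 : 0 < Num.sqrt N%:R :> R by rewrite sqrtr_gt0.
have K0 : 0 < K by exact: lt_le_trans K1.
have absK (A : {fset site}) : \sum_(j <- A) `|rho j| <= K.
  apply: le_trans (rK A); apply: ler_sum => j _; rewrite ler_peMr// lerDl.
  exact: sqrtr_ge0.
have e0 : 0 < K / Num.sqrt N%:R by rewrite divr_gt0.
(* All differences of two sites of the box, so that every shift occurring in the double sum lies in
   [B]. *)
pose A : {fset site} := seq_fset tt [seq i' - i | i' <- box, i <- box].
have [B [AB BN hB]] := @spectrum_near _ _ rho K xi A _ absK e0.
set SB := \sum_(j <- B) rho j * cos (phase xi j) in hB.
have sinB : \sum_(j <- B) rho j * sin (phase xi j) = 0.
  set X := \sum_(j <- B) _; suff : X = - X by move=> ?; lra.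
  rewrite {1}/X (perm_big [seq - j | j <- B]) /=.
    rewrite big_map /X -sumrN; apply: eq_bigr => j _.
    by rewrite rE phaseN sinN mulrN.
  apply: uniq_perm; first exact: fset_uniq.
    by rewrite map_inj_uniq ?fset_uniq//; exact: oppr_inj.
  move=> j; apply/idP/mapP => [jB|[k kB ->]].
    by exists (- j); rewrite ?BN ?opprK.
  by rewrite BN.
(* The sum over the box is the sum over all shifts in [B] less those that leave the box. The full
   sum is [SB * g i] by the addition formula, its sine part being [sinB]. *)
have inner i : i \in box -> \sum_(i' <- box) rho (i' - i) * g i' =
    SB * g i - \sum_(j <- B) (~~ in_box N (i + j))%:R * (rho j * g (i + j)).
  move=> ib.
  have -> : \sum_(i' <- box) rho (i' - i) * g i' =
      \sum_(j <- B | in_box N (i + j)) rho j * g (i + j).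
    rewrite -[RHS]big_filter [RHS](perm_big [seq i' - i | i' <- box]) /=.
      by rewrite big_map; apply: eq_bigr => i' _; rewrite (addrC i) subrK.
    apply: uniq_perm; first by rewrite filter_uniq// fset_uniq.
      by rewrite map_inj_uniq ?box_seq_uniq// => x y /addIr.
    move=> j; rewrite mem_filter; apply/andP/mapP => [[jb jB]|[i' i'b ->]].
      by exists (i + j); rewrite // addrAC subrr add0r.
    split; first by rewrite /in_box (addrC i) subrK.
    apply: (fsubsetP AB); rewrite seq_fsetE; apply/allpairsP; exists (i', i).
    by split.
  have -> : SB * g i = \sum_(j <- B) rho j * g (i + j).
    under [RHS]eq_bigr do rewrite gD mulrDr !mulrA.
    by rewrite big_split /= -!mulr_suml sinB mul0r addr0.
  rewrite big_mkcond -sumrB; apply: eq_bigr => j _.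
  by case: (in_box N (i + j)); rewrite /= ?mul0r ?subr0 ?mul1r ?subrr.
have gB i j : `|g (i + j)| <= 1 by [].
have E : \sum_(i <- box) \sum_(i' <- box) rho (i' - i) * (f i * g i') =
    SB * (\sum_(i <- box) f i * g i) -
    \sum_(i <- box) f i * \sum_(j <- B) (~~ in_box N (i + j))%:R * (rho j * g (i + j)).
  rewrite mulr_sumr -sumrB big_seq [RHS]big_seq; apply: eq_bigr => i ib.
  rewrite mulrCA -mulrBr -inner// mulr_sumr; apply: eq_bigr => i' _.
  by rewrite mulrCA.
have tail : `|\sum_(i <- box) f i *
    \sum_(j <- B) (~~ in_box N (i + j))%:R * (rho j * g (i + j))| <=
    ND * (K / Num.sqrt N%:R).
  apply: (le_trans (ler_norm_sum _ _ _)).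
  apply: (@le_trans _ _ (\sum_(i <- box) \sum_(j <- B)
      (~~ in_box N (i + j))%:R * `|rho j|)).
    apply: ler_sum => i _; rewrite normrM.
    apply: (@le_trans _ _ (1 * `|\sum_(j <- B) (~~ in_box N (i + j))%:R *
      (rho j * g (i + j))|)); first exact: ler_wpM2r.
    rewrite mul1r; apply: (le_trans (ler_norm_sum _ _ _)); apply: ler_sum => j _.
    rewrite !normrM ger0_norm//; apply: ler_wpM2l => //.
    by rewrite ler_piMr.
  rewrite exchange_big /=.
  apply: (@le_trans _ _ (\sum_(j <- B) ND / Num.sqrt N%:R *
      (`|rho j| * (1 + Num.sqrt (norm1 j))))).
    apply: ler_sum => j _; rewrite -mulr_suml.
    apply: (@le_trans _ _ (ND * (Num.sqrt (norm1 j) / Num.sqrt N%:R) * `|rho j|)).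
      by apply: ler_wpM2r => //; exact: out_of_box_le.
    rewrite [leLHS](_ : _ = ND / Num.sqrt N%:R * (`|rho j| * Num.sqrt (norm1 j))); last by ring.
    apply: ler_wpM2l; first by rewrite divr_ge0// ltW.
    by apply: ler_wpM2l => //; rewrite lerDr.
  rewrite -mulr_sumr [leRHS](_ : _ = ND / Num.sqrt N%:R * K); last by ring.
  by apply: ler_wpM2l; [rewrite divr_ge0// ltW|exact: rK].
have fgN : `|\sum_(i <- box) f i * g i| <= ND.
  apply: (le_trans (ler_norm_sum _ _ _)).
  rewrite -(size_box_seq (dim := dim)) -sum1_size natr_sum; apply: ler_sum => i _.
  by rewrite normrM -[leRHS]mulr1; apply: ler_pM.
rewrite E mulrBr.
set FG := \sum_(i <- box) f i * g i in fgN *.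
set TL := \sum_(i <- box) _ in tail *.
rewrite [X in `|X|](_ : _ = ND^-1 * ((SB - spectrum rho xi) * FG - TL)); last by ring.
rewrite normrM gtr0_norm ?invr_gt0// ler_pdivrMl//.
apply: (le_trans (ler_normB _ _)); rewrite normrM.
apply: (@le_trans _ _ (K / Num.sqrt N%:R * ND + ND * (K / Num.sqrt N%:R))).
  apply: lerD => //; apply: ler_pM => //.
  by rewrite distrC.
rewrite [leRHS](_ : _ = 3 * (ND * (K / Num.sqrt N%:R))); last by ring.
by have : 0 < ND * (K / Num.sqrt N%:R); [rewrite mulr_gt0|lra].
Qed.

End BoxSums.

(** * Averages of independent variables *)

Section IndependentMeans.
Context {R : realType} {d : measure_display} {T : measurableType d}.
Variables (P : probability T R) (I : choiceType) (F : I -> set_system T).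
Hypothesis FI : forall i, setI_closed (F i).
Hypothesis FT : forall i, F i setT.
Hypothesis Fm : forall i, F i `<=` measurable.
Hypothesis indF : mutually_independent P F.
Variables (n : nat) (n0 : (0 < n)%N) (J : 'I_n -> set I).
Hypothesis Jdisj : forall s s', s != s' -> J s `&` J s' = set0.

Local Notation jm := (join_measurable F).
Let NR0 : 0 < n%:R :> R. Proof. by rewrite ltr0n. Qed.

Definition centred_mean (Y : 'I_n -> T -> R) (t : T) : R :=
  n%:R^-1 * \sum_(s < n) (Y s t - 'Er_P[Y s]).

Lemma integrableR_sqr (X : T -> R) : measurable_fun setT X ->
  integrableR P (fun t => X t ^+ 2) -> integrableR P X.
Proof.
move=> mX iX; apply: (integrableR_le mX (integrableRD (integrableR_cst P 1) iX)) => t.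
have := (sqr_ge0 (X t - 1), sqr_ge0 (X t + 1), sqr_ge0 (X t)) => -[[? ?] ?].
by rewrite /= ler_norml; apply/andP; split; lra.
Qed.

(** Disjoint blocks are independent, so only the diagonal of the double sum survives. *)
Lemma centred_mean_sqr (Y : 'I_n -> T -> R) (V : R) :
  (forall s, jm (J s) (Y s)) -> (forall s, integrableR P (fun t => Y s t ^+ 2)) ->
  (forall s, 'Er_P[fun t => Y s t ^+ 2] <= V) ->
  integrableR P (fun t => centred_mean Y t ^+ 2) /\
  'Er_P[fun t => centred_mean Y t ^+ 2] <= V / n%:R.
Proof.
move=> mY iY2 EY2.
have mYT s : measurable_fun setT (Y s) := join_measurable_meas Fm (mY s).
have iY s : integrableR P (Y s) := integrableR_sqr (mYT s) (iY2 s).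
pose U s t := Y s t - 'Er_P[Y s].
have icst s : integrableR P (cst 'Er_P[Y s]) := integrableR_cst P _.
have iU s : integrableR P (U s) by exact: integrableRB (iY s) (icst s).
have EU s : 'Er_P[U s] = 0 by rewrite (ErB (iY s) (icst s)) Er_cst subrr.
have jU s : jm (J s) (U s).
  by apply: join_measurableD => //; exact: join_measurable_cst.
have mU s : measurable_fun setT (U s) := join_measurable_meas Fm (jU s).
have q s t : U s t ^+ 2 = Y s t ^+ 2 + (- 2 * 'Er_P[Y s]) * Y s t + 'Er_P[Y s] ^+ 2.
  by rewrite /U; ring.
have iU2 s : integrableR P (fun t => U s t ^+ 2).
  apply: (@eq_integrableR _ _ _ _ (fun t => Y s t ^+ 2 +
    (- 2 * 'Er_P[Y s]) * Y s t + 'Er_P[Y s] ^+ 2)) => [t|]; first by rewrite q.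
  exact: integrableRD (integrableRD (iY2 s) (integrableRZ _ (iY s))) (integrableR_cst P _).
have EU2 s : 'Er_P[fun t => U s t ^+ 2] <= V.
  rewrite (eq_Er _ (q s)).
  have i3 := integrableRZ (- 2 * 'Er_P[Y s]) (iY s).
  rewrite (ErD (integrableRD (iY2 s) i3) (integrableR_cst P ('Er_P[Y s] ^+ 2))).
  rewrite (ErD (iY2 s) i3) (ErZ _ (iY s)) Er_cst.
  by have := sqr_ge0 'Er_P[Y s]; have := EY2 s; lra.
have iUU s s' : integrableR P (fun t => U s t * U s' t).
  apply: (@integrableR_le _ _ _ _ _ (fun t => U s t ^+ 2 + U s' t ^+ 2)).
  - exact: measurable_funM.
  - exact: integrableRD.
  - move=> t; have := (sqr_ge0 (U s t - U s' t), sqr_ge0 (U s t + U s' t)) => -[? ?].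
    have := (sqr_ge0 (U s t), sqr_ge0 (U s' t)) => -[? ?].
    by rewrite ler_norml; apply/andP; split; lra.
have EUU s s' : s' != s -> 'Er_P[fun t => U s t * U s' t] = 0.
  rewrite eq_sym => ss'.
  by rewrite (indep_ErM FI FT Fm indF (Jdisj ss') (jU s) (jU s')) ?EU ?mul0r.
have sq t : centred_mean Y t ^+ 2 =
    (n%:R^-1) ^+ 2 * \sum_(s < n) \sum_(s' < n) U s t * U s' t.
  rewrite /centred_mean exprMn; congr (_ * _).
  by rewrite expr2 mulr_suml; apply: eq_bigr => s _; rewrite mulr_sumr.
have iS : integrableR P (fun t => \sum_(s < n) \sum_(s' < n) U s t * U s' t).
  by apply: integrableR_sum => s _; exact: integrableR_sum.
split; first by apply: eq_integrableR (integrableRZ _ iS) => t; rewrite sq.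
rewrite (eq_Er _ sq) (ErZ _ iS) Er_sum; last by move=> s _; exact: integrableR_sum.
apply: (@le_trans _ _ ((n%:R^-1) ^+ 2 * \sum_(s < n) V)).
  apply: ler_wpM2l; first exact: sqr_ge0.
  apply: ler_sum => s _; rewrite Er_sum// (bigD1 s)//= big1 ?addr0; last first.
    by move=> s' /EUU.
  by rewrite (@eq_Er _ _ _ _ _ (fun t => U s t ^+ 2)) ?EU2// => t; rewrite expr2.
rewrite sumr_const card_ord -mulr_natr le_eqVlt; apply/orP; left; apply/eqP.
by field; rewrite gt_eqF.
Qed.

(** AM-GM, to be integrated pointwise in place of Jensen's inequality: with [c] the square root of
    [n], a variance [V / n] becomes a mean absolute value of order [n^(-1/2)]. *)
Lemma abs_le_sqr (c q : R) : 0 < c -> `|q| <= (c * q ^+ 2 + c^-1) / 2.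
Proof.
move=> c0; rewrite ler_pdivlMr// -(ler_pM2l c0) [leRHS]mulrDr divff ?gt_eqF//.
have := sqr_ge0 (c * `|q| - 1); have -> : q ^+ 2 = `|q| ^+ 2.
  by rewrite -normrX ger0_norm ?sqr_ge0.
by move: `|q| => x; lra.
Qed.

Lemma centred_mean_abs (Y : 'I_n -> T -> R) (V : R) :
  (forall s, jm (J s) (Y s)) -> (forall s, integrableR P (fun t => Y s t ^+ 2)) ->
  (forall s, 'Er_P[fun t => Y s t ^+ 2] <= V) ->
  integrableR P (fun t => `|centred_mean Y t|) /\
    'Er_P[fun t => `|centred_mean Y t|] <= (V + 1) / Num.sqrt n%:R.
Proof.
move=> mY iY2 EY2; have [i2 E2] := centred_mean_sqr mY iY2 EY2.
have c0 : 0 < Num.sqrt n%:R :> R by rewrite sqrtr_gt0.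
set c := Num.sqrt n%:R in c0 *.
have cc : c * c = n%:R by rewrite -expr2 sqr_sqrtr// ltW.
have mC : measurable_fun setT (centred_mean Y).
  apply: measurable_funM => //; apply: measurable_sum => s.
  by apply: measurable_funB => //; exact: join_measurable_meas (@mY s).
have iB : integrableR P (fun t => 2^-1 * (c * centred_mean Y t ^+ 2 + c^-1)).
  by apply: integrableRZ; exact: integrableRD (integrableRZ _ i2) (integrableR_cst P _).
have le t : `|centred_mean Y t| <= 2^-1 * (c * centred_mean Y t ^+ 2 + c^-1).
  by rewrite mulrC; exact: abs_le_sqr.
have iA : integrableR P (fun t => `|centred_mean Y t|).
  apply: integrableR_le iB _; first exact: measurableT_comp.
  by move=> t; rewrite normr_id.
split => //; apply: (le_trans (le_Er iA iB le)).
rewrite (ErZ _ (integrableRD (integrableRZ c i2) (integrableR_cst P c^-1))).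
rewrite (ErD (integrableRZ c i2) (integrableR_cst P c^-1)) (ErZ _ i2) Er_cst.
have V0 : 0 <= V.
  by apply: le_trans (EY2 (Ordinal n0)); apply: Er_ge0 => t; exact: sqr_ge0.
apply: (@le_trans _ _ (2^-1 * (c * (V / n%:R) + c^-1))).
  by rewrite ler_pM2l// lerD2r ler_pM2l.
rewrite -cc [leLHS](_ : _ = (V + 1) / 2 / c); last by field; rewrite gt_eqF.
by rewrite ler_pM2r ?invr_gt0//; lra.
Qed.

(* Only [V] is square integrable: the mean of [light c (Y s)] is controlled by its
   variance and that of [heavy c (Y s)] by its expectation, with [c] the square
   root of [n]. *)
Lemma centred_mean_truncated (Y U V : 'I_n -> T -> R) (e K : R) :
  (forall s, jm (J s) (Y s)) -> (forall s, integrableR P (Y s)) ->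
  (forall s, integrableR P (U s)) -> (forall s, integrableR P (fun t => V s t ^+ 2)) ->
  (forall s t, 0 <= Y s t) -> (forall s t, 0 <= U s t) -> (forall s t, 0 <= V s t) ->
  (forall s t, Y s t <= U s t + V s t) ->
  (forall s, 'Er_P[U s] <= e) -> (forall s, 'Er_P[fun t => V s t ^+ 2] <= K) ->
  integrableR P (fun t => `|centred_mean Y t|) /\
    'Er_P[fun t => `|centred_mean Y t|] <= 4 * e + (4 * K + 1) / Num.sqrt n%:R.
Proof.
move=> mY iY iU iV Y0 U0 V0 YUV EU EV.
have c0 : 0 < Num.sqrt n%:R :> R by rewrite sqrtr_gt0.
set c := Num.sqrt n%:R in c0 *.
have cc : c * c = n%:R by rewrite -expr2 sqr_sqrtr// ltW.
have e0 : 0 <= e by apply: le_trans (EU (Ordinal n0)); exact: Er_ge0.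
have K0 : 0 <= K.
  by apply: le_trans (EV (Ordinal n0)); apply: Er_ge0 => t; exact: sqr_ge0.
have mYT s : measurable_fun setT (Y s) := join_measurable_meas Fm (@mY s).
pose g s t := light c (Y s t); pose h s t := heavy c (Y s t).
have jg s : jm (J s) (g s).
  by apply: join_measurable_comp (@mY s); exact: measurable_light.
have mg s : measurable_fun setT (g s) := join_measurable_meas Fm (jg s).
have mh s : measurable_fun setT (h s).
  exact: measurableT_comp (measurable_heavy c) (mYT s).
have g0 s t : 0 <= g s t by rewrite light_ge0// ltW.
have ig s : integrableR P (g s).
  by apply: (@integrableR_bounded _ _ _ _ _ c) => // t; rewrite ger0_norm// light_le.
have ig2 s : integrableR P (fun t => g s t ^+ 2).
  apply: (@integrableR_bounded _ _ _ _ _ (c ^+ 2)); first exact: measurable_funX.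
  move=> t; rewrite ger0_norm ?sqr_ge0//; apply: lerXn2r; rewrite ?nnegrE ?light_le//.
  exact: ltW.
have iB s : integrableR P (fun t => U s t + c^-1 * V s t ^+ 2).
  exact: integrableRD (iU s) (integrableRZ _ (iV s)).
have hB s t : h s t <= U s t + c^-1 * V s t ^+ 2.
  by rewrite [c^-1 * _]mulrC; exact: heavy_le_split (YUV s t).
have ih s : integrableR P (h s).
  by apply: integrableR_le (iB s) _ => // t; rewrite ger0_norm ?heavy_ge0.
have Eh s : 'Er_P[h s] <= e + K / c.
  apply: (le_trans (le_Er (ih s) (iB s) (hB s))).
  rewrite (ErD (iU s) (integrableRZ _ (iV s))) (ErZ _ (iV s)) [K / c]mulrC.
  by apply: lerD => //; rewrite ler_pM2l// invr_gt0.
have Eh0 s : 0 <= 'Er_P[h s] by apply: Er_ge0 => t; exact: heavy_ge0.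
(* The term [2 c e] is harmless: after division by [n = c^2] and multiplication by [c / 2] it
   contributes just [e]. *)
have Eg2 s : 'Er_P[fun t => g s t ^+ 2] <= 2 * c * e + 2 * K.
  have i' := integrableRD (integrableRZ (2 * c) (iU s)) (integrableRZ 2 (iV s)).
  apply: (@le_trans _ _ 'Er_P[fun t => 2 * c * U s t + 2 * V s t ^+ 2]).
    by apply: le_Er => // t; exact: light_sqr_le_split (ltW c0) _ _ _ (YUV s t).
  rewrite (ErD (integrableRZ _ (iU s)) (integrableRZ _ (iV s))) (ErZ _ (iU s)) (ErZ _ (iV s)).
  by apply: lerD; [rewrite ler_pM2l ?mulr_gt0|rewrite ler_pM2l].
have [icg Ecg] := centred_mean_sqr jg ig2 Eg2.
pose bound t := 2^-1 * (c * centred_mean g t ^+ 2 + c^-1) +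
  n%:R^-1 * \sum_(s < n) (h s t + 'Er_P[h s]).
have ihE s : integrableR P (fun t => h s t + 'Er_P[h s]).
  exact: integrableRD (ih s) (integrableR_cst P _).
have ihS : integrableR P (fun t => \sum_(s < n) (h s t + 'Er_P[h s])).
  exact: integrableR_sum.
have iq : integrableR P (fun t => 2^-1 * (c * centred_mean g t ^+ 2 + c^-1)).
  by apply: integrableRZ; exact: integrableRD (integrableRZ _ icg) (integrableR_cst P _).
have ib : integrableR P bound by exact: integrableRD iq (integrableRZ _ ihS).
have lb t : `|centred_mean Y t| <= bound t.
  have -> : centred_mean Y t = centred_mean g t +
      n%:R^-1 * \sum_(s < n) (h s t - 'Er_P[h s]).
    rewrite -mulrDr -big_split; congr (_ * _); apply: eq_bigr => s _ /=.
    have -> : 'Er_P[Y s] = 'Er_P[g s] + 'Er_P[h s].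
      by rewrite -(ErD (ig s) (ih s)); apply: eq_Er => u; rewrite light_heavy.
    by rewrite -[in LHS](light_heavy c (Y s t)) /g /h; ring.
  apply: (le_trans (ler_normD _ _)); apply: lerD.
    by rewrite mulrC; exact: abs_le_sqr.
  rewrite normrM gtr0_norm ?invr_gt0// ler_pM2l ?invr_gt0//.
  apply: (le_trans (ler_norm_sum _ _ _)); apply: ler_sum => s _.
  by apply: (le_trans (ler_normB _ _)); rewrite !ger0_norm ?heavy_ge0.
have mC : measurable_fun setT (centred_mean Y).
  apply: measurable_funM => //; apply: measurable_sum => s.
  by apply: measurable_funB.
have iA : integrableR P (fun t => `|centred_mean Y t|).
  apply: integrableR_le ib _; first exact: measurableT_comp.
  by move=> t; rewrite normr_id.
split => //; apply: (le_trans (le_Er iA ib lb)).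
rewrite (ErD iq (integrableRZ _ ihS)) (ErZ _ ihS) Er_sum//.
rewrite (ErZ _ (integrableRD (integrableRZ c icg) (integrableR_cst P c^-1))).
rewrite (ErD (integrableRZ c icg) (integrableR_cst P c^-1)) (ErZ _ icg) Er_cst.
apply: (@le_trans _ _ (2^-1 * (c * ((2 * c * e + 2 * K) / n%:R) + c^-1) +
    n%:R^-1 * \sum_(s < n) (2 * (e + K / c)))).
  apply: lerD; first by rewrite ler_pM2l// lerD2r ler_pM2l.
  rewrite ler_pM2l ?invr_gt0//; apply: ler_sum => s _.
  rewrite (ErD (ih s) (integrableR_cst P 'Er_P[h s])) Er_cst.
  by have := Eh s; lra.
rewrite sumr_const card_ord -[X in _ + _ * X <= _]mulr_natr -cc.
rewrite [leLHS](_ : _ = 3 * e + (3 * K + 1 / 2) / c); last by field; rewrite gt_eqF.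
apply: lerD; first by lra.
by rewrite ler_pM2r ?invr_gt0//; lra.
Qed.

End IndependentMeans.

(** * Invariance of the field bounds under equality in law *)

Section FieldTransfer.
Context {R : realType} {dim : nat}.
Local Notation site := 'rV[int]_dim.
Context {d : measure_display} {T : measurableType d} {P : probability T R}.
Context {d' : measure_display} {T' : measurableType d'} {P' : probability T' R}.
Variables (Y : site -> T -> R) (Y' : site -> T' -> R).
Hypotheses (mY : forall i, measurable_fun setT (Y i)).
Hypotheses (mY' : forall i, measurable_fun setT (Y' i)).
Hypothesis law : same_law P Y P' Y'.

Let mcoord (i : site) : measurable_fun setT
  (fun y : g_sigma_algebraType (@cylinders R site) => y i) := measurable_coordinate i.

Lemma same_law_L4 i : L4 P (Y i) -> L4 P' (Y' i).
Proof.
move=> [mYi iYi]; split => //.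
have mf : measurable_fun setT
    (fun y : g_sigma_algebraType (@cylinders R site) => y i ^+ 4).
  by apply: measurable_funX; exact: mcoord.
by have [] := same_law_Er mY mY' law mf iYi.
Qed.

Hypothesis LY : forall i, L4 P (Y i).

Lemma same_law_cov2 i j : cov2 P (Y i) (Y j) = cov2 P' (Y' i) (Y' j).
Proof.
have mf : measurable_fun setT
    (fun y : g_sigma_algebraType (@cylinders R site) => y i * y j).
  by apply: measurable_funM; exact: mcoord.
by have [] := same_law_Er mY mY' law mf (L4_mul2 (LY i) (LY j)).
Qed.

(** The copies come with the law of a linear field but without a noise or a kernel, so the
    construction cannot be repeated on their space. Every bound of the record is about expectations
    of measurable functions of the realization, and these depend on the law alone. *)
Lemma field_bounds_same_law K : field_bounds P Y K -> field_bounds P' Y' K.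
Proof.
move=> [K1 _ mean cov even autocov kap hvy lgt].
have LY' i := same_law_L4 (LY i).
pose form (s : seq site) (c : site -> R) (y : g_sigma_algebraType (@cylinders R site)) :=
  \sum_(i <- s) c i * y i.
have mform s c : measurable_fun setT (form s c).
  by apply: measurable_sum => i; apply: measurable_funM => //; exact: mcoord.
have Lform s c : L4 P (fun t => form s c (realization Y t)).
  by apply: L4_sum => i _; exact: (L4Z (c i) (LY i)).
have covform s c c' : cov2 P (fun t => form s c (realization Y t))
    (fun t => form s c' (realization Y t)) =
    cov2 P' (fun t => form s c (realization Y' t)) (fun t => form s c' (realization Y' t)).
  have [] // := same_law_Er (f := fun y => form s c y * form s c' y) mY mY' law.
    exact: measurable_funM.
  exact: L4_mul2.
have kapform s c c' : kappa P (fun t => form s c (realization Y t))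
    (fun t => form s c' (realization Y t)) =
    kappa P' (fun t => form s c (realization Y' t)) (fun t => form s c' (realization Y' t)).
  rewrite /kappa !covform; congr (_ - _ - _).
  have [] // := same_law_Er
    (f := fun y => form s c y * form s c y * form s c' y * form s c' y) mY mY' law.
    by repeat apply: measurable_funM.
  exact: L4_mul4.
split => //.
- move=> i; rewrite -(mean i).
  by have [_ ->] := same_law_Er (f := fun y => y i) mY mY' law (mcoord i) (L4_integrable (LY i)).
- by move=> i j; rewrite -!same_law_cov2.
- by move=> j; rewrite -!same_law_cov2.
- by move=> A uA; under eq_bigr do rewrite -same_law_cov2; exact: autocov.
- by move=> s c c' us c1 c1'; have := kap s c c' us c1 c1'; rewrite kapform.
- move=> s c m us c1 m1 ms.
  have m0 : 0 <= m by exact: le_trans m1.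
  have := hvy s c m us c1 m1 ms.
  have [] // := same_law_Er (f := fun y =>
    heavy m (form s (fun i => c i / Num.sqrt (size s)%:R) y ^+ 4)) mY mY' law.
  + apply: measurableT_comp; [exact: measurable_heavy|exact: measurable_funX].
  + have [mL iL] := Lform s (fun i => c i / Num.sqrt (size s)%:R).
    apply: integrableR_le iL _.
      apply: measurableT_comp; [exact: measurable_heavy|exact: measurable_funX].
    move=> t; rewrite ger0_norm ?heavy_ge0// /heavy ge_max (exprM _ 2 2) sqr_ge0 andbT.
    by rewrite lerBlDr lerDl.
  + by move=> _ ->.
- move=> s c m us c1 m1 ms.
  have m0 : 0 <= m by exact: le_trans m1.
  have := lgt s c m us c1 m1 ms.
  have [] // := same_law_Er (f := fun y =>
    light m (form s (fun i => c i / Num.sqrt (size s)%:R) y ^+ 4) ^+ 2) mY mY' law.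
  + apply: measurable_funX.
    apply: measurableT_comp; [exact: measurable_light|exact: measurable_funX].
  + have [mL iL] := Lform s (fun i => c i / Num.sqrt (size s)%:R).
    apply: (@integrableR_bounded _ _ _ _ _ (m ^+ 2)).
      apply: measurable_funX.
      apply: measurableT_comp; [exact: measurable_light|exact: measurable_funX].
    move=> t; rewrite ger0_norm ?sqr_ge0//; apply: lerXn2r; rewrite ?nnegrE ?light_le//.
    by rewrite light_ge0// (exprM _ 2 2) sqr_ge0.
  + by move=> _ ->.
Qed.

End FieldTransfer.

Lemma field_bounds_le {R : realType} {dim : nat} {d : measure_display}
    {T : measurableType d} (P : probability T R) (Y : 'rV[int]_dim -> T -> R)
    (K K' : R) : K <= K' -> field_bounds P Y K -> field_bounds P Y K'.
Proof.
move=> KK' [K1 L mean cov even autocov kap hvy lgt]; split => //.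
- exact: le_trans KK'.
- by move=> J uJ; exact: le_trans (autocov J uJ) KK'.
- move=> s c c' us c1 c1'; apply: le_trans (kap s c c' us c1 c1') _.
  exact: ler_wpM2r.
- move=> s c m us c1 m1 ms; apply: le_trans (hvy s c m us c1 m1 ms) _.
  by apply: ler_wpM2r => //; rewrite invr_ge0 (le_trans _ m1).
- by move=> s c m us c1 m1 ms; exact: le_trans (lgt s c m us c1 m1 ms) KK'.
Qed.

(** * Cosines and sines on the frequency grid *)

Section GridTrigonometry.
Context {R : realType} {dim : nat}.
Variables (N : nat) (N0 : (0 < N)%N).
Local Notation site := 'rV[int]_dim.
Local Notation ND := ((N ^ dim)%:R : R).
Local Notation box := (@box_seq dim N).
Local Open Scope complex_scope.

Let ND0 : 0 < ND. Proof. by rewrite ltr0n expn_gt0 N0. Qed.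

Definition trig (b : bool) (k i : site) : R :=
  let theta := phase (grid_freq N k : 'rV[R]_dim) i in
  if b then sin theta else cos theta.

Definition overlap (f g : site -> R) : R := ND^-1 * \sum_(i <- box) f i * g i.

Lemma grid_freqD (k1 k2 : site) :
  grid_freq N (k1 + k2) = grid_freq N k1 + grid_freq N k2 :> 'rV[R]_dim.
Proof. by apply/rowP => m; rewrite !mxE rmorphD mulrDl. Qed.

Lemma grid_freqN (k : site) : grid_freq N (- k) = - grid_freq N k :> 'rV[R]_dim.
Proof. by apply/rowP => m; rewrite !mxE rmorphN mulNr. Qed.

Lemma trig_le b k i : `|trig b k i| <= 1.
Proof. by rewrite ler_norml /trig; case: b; rewrite ?sin_geN1 ?sin_le1 ?cos_geN1 ?cos_le1. Qed.

Lemma overlap_le (f g : site -> R) : (forall i, `|f i| <= 1) ->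
  (forall i, `|g i| <= 1) -> `|overlap f g| <= 1.
Proof.
move=> f1 g1; rewrite /overlap normrM gtr0_norm ?invr_gt0//.
rewrite mulrC ler_pdivrMr// mul1r; apply: (le_trans (ler_norm_sum _ _ _)).
apply: (@le_trans _ _ (\sum_(i <- box) 1)).
  by apply: ler_sum => i _; rewrite normrM; apply: mulr_ile1.
by rewrite big_const_seq count_predT iter_addr addr0 size_box_seq.
Qed.

Lemma trig_cov (rho : site -> R) (K : R) (f : site -> R) b (k : site) : 1 <= K ->
  (forall A : {fset site}, \sum_(j <- A) `|rho j| * (1 + Num.sqrt (norm1 j)) <= K) ->
  (forall j, rho (- j) = rho j) -> (forall i, `|f i| <= 1) ->
  `|ND^-1 * \sum_(i <- box) \sum_(i' <- box) rho (i' - i) * (f i * trig b k i') -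
     spectrum rho (grid_freq N k) * overlap f (trig b k)| <= 3 * K / Num.sqrt N%:R.
Proof.
(* The companion [g'] in the addition formula is the cosine for a sine and minus the sine for a
   cosine. *)
move=> K1 rK re f1; apply: (@covariance_transform _ _ _ N0 _ _ _ _ _
   (fun i => if b then trig false k i else - trig true k i)) => //.
- by move=> i; exact: trig_le.
- by move=> i; case: b; rewrite ?normrN; exact: trig_le.
- by move=> i j; rewrite /trig phaseD; case: b; rewrite ?sinD ?cosD; ring.
Qed.

Lemma overlap_self k : overlap (trig false k) (trig false k) +
  overlap (trig true k) (trig true k) = 1.
Proof.
rewrite /overlap -mulrDr -big_split /=.
rewrite (eq_bigr (fun=> 1)); last by move=> i _; rewrite -!expr2 cos2Dsin2.
by rewrite big_const_seq count_predT iter_addr addr0 size_box_seq mulVf ?gt_eqF.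
Qed.

Let indicator (k : site) : R := if [forall m, (N%:Z %| k ord0 m)%Z] then 1 else 0.

Let mean_cos (k : site) : ND^-1 * \sum_(i <- box) trig false k i = indicator k.
Proof.
have [-> _] := @sum_phase R dim N N0 k.
by rewrite /indicator; case: ifP => _; rewrite ?mulr0// mulVf ?gt_eqF.
Qed.

Let mean_sin (k : site) : ND^-1 * \sum_(i <- box) trig true k i = 0.
Proof. by have [_ ->] := @sum_phase R dim N N0 k; rewrite mulr0. Qed.

Let overlapE (f g : site -> R) (b b' : bool) (x y : R) k k' :
  (forall i, f i * g i = x * trig b k i + y * trig b' k' i) ->
  overlap f g = x * (ND^-1 * \sum_(i <- box) trig b k i) +
                y * (ND^-1 * \sum_(i <- box) trig b' k' i).
Proof.
move=> fg; rewrite /overlap (eq_bigr _ (fun i _ => fg i)) big_split/= -!mulr_sumr; ring.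
Qed.

(** Let [p] and [q] be the indicators of [k1 = k2] and [k1 = - k2] modulo [N]. By the product-to-sum
    formulas the cosine and sine overlaps are [(p + q) / 2] and [(p - q) / 2] and the mixed ones
    vanish; the squares add up because [p^2 = p] and [q^2 = q]. *)
Lemma overlap_sqr_sum_indicator (k1 k2 : site) :
  2 * \sum_b1 \sum_b2 overlap (trig b1 k1) (trig b2 k2) ^+ 2 =
  indicator (k1 - k2) + indicator (k1 + k2).
Proof.
have cc : overlap (trig false k1) (trig false k2) =
    (indicator (k1 - k2) + indicator (k1 + k2)) / 2.
  rewrite (@overlapE _ _ false false 2^-1 2^-1 (k1 - k2) (k1 + k2)).
    by rewrite !mean_cos; field.
  move=> i; rewrite /trig !grid_freqD !grid_freqN !phase_freqD !phase_freqN.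
  by rewrite cosB cosD; field.
have ss : overlap (trig true k1) (trig true k2) =
    (indicator (k1 - k2) - indicator (k1 + k2)) / 2.
  rewrite (@overlapE _ _ false false 2^-1 (- 2^-1) (k1 - k2) (k1 + k2)).
    by rewrite !mean_cos; field.
  move=> i; rewrite /trig !grid_freqD !grid_freqN !phase_freqD !phase_freqN.
  by rewrite cosB cosD; field.
have sc : overlap (trig true k1) (trig false k2) = 0.
  rewrite (@overlapE _ _ true true 2^-1 2^-1 (k1 - k2) (k1 + k2)).
    by rewrite !mean_sin; ring.
  move=> i; rewrite /trig !grid_freqD !grid_freqN !phase_freqD !phase_freqN.
  by rewrite sinB sinD; field.
have cs : overlap (trig false k1) (trig true k2) = 0.
  rewrite (@overlapE _ _ true true (- 2^-1) 2^-1 (k1 - k2) (k1 + k2)).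
    by rewrite !mean_sin; ring.
  move=> i; rewrite /trig !grid_freqD !grid_freqN !phase_freqD !phase_freqN.
  by rewrite sinB sinD; field.
rewrite !big_bool /= cc ss sc cs.
have sq k : indicator k ^+ 2 = indicator k.
  by rewrite /indicator; case: ifP => _; rewrite ?expr1n// expr0n.
rewrite -[in RHS](sq (k1 - k2)) -[in RHS](sq (k1 + k2)); by field.
Qed.

Let eqmodNP (k k' : site) :
  reflect (eqmodN N k k') [forall m, (N%:Z %| (k - k') ord0 m)%Z].
Proof.
apply: (iffP forallP) => h m; have := h m; rewrite !mxE.
  by move=> /dvdz_mod0P e; apply/eqP; rewrite eqz_mod_dvd; apply/dvdz_mod0P.
by move/eqP; rewrite eqz_mod_dvd.
Qed.

(** Each coordinate of the box ranges over [N] consecutive integers, so a multiple of [N] that is a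
    difference of two of them is zero. *)
Let box_eqmodN (k k' : site) : @Defs.box dim N k -> @Defs.box dim N k' ->
  eqmodN N k k' -> k = k'.
Proof.
move=> bk bk' e; apply/rowP => m.
have := (bk m, bk' m, e m) => -[[/andP[? ?] /andP[? ?]]].
move/eqP; rewrite eqz_mod_dvd => /dvdzP[q eq].
suff q0 : q = 0.
  by apply/eqP; rewrite -subr_eq0; apply/eqP; move: eq; rewrite q0 mul0r.
have [//|q0] := eqVneq q 0; exfalso.
have : (`|k ord0 m - k' ord0 m| < N%:Z).
  change (`|k 0 m - k' 0 m| < N%:Z); lia.
rewrite eq normrM => h.
have : 1 <= `|q| by lia.
nia.
Qed.

(** Translates the condition in [deltaN], stated over the reals, into the divisibility of [2 k] by
    [N] that orthogonality produces. *)
Let double_half (k : site) : [forall m, (N%:Z %| (k + k) ord0 m)%Z] =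
  `[< forall m, exists z : int, (k 0 m)%:~R = N%:R / 2 * z%:~R :> R >].
Proof.
apply/forallP/asboolP => h m.
  have /dvdzP[z e] := h m; exists z.
  have : ((k + k) ord0 m)%:~R = (z * N%:Z)%:~R :> R by rewrite e.
  rewrite !mxE intrD intrM; have -> : (N%:Z)%:~R = N%:R :> R by [].
  by move=> e'; lra.
have [z e] := h m; apply/dvdzP; exists z; apply: (@intr_inj R).
rewrite !mxE intrD intrM; have -> : (N%:Z)%:~R = N%:R :> R by [].
by rewrite e; field.
Qed.

(* On a half box [k1 = - k2] modulo [N] forces [k1 = k2]. *)
Lemma overlap_sqr_sum (M : set site) k1 k2 : half_box N M -> M k1 -> M k2 ->
  2 * \sum_b1 \sum_b2 overlap (trig b1 k1) (trig b2 k2) ^+ 2 = deltaN N k1 k2.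
Proof.
move=> [Mbox _ Mhalf] M1 M2; rewrite overlap_sqr_sum_indicator /deltaN.
have [->|k12] := eqVneq k1 k2.
  rewrite subrr -double_half /indicator.
  have -> : [forall m, (N%:Z %| (0%R : site) ord0 m)%Z] by apply/forallP => m; rewrite mxE dvdz0.
  by case: ifP => _ //; rewrite ?addr0.
have n1 : ~ eqmodN N k1 k2.
  by move=> e; case/eqP: k12; apply: box_eqmodN e; exact: Mbox.
have n2 : ~ eqmodN N k1 (- k2).
  move=> e; apply: n1; have e1 := Mhalf _ _ M1 M2 e.
  move=> m; have := (e m, e1 m) => -[/eqP + /eqP]; rewrite !eqz_mod_dvd !mxE.
  move=> h1 h2; apply/eqP; rewrite eqz_mod_dvd.
  have -> : k1 ord0 m - k2 ord0 m =
    (k1 ord0 m - - k1 ord0 m) - (k1 ord0 m - - k2 ord0 m) by ring.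
  exact: rpredB.
rewrite /indicator.
rewrite (negbTE (introN (eqmodNP _ _) n1)).
have -> : k1 + k2 = k1 - (- k2) by rewrite opprK.
by rewrite (negbTE (introN (eqmodNP _ _) n2)) addr0.
Qed.

Lemma periodogramE (y : site -> R) k : periodogram N y k =
  \sum_b (\sum_(i <- box) trig b k i / Num.sqrt (size box)%:R * y i) ^+ 2.
Proof.
rewrite /periodogram box_seqE -fsbig_seq ?box_seq_uniq//.
rewrite (_ : \sum_(i <- box) _ =
    (\sum_(i <- box) trig false k i * y i) +i* (\sum_(i <- box) trig true k i * y i)).
  rewrite normc_def /= sqr_sqrtr ?addr_ge0 ?sqr_ge0// big_bool /= addrC mulrDr.
  have q b : (\sum_(i <- box) trig b k i / Num.sqrt (size box)%:R * y i) ^+ 2 =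
      ND^-1 * (\sum_(i <- box) trig b k i * y i) ^+ 2.
    rewrite (eq_bigr (fun i => (Num.sqrt (size box)%:R)^-1 * (trig b k i * y i))).
      by rewrite -mulr_sumr exprMn exprVn sqr_sqrtr// size_box_seq.
    by move=> i _; ring.
  by have := (q true, q false) => -[/= -> ->].
elim: {1 2 3}box => [|i s IH]; first by rewrite !big_nil.
rewrite !big_cons IH fourier_charE; apply/eqP; rewrite eq_complex /=.
by apply/andP; split; apply/eqP; rewrite /trig; ring.
Qed.

End GridTrigonometry.

(** * Periodograms of mixtures *)

Section Kappa.
Context {R : realType} {d : measure_display} {T : measurableType d}.
Variable P : probability T R.

Lemma cov2Z (x y : R) (X Y : T -> R) : L4 P X -> L4 P Y ->
  cov2 P (fun t => x * X t) (fun t => y * Y t) = x * y * cov2 P X Y.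
Proof.
move=> LX LY; rewrite /cov2 -(ErZ _ (L4_mul2 LX LY)); apply: eq_Er => t; ring.
Qed.

Lemma kappaZ (x : R) (X Y : T -> R) : L4 P X -> L4 P Y ->
  kappa P (fun t => x * X t) (fun t => x * Y t) = x ^+ 4 * kappa P X Y.
Proof.
move=> LX LY; rewrite /kappa !cov2Z//.
have -> : 'Er_P[fun t => x * X t * (x * X t) * (x * Y t) * (x * Y t)] =
    x ^+ 4 * 'Er_P[fun t => X t * X t * Y t * Y t].
  by rewrite -(ErZ _ (L4_mul4 LX LX LY LY)); apply: eq_Er => t; ring.
ring.
Qed.

End Kappa.

(** * Linear forms of one field over the box *)

Section BoxForm.
Context {R : realType} {dim : nat} {d : measure_display} {T : measurableType d}.
Variable P : probability T R.
Variables (N : nat) (N0 : (0 < N)%N) (dim0 : (0 < dim)%N).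
Local Notation site := 'rV[int]_dim.
Local Notation ND := ((N ^ dim)%:R : R).
Local Notation box := (@box_seq dim N).
Implicit Type c : site -> R.

Definition box_form (Z : site -> T -> R) c (t : T) : R :=
  \sum_(i <- box) c i / Num.sqrt (size box)%:R * Z i t.

Variables (Z : site -> T -> R) (K : R).
Hypothesis bZ : field_bounds P Z K.

Let K1 : 1 <= K := field_bound_ge1 bZ.
Let K0 : 0 <= K. Proof. exact: le_trans K1. Qed.
Let ND0 : 0 < ND. Proof. by rewrite ltr0n expn_gt0 N0. Qed.
Let NR1 : 1 <= N%:R :> R. Proof. by rewrite ler1n. Qed.
Let sqrtN1 : 1 <= Num.sqrt N%:R :> R.
Proof. by rewrite -[leLHS]sqrtr1 ler_wsqrtr. Qed.
Let sqrtN_sqr : Num.sqrt N%:R ^+ 2 = N%:R :> R.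
Proof. by rewrite sqr_sqrtr ?ler0n. Qed.
(** Positive dimension enters here. The cumulants, of order [N^(-dim)], are then within the rate,
    and the truncation level [sqrt N] is admissible since its square is at most the number of
    sites. *)
Let N_le_ND : N%:R <= ND.
Proof. by rewrite ler_nat; exact: (@leq_pexp2l N 1 dim N0 dim0). Qed.

Definition autocovariance (j : site) : R := cov2 P (Z 0) (Z j).
Local Notation rho := autocovariance.

Lemma box_formE c : box_form Z c =
  (fun t => (Num.sqrt ND)^-1 * \sum_(i <- box) c i * Z i t).
Proof.
apply/funext => t; rewrite mulr_sumr /box_form size_box_seq.
by apply: eq_bigr => i _; ring.
Qed.

Lemma L4_box_form c : L4 P (box_form Z c).
Proof. by apply: L4_sum => i _; apply: L4Z; exact: field_L4 bZ i. Qed.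

Lemma box_form_mean c : 'Er_P[box_form Z c] = 0.
Proof.
rewrite Er_sum => [|i _]; last first.
  by apply: integrableRZ; exact: L4_integrable (field_L4 bZ i).
by rewrite big1// => i _; rewrite ErZ ?(field_mean bZ) ?mulr0//;
  exact: L4_integrable (field_L4 bZ i).
Qed.

Lemma box_form_cov c c' : cov2 P (box_form Z c) (box_form Z c') =
  ND^-1 * \sum_(i <- box) \sum_(i' <- box) rho (i' - i) * (c i * c' i').
Proof.
rewrite !box_formE cov2Z; try by apply: L4_sum => i _; apply: L4Z; exact: field_L4 bZ i.
rewrite -invfM -expr2 sqr_sqrtr ?(ltW ND0)//; congr (_ * _).
have iZZ i i' : integrableR P (fun t => c i * c' i' * (Z i t * Z i' t)).
  by apply: integrableRZ; exact: L4_mul2 (field_L4 bZ i) (field_L4 bZ i').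
rewrite /cov2 (@eq_Er _ _ _ _ _ (fun t => \sum_(i <- box) \sum_(i' <- box)
    c i * c' i' * (Z i t * Z i' t))); last first.
  move=> t; rewrite mulr_suml; apply: eq_bigr => i _; rewrite mulr_sumr.
  by apply: eq_bigr => i' _; ring.
rewrite Er_sum => [|i _]; last by apply: integrableR_sum.
apply: eq_bigr => i _; rewrite Er_sum//; apply: eq_bigr => i' _.
rewrite (ErZ _ (L4_mul2 (field_L4 bZ i) (field_L4 bZ i'))) mulrC; congr (_ * _).
exact: field_cov bZ i i'.
Qed.

Lemma box_form_kappa c c' : (forall i, `|c i| <= 1) -> (forall i, `|c' i| <= 1) ->
  `|kappa P (box_form Z c) (box_form Z c')| <= K / Num.sqrt N%:R.
Proof.
move=> c1 c1'; rewrite !box_formE kappaZ; try by apply: L4_sum => i _; apply: L4Z;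
  exact: field_L4 bZ i.
have -> : (Num.sqrt ND)^-1 ^+ 4 = ND^-1 ^+ 2.
  by rewrite (exprM _ 2 2) exprVn sqr_sqrtr// ltW.
rewrite normrM ger0_norm ?sqr_ge0//.
apply: (@le_trans _ _ (ND^-1 ^+ 2 * (K * ND))).
  apply: ler_wpM2l; first exact: sqr_ge0.
  by have := field_kappa bZ (box_seq_uniq N) c1 c1'; rewrite size_box_seq.
rewrite [leLHS](_ : _ = K * ND^-1); last by field; rewrite gt_eqF.
apply: ler_wpM2l => //; rewrite lef_pV2 ?posrE//; last exact: lt_le_trans sqrtN1.
apply: le_trans N_le_ND; by rewrite -{2}sqrtN_sqr expr2 ler_peMl.
Qed.

Lemma autocovariance_weighted (A : {fset site}) :
  \sum_(j <- A) `|rho j| * (1 + Num.sqrt (norm1 j)) <= K.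
Proof. exact: (field_autocov bZ (fset_uniq A)). Qed.

Lemma autocovariance_summable (A : {fset site}) : \sum_(j <- A) `|rho j| <= K.
Proof.
apply: le_trans (autocovariance_weighted A); apply: ler_sum => j _.
by rewrite ler_peMr// lerDl sqrtr_ge0.
Qed.

Local Notation S k := (spectrum rho (grid_freq N k)).

Lemma box_form_cov_trig c b k : (forall i, `|c i| <= 1) ->
  `|cov2 P (box_form Z c) (box_form Z (trig N b k)) -
    S k * overlap N c (trig N b k)| <= 3 * K / Num.sqrt N%:R.
Proof.
move=> c1; rewrite box_form_cov; apply: trig_cov => //.
- exact: autocovariance_weighted.
- by move=> j; exact: field_cov_even bZ j.
Qed.

Lemma box_form_heavy c : (forall i, `|c i| <= 1) ->
  'Er_P[fun t => heavy (Num.sqrt N%:R) (box_form Z c t ^+ 4)] <= K / Num.sqrt N%:R.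
Proof.
move=> c1; apply: (field_heavy bZ (box_seq_uniq N) c1 sqrtN1).
by rewrite sqrtN_sqr size_box_seq.
Qed.

Lemma box_form_light c : (forall i, `|c i| <= 1) ->
  'Er_P[fun t => light (Num.sqrt N%:R) (box_form Z c t ^+ 4) ^+ 2] <= K.
Proof.
move=> c1; apply: (field_light bZ (box_seq_uniq N) c1 sqrtN1).
by rewrite sqrtN_sqr size_box_seq.
Qed.

End BoxForm.

(** * A calculus of bounded approximations *)

Section Approximation.
Context {R : realType}.
Variable q : R.

(** Magnitudes travel with the error, since the error of a product involves the size of its factors.
    The small quantity [q] stays outside, so composing the rules computes the constant [D] of a
    polynomial expression from its shape. *)
Definition approx (D B x y : R) : Prop :=
  [/\ `|x| <= B, `|y| <= B & `|x - y| <= D * q].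

Lemma approx_refl B x : `|x| <= B -> approx 0 B x x.
Proof. by move=> xB; split; rewrite ?subrr ?normr0 ?mul0r. Qed.

Lemma approxD D D' B B' x x' y y' : approx D B x y -> approx D' B' x' y' ->
  approx (D + D') (B + B') (x + x') (y + y').
Proof.
move=> [xB yB xy] [xB' yB' xy']; split.
- by rewrite (le_trans (ler_normD _ _))// lerD.
- by rewrite (le_trans (ler_normD _ _))// lerD.
- rewrite opprD addrACA mulrDl; exact: le_trans (ler_normD _ _) (lerD xy xy').
Qed.

Lemma approxN D B x y : approx D B x y -> approx D B (- x) (- y).
Proof. by move=> [xB yB xy]; split; rewrite ?normrN// -opprD normrN. Qed.

Lemma approxB D D' B B' x x' y y' : approx D B x y -> approx D' B' x' y' ->
  approx (D + D') (B + B') (x - x') (y - y').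
Proof. by move=> h h'; apply: approxD => //; exact: approxN. Qed.

Lemma approxM D D' B B' x x' y y' : approx D B x y -> approx D' B' x' y' ->
  approx (B * D' + B' * D) (B * B') (x * x') (y * y').
Proof.
move=> [xB yB xy] [xB' yB' xy']; split; rewrite ?normrM; try exact: ler_pM.
have -> : x * x' - y * y' = x * (x' - y') + (x - y) * y' by ring.
apply: (le_trans (ler_normD _ _)); rewrite !normrM mulrDl -!mulrA.
by apply: lerD; [exact: ler_pM|rewrite [leRHS]mulrC; exact: ler_pM].
Qed.

Lemma approx_sum (L : finType) D B (x y : L -> R) :
  (forall l, approx D B (x l) (y l)) ->
  approx (#|L|%:R * D) (#|L|%:R * B) (\sum_l x l) (\sum_l y l).
Proof.
move=> h; have cst (z : R) : #|L|%:R * z = \sum_(l : L) z.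
  by rewrite sumr_const mulr_natl.
split.
- by rewrite cst (le_trans (ler_norm_sum _ _ _))// ler_sum// => l _; case: (h l).
- by rewrite cst (le_trans (ler_norm_sum _ _ _))// ler_sum// => l _; case: (h l).
- rewrite -mulrA cst -sumrB (le_trans (ler_norm_sum _ _ _))// ler_sum// => l _.
  by case: (h l).
Qed.

End Approximation.

(** * Moments of the periodograms of one mixture *)

Section Sample.
Context {R : realType} {dim : nat} {d : measure_display} {T : measurableType d}.
Variables (P : probability T R) (I : choiceType) (G : I -> set_system T).
Hypothesis GI : forall i, setI_closed (G i).
Hypothesis GT : forall i, G i setT.
Hypothesis Gm : forall i, G i `<=` measurable.
Hypothesis indG : mutually_independent P G.
Local Notation jm := (join_measurable G).
Local Notation site := 'rV[int]_dim.
Variables (r : nat) (iz ia : 'I_r -> I).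
Hypothesis iz_inj : injective iz.
Hypothesis ia_inj : injective ia.
Hypothesis iza : forall l l', iz l != ia l'.
Variables (Z : 'I_r -> site -> T -> R) (a : 'I_r -> T -> R).
Hypothesis jmZ : forall l i, jm [set iz l] (Z l i).
Hypothesis jma : forall l, jm [set ia l] (a l).
Variables (K c : R).
Hypothesis bZ : forall l, field_bounds P (Z l) K.
Hypothesis ia8 : forall l, integrableR P (fun t => a l t ^+ 8).
Hypothesis c1 : 1 <= c.
Hypothesis Ea8 : forall l, 'Er_P[fun t => a l t ^+ 8] <= c.
(** The two independent sources behind [a_l Z_l]. Abstract injections [iz] and [ia] let the same
    results serve the original mixture, with sources indexed by [l], and each copy [s], with sources
    indexed by [(s, l)]. *)
Definition component_sites (l : 'I_r) : set I := [set iz l; ia l].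

Lemma component_sites_disjoint l l' : l != l' ->
  component_sites l `&` component_sites l' = set0.
Proof.
move=> ll'; rewrite -subset0 => x [/= [->|->] [e|e]].
- by move/eqP: ll'; apply; exact: iz_inj.
- by have := iza l l'; rewrite e eqxx.
- by have := iza l' l; rewrite e eqxx.
- by move/eqP: ll'; apply; exact: ia_inj.
Qed.

Let ia_iz l : [set ia l] `&` [set iz l] = set0.
Proof.
by rewrite -subset0 => x [/= -> e]; have := iza l l; rewrite e eqxx.
Qed.

Let ma l : measurable_fun setT (a l) := join_measurable_meas Gm (@jma l).

Lemma coef_pow_integrable l (n : nat) : (n <= 8)%N -> integrableR P (fun t => a l t ^+ n).
Proof.
move=> n8; apply: (@integrableR_le _ _ _ _ _ (fun t => 1 + a l t ^+ 8)).
- by apply: measurable_funX; exact: ma.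
- exact: integrableRD (integrableR_cst P 1) (ia8 l).
- move=> t; rewrite normrX.
  have -> : a l t ^+ 8 = `|a l t| ^+ 8 by rewrite -normrX ger0_norm// (exprM _ 4 2) sqr_ge0.
  have := normr_ge0 (a l t); move: `|a l t| => x x0.
  have [x1|x1] := leP x 1.
    by apply: (@le_trans _ _ 1); [exact: exprn_ile1|rewrite lerDl exprn_ge0].
  by apply: (@le_trans _ _ (x ^+ 8)); [rewrite ler_weXn2l// ltW|rewrite lerDr].
Qed.

Definition coef_moment (m : nat) l := 'Er_P[fun t => a l t ^+ m].
Local Notation m2 := (coef_moment 2).
Local Notation m4 := (coef_moment 4).

Let m2_ge0 l : 0 <= m2 l. Proof. by apply: Er_ge0 => t; exact: sqr_ge0. Qed.
Let m4_ge0 l : 0 <= m4 l.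
Proof. by apply: Er_ge0 => t; rewrite (exprM _ 2 2) sqr_ge0. Qed.

Let m2_le l : m2 l <= 2 * c.
Proof.
apply: (@le_trans _ _ 'Er_P[fun t => 1 + a l t ^+ 8]).
  apply: le_Er => [||t]; first exact: coef_pow_integrable.
    exact: integrableRD (integrableR_cst P 1) (ia8 l).
  rewrite (exprM _ 2 4); have := sqr_ge0 (a l t); move: (a l t ^+ 2) => x x0.
  have := (sqr_ge0 (x ^+ 2 - 1 / 2), sqr_ge0 (x - 1 / 2)); rewrite (exprM _ 2 2) => -[] *.
  by lra.
rewrite (ErD (integrableR_cst P 1) (ia8 l)) Er_cst.
by have := Ea8 l; have := c1; lra.
Qed.

Let m4_le l : m4 l <= 2 * c.
Proof.
apply: (@le_trans _ _ 'Er_P[fun t => 1 + a l t ^+ 8]).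
  apply: le_Er => [||t]; first exact: coef_pow_integrable.
    exact: integrableRD (integrableR_cst P 1) (ia8 l).
  rewrite (exprM _ 4 2); move: (a l t ^+ 4) => x.
  by have := sqr_ge0 (x - 1 / 2); nra.
rewrite (ErD (integrableR_cst P 1) (ia8 l)) Er_cst.
by have := Ea8 l; have := c1; lra.
Qed.

Section coefficient_times.
Variables (l : 'I_r) (A B : T -> R).
Hypotheses (jmA : jm [set iz l] A) (jmB : jm [set iz l] B).
Hypotheses (LA : L4 P A) (LB : L4 P B).

Lemma coef_mul_measurable : jm (component_sites l) (fun t => a l t * A t).
Proof.
apply: join_measurableM.
  by apply: sub_join_measurable (@jma l) => x /= ->; right.
by apply: sub_join_measurable jmA => x /= ->; left.
Qed.

Lemma coef_mul_L4 : L4 P (fun t => a l t * A t).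
Proof.
split; first exact: join_measurable_meas coef_mul_measurable.
apply: (@eq_integrableR _ _ _ _ (fun t => a l t ^+ 4 * A t ^+ 4)).
  by move=> t; rewrite exprMn.
have mp : measurable_fun setT (fun x : R => x ^+ 4) by exact: measurable_funX.
apply: (indep_integrableM GI GT Gm indG (ia_iz l)).
- exact: join_measurable_comp mp (@jma l).
- exact: join_measurable_comp mp jmA.
- exact: coef_pow_integrable.
- exact: LA.2.
Qed.

Lemma coef_mul_mean : 'Er_P[A] = 0 -> 'Er_P[fun t => a l t * A t] = 0.
Proof.
move=> A0; rewrite (indep_ErM GI GT Gm indG (ia_iz l) (@jma l) jmA).
- by rewrite A0 mulr0.
- exact: (@coef_pow_integrable l 1).
- exact: L4_integrable.
Qed.

Lemma coef_mul_cov :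
  cov2 P (fun t => a l t * A t) (fun t => a l t * B t) = m2 l * cov2 P A B.
Proof.
have mp : measurable_fun setT (fun x : R => x ^+ 2) by exact: measurable_funX.
rewrite /cov2 /coef_moment -(indep_ErM GI GT Gm indG (ia_iz l)
  (join_measurable_comp mp (@jma l)) (join_measurableM jmA jmB)).
- by apply: eq_Er => t; ring.
- exact: coef_pow_integrable.
- exact: L4_mul2.
Qed.

End coefficient_times.

Lemma coef_mixture_cov (A B : 'I_r -> T -> R) :
  (forall l, jm [set iz l] (A l)) -> (forall l, jm [set iz l] (B l)) ->
  (forall l, L4 P (A l)) -> (forall l, L4 P (B l)) ->
  (forall l, 'Er_P[A l] = 0) -> (forall l, 'Er_P[B l] = 0) ->
  cov2 P (fun t => \sum_l a l t * A l t) (fun t => \sum_l a l t * B l t) =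
  \sum_l m2 l * cov2 P (A l) (B l).
Proof.
move=> jmA jmB LA LB A0 B0.
rewrite (cov2_blocks GI GT Gm indG component_sites_disjoint
  (fun l => coef_mul_measurable (@jmA l)) (fun l => coef_mul_measurable (@jmB l))
  (fun l => coef_mul_L4 (@jmA l) (LA l)) (fun l => coef_mul_L4 (@jmB l) (LB l))
  (fun l => coef_mul_mean (@jmA l) (LA l) (A0 l))
  (fun l => coef_mul_mean (@jmB l) (LB l) (B0 l)) (index_enum_uniq _)).
by apply: eq_bigr => l _; exact: coef_mul_cov.
Qed.

Lemma mixture_power_spectrum xi : power_spectrum P (mixture a Z) xi =
  \sum_l m2 l * spectrum (autocovariance P (Z l)) xi.
Proof.
rewrite power_spectrumE.
rewrite -(spectrum_sum _ _ (fun l A => autocovariance_summable (bZ l) A)).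
congr (spectrum _ xi); apply/funext => j; rewrite /mixture.
apply: coef_mixture_cov => l; [exact: jmZ|exact: jmZ|..].
- exact: field_L4 (bZ l) 0.
- exact: field_L4 (bZ l) j.
- exact: field_mean (bZ l) 0.
- exact: field_mean (bZ l) j.
Qed.

Lemma frozen_power_spectrum (alpha : 'I_r -> R) xi :
  cond_power_spectrum P Z alpha xi =
  \sum_l alpha l ^+ 2 * spectrum (autocovariance P (Z l)) xi.
Proof.
rewrite /cond_power_spectrum power_spectrumE.
rewrite -(spectrum_sum _ _ (fun l A => autocovariance_summable (bZ l) A)).
congr (spectrum _ xi); apply/funext => j; rewrite /mixture.
have disj (l l' : 'I_r) : l != l' -> [set iz l] `&` [set iz l'] = set0.
  move=> ll'; rewrite -subset0 => x [/= -> e].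
  by move/eqP: ll'; apply; exact: iz_inj.
have jmc i l : jm [set iz l] (fun t => alpha l * Z l i t).
  by apply: join_measurableM (@jmZ l i); exact: join_measurable_cst.
have Lc i l : L4 P (fun t => alpha l * Z l i t) by exact: (L4Z (alpha l) (field_L4 (bZ l) i)).
have c_mean i l : 'Er_P[fun t => alpha l * Z l i t] = 0.
  by rewrite (ErZ _ (L4_integrable (field_L4 (bZ l) i))) (field_mean (bZ l)) mulr0.
rewrite (cov2_blocks GI GT Gm indG disj (jmc 0) (jmc j) (Lc 0) (Lc j) (c_mean 0)
  (c_mean j) (index_enum_uniq _)).
apply: eq_bigr => l _.
by rewrite (cov2Z _ _ (field_L4 (bZ l) 0) (field_L4 (bZ l) j)) expr2.
Qed.

(** The variance of [a_l^2] is [m4 l - m2 l ^+ 2], and distinct coefficients do not correlate. With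
    spectra for [x] and [y] this is the covariance of the theorem, in the form in which cumulants
    produce it. *)
Lemma coef_square_covariance (x y : 'I_r -> R) :
  covariance P (fun t => \sum_l a l t ^+ 2 * x l) (fun t => \sum_l a l t ^+ 2 * y l) =
  (\sum_l (m4 l - m2 l ^+ 2) * (x l * y l))%:E.
Proof.
pose b (z : 'I_r -> R) l t := z l * (a l t ^+ 2 - m2 l).
have ia2 l : integrableR P (fun t => a l t ^+ 2) by exact: coef_pow_integrable.
have disj (l l' : 'I_r) : l != l' -> [set ia l] `&` [set ia l'] = set0.
  move=> ll'; rewrite -subset0 => z [/= -> e].
  by move/eqP: ll'; apply; exact: ia_inj.
have jmb z l : jm [set ia l] (b z l).
  apply: join_measurableM; first exact: join_measurable_cst.
  apply: join_measurableD; last exact: join_measurable_cst.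
  have mp : measurable_fun setT (fun x : R => x ^+ 2) by exact: measurable_funX.
  exact: join_measurable_comp mp (@jma l).
have L2 l : L4 P (fun t => a l t ^+ 2 - m2 l).
  apply: L4D (L4_cst P (- m2 l)); split; first by apply: measurable_funX; exact: ma.
  by apply: eq_integrableR (ia8 l) => t; rewrite -exprM.
have Lb z l : L4 P (b z l) by exact: (L4Z (z l) (L2 l)).
have b_mean z l : 'Er_P[b z l] = 0.
  rewrite (ErZ _ (L4_integrable (L2 l))) (ErB (ia2 l) (integrableR_cst P (m2 l))).
  by rewrite Er_cst subrr mulr0.
have cov_b l : cov2 P (b x l) (b y l) = (m4 l - m2 l ^+ 2) * (x l * y l).
  rewrite (cov2Z _ _ (L2 l) (L2 l)) mulrC; congr (_ * _).
  rewrite /cov2 (@eq_Er _ _ _ _ _ (fun t => a l t ^+ 4 +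
    ((- 2 * m2 l) * a l t ^+ 2 + m2 l ^+ 2))); last by move=> t; ring.
  have i1 := integrableRZ (- 2 * m2 l) (ia2 l).
  have i2 := integrableR_cst P (m2 l ^+ 2).
  rewrite (ErD (coef_pow_integrable l (isT : (4 <= 8)%N)) (integrableRD i1 i2)) (ErD i1 i2).
  by rewrite (ErZ _ (ia2 l)) Er_cst /coef_moment; ring.
have centred (z : 'I_r -> R) t : \sum_l a l t ^+ 2 * z l -
    fine ('E_P[(fun t => \sum_l a l t ^+ 2 * z l)%R])%E = \sum_l b z l t.
  have i_az l : integrableR P (fun t => a l t ^+ 2 * z l).
    by apply: eq_integrableR (integrableRZ (z l) (ia2 l)) => u; rewrite mulrC.
  have iS : integrableR P (fun t => \sum_l a l t ^+ 2 * z l) by exact: integrableR_sum.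
  rewrite (integrableR_fin iS) /=.
  rewrite Er_sum// -sumrB; apply: eq_bigr => l _.
  have -> : 'Er_P[fun t => a l t ^+ 2 * z l] = z l * m2 l.
    by rewrite -(ErZ _ (ia2 l)); apply: eq_Er => u; rewrite mulrC.
  by rewrite /b; ring.
rewrite unlock.
rewrite (_ : (_ * _)%R = fun t => (\sum_l b x l t) * (\sum_l b y l t)); last first.
  by apply/funext => t /=; rewrite -!centred.
rewrite integrableR_fin; last by apply: L4_mul2; exact: L4_sum.
congr EFin; rewrite -[LHS]/(cov2 P _ _).
rewrite (cov2_blocks GI GT Gm indG disj (jmb x) (jmb y) (Lb x) (Lb y) (b_mean x)
  (b_mean y) (index_enum_uniq _)).
by apply: eq_bigr => l _; exact: cov_b.
Qed.

Variables (N : nat) (N0 : (0 < N)%N) (dim0 : (0 < dim)%N).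
Local Notation box := (@box_seq dim N).
Implicit Types f g : site -> R.

Local Notation trig := (@trig R dim N).
Local Notation overlap := (@overlap R dim N).

Definition mixture_form f (t : T) : R := \sum_l a l t * box_form N (Z l) f t.

Local Notation u l f := (fun t => a l t * box_form N (Z l) f t).

Let jmA l f : jm [set iz l] (box_form N (Z l) f).
Proof.
apply: join_measurable_sum => i; apply: join_measurableM; last exact: jmZ.
exact: join_measurable_cst.
Qed.

Let LA l f : L4 P (box_form N (Z l) f). Proof. exact: L4_box_form (bZ l) f. Qed.

Let L4u l f : L4 P (u l f). Proof. exact: coef_mul_L4 (@jmA l f) (LA l f). Qed.

Let Eu l f : 'Er_P[u l f] = 0.
Proof. exact: coef_mul_mean (@jmA l f) (LA l f) (box_form_mean N (bZ l) f). Qed.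

Local Notation w l f g := (cov2 P (box_form N (Z l) f) (box_form N (Z l) g)).

Let cov_u l f g : cov2 P (u l f) (u l g) = m2 l * w l f g.
Proof. exact: coef_mul_cov (@jmA l f) (@jmA l g) (LA l f) (LA l g). Qed.

(** The fourth moment of the box forms, their cumulant plus three pairings, picks up [m4], while the
    pairings subtracted in the cumulant pick up [m2^2]. Even when the cumulant of the field is
    negligible, [m4 - m2^2] times the pairings remains. *)
Let kappa_u l f g : kappa P (u l f) (u l g) =
  m4 l * (kappa P (box_form N (Z l) f) (box_form N (Z l) g) +
          (w l f f * w l g g + 2 * w l f g ^+ 2)) -
  m2 l ^+ 2 * (w l f f * w l g g + 2 * w l f g ^+ 2).
Proof.
have mp : measurable_fun setT (fun x : R => x ^+ 4) by exact: measurable_funX.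
set A := box_form N (Z l) f; set B := box_form N (Z l) g.
have jmAB : jm [set iz l] (fun t => A t * A t * B t * B t).
  have [jA jB] := (@jmA l f, @jmA l g).
  exact: join_measurableM (join_measurableM (join_measurableM jA jA) jB) jB.
rewrite /kappa !cov_u /coef_moment.
have -> : 'Er_P[fun t => a l t * A t * (a l t * A t) * (a l t * B t) * (a l t * B t)] =
    'Er_P[fun t => a l t ^+ 4] * 'Er_P[fun t => A t * A t * B t * B t].
  rewrite -(indep_ErM GI GT Gm indG (ia_iz l) (join_measurable_comp mp (@jma l)) jmAB).
  - by apply: eq_Er => t; ring.
  - exact: coef_pow_integrable.
  - exact: L4_mul4 (LA l f) (LA l f) (LA l g) (LA l g).
by ring.
Qed.

Local Notation X := mixture_form.

Let L4X f : L4 P (X f). Proof. by apply: L4_sum => l _; exact: L4u. Qed.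

Let cov_X f g : cov2 P (X f) (X g) = \sum_l m2 l * w l f g.
Proof.
exact: coef_mixture_cov (fun l => @jmA l f) (fun l => @jmA l g) (fun l => LA l f)
  (fun l => LA l g) (fun l => box_form_mean N (bZ l) f) (fun l => box_form_mean N (bZ l) g).
Qed.

Let kappa_X f g : kappa P (X f) (X g) = \sum_l kappa P (u l f) (u l g).
Proof.
exact: (kappa_blocks GI GT Gm indG component_sites_disjoint
  (fun l => coef_mul_measurable (@jmA l f)) (fun l => coef_mul_measurable (@jmA l g))
  (fun l => L4u l f) (fun l => L4u l g) (fun l => Eu l f) (fun l => Eu l g)
  (index_enum_uniq _)).
Qed.

Lemma mixture_form_measurable f : jm (\bigcup_l component_sites l) (X f).
Proof.
have := join_measurable_blocks (fun l => coef_mul_measurable (@jmA l f)) (s := index_enum _).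
by apply: sub_join_measurable => x [l _ h]; exists l.
Qed.

Lemma periodogram_mixture k t :
  periodogram N (fun i => mixture a Z i t) k = \sum_b X (trig b k) t ^+ 2.
Proof.
rewrite periodogramE; apply: eq_bigr => b _; congr (_ ^+ 2).
rewrite /X /box_form; under eq_bigr do rewrite /mixture mulr_sumr.
rewrite exchange_big; apply: eq_bigr => l _; rewrite mulr_sumr.
by apply: eq_bigr => i _; ring.
Qed.

Local Notation S l k := (spectrum (autocovariance P (Z l)) (grid_freq N k)).
Local Notation q := (Num.sqrt (N%:R : R))^-1.
Local Notation Ph k := (fun t => periodogram N (fun i => mixture a Z i t) k).

Let sqrtN1 : 1 <= Num.sqrt N%:R :> R.
Proof. by rewrite -[leLHS]sqrtr1 ler_wsqrtr// ler1n. Qed.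
Let q1 : q <= 1. Proof. by rewrite invf_le1 ?(lt_le_trans _ sqrtN1). Qed.

Let S_le l k : `|S l k| <= K.
Proof. by apply: spectrum_le => A; exact: autocovariance_summable (bZ l) A. Qed.

Let K1 (l : 'I_r) : 1 <= K := field_bound_ge1 (bZ l).

Let w_approx l b1 k1 b2 k2 : approx q (3 * K) (4 * K)
  (w l (trig b1 k1) (trig b2 k2)) (S l k2 * overlap (trig b1 k1) (trig b2 k2)).
Proof.
have e := box_form_cov_trig N0 (bZ l) b2 k2 (trig_le N b1 k1).
have B : `|S l k2 * overlap (trig b1 k1) (trig b2 k2)| <= K.
  rewrite normrM -[leRHS]mulr1; apply: ler_pM => //.
  by apply: overlap_le => // i; exact: trig_le.
have K1' := K1 l; split=> //; last by lra.
have Kq : 3 * K * q <= 3 * K by rewrite ler_piMr// mulr_ge0//; lra.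
move: e B Kq; move: (S l k2 * _) => y; move: (w l _ _) => x e B Kq.
have -> : x = (x - y) + y by ring.
by apply: (le_trans (ler_normD _ _)); lra.
Qed.

Let kappa_approx l b1 k1 b2 k2 : approx q K K
  (kappa P (box_form N (Z l) (trig b1 k1)) (box_form N (Z l) (trig b2 k2))) 0.
Proof.
have e := box_form_kappa N0 dim0 (bZ l) (trig_le N b1 k1) (trig_le N b2 k2).
have K1' := K1 l.
split; rewrite ?normr0 ?subr0//; last by lra.
by apply: (le_trans e); rewrite ler_piMr//; lra.
Qed.

Let c0 : 0 <= c. Proof. exact: le_trans c1. Qed.

Let m2_approx l : approx q 0 (2 * c) (m2 l) (m2 l).
Proof. by apply: approx_refl; rewrite ger0_norm. Qed.

Let m4_approx l : approx q 0 (2 * c) (m4 l) (m4 l).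
Proof. by apply: approx_refl; rewrite ger0_norm. Qed.

(** The constants are left as [approxM] and [approx_sum] return them, vanishing term included, so
    that further composition needs no rewriting. *)
Let cov_X_approx b1 k1 b2 k2 : approx q (r%:R * (2 * c * (3 * K) + 4 * K * 0))
  (r%:R * (2 * c * (4 * K))) (cov2 P (X (trig b1 k1)) (X (trig b2 k2)))
  (\sum_l m2 l * (S l k2 * overlap (trig b1 k1) (trig b2 k2))).
Proof.
rewrite cov_X -{1 2}(card_ord r); apply: approx_sum => l.
exact: approxM (m2_approx l) (w_approx l b1 k1 b2 k2).
Qed.

Definition limit_mean k : R := \sum_l m2 l * S l k.

Let iPh b k : integrableR P (fun t => X (trig b k) t ^+ 2).
Proof. exact: L4_mul2. Qed.

(** Cosine and sine at one frequency have self-overlaps adding up to [1]. The constant is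
    [2 * r * (2 c) * (3 K)]: two phases, [r] components, the bound on [m2] and the error of one
    covariance. *)
Lemma periodogram_mean k :
  `|'Er_P[Ph k] - limit_mean k| <= 12 * r%:R * c * K * q.
Proof.
rewrite (eq_Er _ (periodogram_mixture k)) Er_sum => [|b _]; last exact: iPh.
have h b := cov_X_approx b k b k.
have [_ _] := approx_sum h; rewrite card_bool.
rewrite [X in _ - X](_ : _ = limit_mean k); last first.
  rewrite exchange_big; apply: eq_bigr => l _; rewrite big_bool /=.
  rewrite -mulrDr -mulrDr [_ + _](addrC (overlap _ _)).
  by rewrite overlap_self// mulr1.
move=> e; apply: (le_trans _ (le_trans e _)); last by lra.
by rewrite le_eqVlt; apply/orP; left; apply/eqP; congr (`|_ - _|).
Qed.

Lemma limit_mean_le k : `|limit_mean k| <= 2 * r%:R * c * K.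
Proof.
apply: (le_trans (ler_norm_sum _ _ _)).
apply: (@le_trans _ _ (\sum_(l < r) 2 * c * K)).
  apply: ler_sum => l _; rewrite normrM; apply: ler_pM => //.
  by rewrite ger0_norm.
by rewrite sumr_const card_ord -mulr_natl; lra.
Qed.

(** Squares are spelled as products and doubled by addition, so that the expression matches term by
    term what [approxM], [approxD] and [approxB] build. *)
Let moment22 f g : 'Er_P[fun t => X f t ^+ 2 * X g t ^+ 2] =
  \sum_l (m4 l * (kappa P (box_form N (Z l) f) (box_form N (Z l) g) +
          (w l f f * w l g g + (w l f g * w l f g + w l f g * w l f g))) -
  m2 l * m2 l * (w l f f * w l g g + (w l f g * w l f g + w l f g * w l f g))) +
  (cov2 P (X f) (X f) * cov2 P (X g) (X g) +
   (cov2 P (X f) (X g) * cov2 P (X f) (X g) +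
    cov2 P (X f) (X g) * cov2 P (X f) (X g))).
Proof.
have -> : 'Er_P[fun t => X f t ^+ 2 * X g t ^+ 2] = kappa P (X f) (X g) +
    cov2 P (X f) (X f) * cov2 P (X g) (X g) + 2 * cov2 P (X f) (X g) ^+ 2.
  rewrite /kappa (@eq_Er _ _ _ _ _ (fun t => X f t * X f t * X g t * X g t)).
    by ring.
  by move=> t; ring.
rewrite kappa_X -addrA; congr (_ + _); last by ring.
by apply: eq_bigr => l _; rewrite kappa_u; ring.
Qed.

Let iPhPh k1 k2 : integrableR P (fun t => Ph k1 t * Ph k2 t).
Proof.
apply: (@eq_integrableR _ _ _ _ (fun t => \sum_b1 \sum_b2
    X (trig b1 k1) t * X (trig b1 k1) t * X (trig b2 k2) t * X (trig b2 k2) t)).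
  move=> t; rewrite !periodogram_mixture mulr_suml; apply: eq_bigr => b1 _.
  by rewrite mulr_sumr; apply: eq_bigr => b2 _; ring.
by apply: integrableR_sum => b1 _; apply: integrableR_sum => b2 _; exact: L4_mul4.
Qed.

Definition limit_variance k1 k2 : R := \sum_l (m4 l - m2 l ^+ 2) * (S l k1 * S l k2).

(** With covariances replaced by spectra times overlaps, each pair of phases contributes a limit
    times a product of self-overlaps, and these products sum to [1], plus a limit times twice a
    squared mixed overlap, and these sum to [deltaN]. The variance of the coefficients multiplies
    the same pairings as the means, so both acquire the factor [1 + deltaN]. *)
Lemma periodogram_product_mean (M : set site) k1 k2 :
  half_box N M -> M k1 -> M k2 ->
  `|'Er_P[fun t => Ph k1 t * Ph k2 t] - (1 + deltaN N k1 k2) *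
      (limit_mean k1 * limit_mean k2 + limit_variance k1 k2)| <=
  4 * (r%:R * (2 * c * (K + 72 * K ^+ 2) + 288 * c ^+ 2 * K ^+ 2) +
       288 * r%:R ^+ 2 * c ^+ 2 * K ^+ 2) * q.
Proof.
move=> hM M1 M2.
rewrite (@eq_Er _ _ _ _ _ (fun t => \sum_b1 \sum_b2
    X (trig b1 k1) t ^+ 2 * X (trig b2 k2) t ^+ 2)); last first.
  move=> t; rewrite !periodogram_mixture mulr_suml; apply: eq_bigr => b1 _.
  by rewrite mulr_sumr.
have i4 b1 b2 : integrableR P (fun t => X (trig b1 k1) t ^+ 2 * X (trig b2 k2) t ^+ 2).
  apply: (@eq_integrableR _ _ _ _ (fun t =>
    X (trig b1 k1) t * X (trig b1 k1) t * X (trig b2 k2) t * X (trig b2 k2) t)).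
    by move=> t; ring.
  exact: L4_mul4.
rewrite Er_sum => [|b1 _]; last exact: integrableR_sum.
rewrite (eq_bigr (fun b1 => \sum_b2
  'Er_P[fun t => X (trig b1 k1) t ^+ 2 * X (trig b2 k2) t ^+ 2])); last first.
  by move=> b1 _; rewrite Er_sum.
under eq_bigr do under eq_bigr do rewrite moment22.
(* [Q], [U] and [V] follow [moment22]: the pairings of one component, its contribution with weights
   [m4] and [m2^2], and the pairings of the whole mixture. The error constant is read off their
   types. *)
pose Q (l : 'I_r) (b1 b2 : bool) := approxD (approxM (w_approx l b1 k1 b1 k1) (w_approx l b2 k2
  b2 k2))
  (approxD (approxM (w_approx l b1 k1 b2 k2) (w_approx l b1 k1 b2 k2))
           (approxM (w_approx l b1 k1 b2 k2) (w_approx l b1 k1 b2 k2))).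
pose U (l : 'I_r) (b1 b2 : bool) := approxB
  (approxM (m4_approx l) (approxD (kappa_approx l b1 k1 b2 k2) (Q l b1 b2)))
  (approxM (approxM (m2_approx l) (m2_approx l)) (Q l b1 b2)).
pose V (b1 b2 : bool) := approxD (approxM (cov_X_approx b1 k1 b1 k1) (cov_X_approx b2 k2 b2 k2))
  (approxD (approxM (cov_X_approx b1 k1 b2 k2) (cov_X_approx b1 k1 b2 k2))
           (approxM (cov_X_approx b1 k1 b2 k2) (cov_X_approx b1 k1 b2 k2))).
have [_ _] := approx_sum (fun b1 => approx_sum (fun b2 =>
  approxD (approx_sum (fun l => U l b1 b2)) (V b1 b2))).
rewrite card_bool card_ord.
set lim := (X in _ - X).
suff -> : lim = (1 + deltaN N k1 k2) *
    (limit_mean k1 * limit_mean k2 + limit_variance k1 k2).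
  by move=> e; apply: (le_trans e); rewrite le_eqVlt; apply/orP; left; apply/eqP; ring.
rewrite /lim {lim}.
pose lim12 := limit_mean k1 * limit_mean k2 + limit_variance k1 k2.
(* [w_approx] returns the spectrum at its second frequency, so mixed terms carry [k2] twice. Their
   overlaps sum to [deltaN], which vanishes unless [k1 = k2], and then [lim22] is [lim12]. *)
pose lim22 := limit_mean k2 * limit_mean k2 + limit_variance k2 k2.
transitivity (\sum_b1 \sum_b2
    (lim12 * (overlap (trig b1 k1) (trig b1 k1) * overlap (trig b2 k2) (trig b2 k2)) +
     lim22 * (2 * overlap (trig b1 k1) (trig b2 k2) ^+ 2))).
  apply: eq_bigr => b1 _; apply: eq_bigr => b2 _.
  have lm k o : \sum_l m2 l * (S l k * o) = limit_mean k * o.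
    by rewrite /limit_mean mulr_suml; apply: eq_bigr => l _; ring.
  rewrite !lm; set o11 := overlap (trig b1 k1) (trig b1 k1).
  set o22 := overlap (trig b2 k2) (trig b2 k2); set o12 := overlap _ _.
  have -> : lim12 * (o11 * o22) + lim22 * (2 * o12 ^+ 2) =
      (limit_variance k1 k2 * (o11 * o22) + limit_variance k2 k2 * (2 * o12 ^+ 2)) +
      (limit_mean k1 * o11 * (limit_mean k2 * o22) +
       (limit_mean k2 * o12 * (limit_mean k2 * o12) +
        limit_mean k2 * o12 * (limit_mean k2 * o12))).
    by rewrite /lim12 /lim22; ring.
  congr (_ + _); rewrite /limit_variance !mulr_suml -big_split.
  by apply: eq_bigr => l _ /=; ring.
have split_sum b1 : \sum_b2
    (lim12 * (overlap (trig b1 k1) (trig b1 k1) * overlap (trig b2 k2) (trig b2 k2)) +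
     lim22 * (2 * overlap (trig b1 k1) (trig b2 k2) ^+ 2)) =
  lim12 * overlap (trig b1 k1) (trig b1 k1) +
  lim22 * (2 * \sum_b2 overlap (trig b1 k1) (trig b2 k2) ^+ 2).
  rewrite !big_bool /=.
  have := @overlap_self R dim N N0 k2; set x := overlap (trig false k2) _.
  set y := overlap (trig true k2) (trig true k2) => xy.
  have -> : lim12 * overlap (trig b1 k1) (trig b1 k1) =
    lim12 * overlap (trig b1 k1) (trig b1 k1) * (x + y) by rewrite xy mulr1.
  by ring.
rewrite (eq_bigr _ (fun b1 _ => split_sum b1)) big_split /=.
rewrite [X in X + _ = _](_ : _ = lim12); last first.
  rewrite big_bool /= -mulrDr [X in _ * X]addrC.
  by rewrite (@overlap_self R dim N N0 k1) mulr1.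
rewrite [X in _ + X = _](_ : _ = lim22 * deltaN N k1 k2); last first.
  by rewrite -mulr_sumr -mulr_sumr (overlap_sqr_sum N0 hM M1 M2).
rewrite /deltaN; have [e|_] := eqVneq k1 k2; last by rewrite /lim12; ring.
by rewrite /lim22 /lim12 e; ring.
Qed.

(** A phase, a choice between [k1] ([true]) and [k2], and a component: the [4 r] linear forms that
    enter a product of two periodograms. *)
Local Notation cell := (bool * bool * 'I_r)%type.

Let form_of k1 k2 (x : cell) : T -> R :=
  box_form N (Z x.2) (trig x.1.1 (if x.1.2 then k1 else k2)).

(** Only the fourth power of the field form is truncated, not the coefficient, so that independence
    still factors the expectation. The factor [r^3] comes from [power4_weighted] with unit
    weights. *)
Definition heavy_part k1 k2 t : R := r%:R ^+ 3 *
  \sum_(x : cell) a x.2 t ^+ 4 * heavy (Num.sqrt N%:R) (form_of k1 k2 x t ^+ 4).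

Definition light_part k1 k2 t : R := r%:R ^+ 3 *
  \sum_(x : cell) a x.2 t ^+ 4 * light (Num.sqrt N%:R) (form_of k1 k2 x t ^+ 4).

Let pow4_ge0 (x : R) : 0 <= x ^+ 4. Proof. by rewrite (exprM _ 2 2) sqr_ge0. Qed.

Lemma heavy_part_ge0 k1 k2 t : 0 <= heavy_part k1 k2 t.
Proof.
by rewrite mulr_ge0 ?exprn_ge0// sumr_ge0// => x _; rewrite mulr_ge0// heavy_ge0.
Qed.

Lemma light_part_ge0 k1 k2 t : 0 <= light_part k1 k2 t.
Proof.
rewrite mulr_ge0 ?exprn_ge0// sumr_ge0// => x _; rewrite mulr_ge0// light_ge0//.
Qed.

(** A product of two sums of two squares is at most the sum of the four fourth powers; each of these
    is spread over the components and then split into its light and heavy parts. *)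
Lemma periodogram_product_le k1 k2 t :
  Ph k1 t * Ph k2 t <= heavy_part k1 k2 t + light_part k1 k2 t.
Proof.
have X4 f : X f t ^+ 4 <= r%:R ^+ 3 * \sum_l a l t ^+ 4 * box_form N (Z l) f t ^+ 4.
  have := power4_weighted (index_enum 'I_r) (fun=> 1) (fun l => a l t * box_form N (Z l) f t).
  rewrite normr1 sumr_const card_ord.
  under eq_bigr do rewrite mul1r.
  by under [X in _ * X]eq_bigr do rewrite mul1r exprMn.
rewrite !periodogram_mixture.
apply: (@le_trans _ _ (\sum_(p : bool * bool)
    X (trig p.1 (if p.2 then k1 else k2)) t ^+ 4)).
  rewrite -(pair_bigA _ (fun b e => X (trig b (if e then k1 else k2)) t ^+ 4)) /=.
  rewrite !big_bool /=.
  move: (X _ t) (X _ t) (X _ t) (X _ t) => x1 x2 x3 x4.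
  have := (sqr_ge0 (x1 ^+ 2 - x3 ^+ 2), sqr_ge0 (x1 ^+ 2 - x4 ^+ 2)) => -[] *.
  have := (sqr_ge0 (x2 ^+ 2 - x3 ^+ 2), sqr_ge0 (x2 ^+ 2 - x4 ^+ 2)) => -[] *.
  have := (sqr_ge0 (x1 ^+ 2 - x2 ^+ 2), sqr_ge0 (x3 ^+ 2 - x4 ^+ 2)) => -[] *.
  lra.
rewrite /heavy_part /light_part -mulrDr -big_split /=.
rewrite -(pair_bigA _ (fun (p : bool * bool) l =>
  a l t ^+ 4 * heavy (Num.sqrt N%:R) (form_of k1 k2 (p, l) t ^+ 4) +
  a l t ^+ 4 * light (Num.sqrt N%:R) (form_of k1 k2 (p, l) t ^+ 4))) /=.
rewrite mulr_sumr; apply: ler_sum => p _; apply: (le_trans (X4 _)).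
rewrite le_eqVlt; apply/orP; left; apply/eqP; congr (_ * _).
by apply: eq_bigr => l _; rewrite -mulrDr [heavy _ _ + _]addrC light_heavy.
Qed.

Let jmF k1 k2 x : jm [set iz x.2] (form_of k1 k2 x).
Proof. exact: jmA. Qed.

Let mpow n : measurable_fun setT (fun x : R => x ^+ n).
Proof. exact: measurable_funX. Qed.

Let jm_heavy k1 k2 x : jm [set iz x.2]
  (fun t => heavy (Num.sqrt N%:R) (form_of k1 k2 x t ^+ 4)).
Proof.
exact: join_measurable_comp (measurable_heavy _)
  (join_measurable_comp (mpow 4) (@jmF k1 k2 x)).
Qed.

Let jm_light2 k1 k2 x : jm [set iz x.2]
  (fun t => light (Num.sqrt N%:R) (form_of k1 k2 x t ^+ 4) ^+ 2).
Proof.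
exact: join_measurable_comp (mpow 2) (join_measurable_comp (measurable_light _)
  (join_measurable_comp (mpow 4) (@jmF k1 k2 x))).
Qed.

Let i_heavy k1 k2 x : integrableR P
  (fun t => heavy (Num.sqrt N%:R) (form_of k1 k2 x t ^+ 4)).
Proof.
apply: integrableR_le (LA x.2 (trig x.1.1 (if x.1.2 then k1 else k2))).2 _.
  exact: join_measurable_meas (@jm_heavy k1 k2 x).
move=> t; rewrite ger0_norm ?heavy_ge0// /heavy ge_max pow4_ge0 andbT.
by rewrite lerBlDr lerDl sqrtr_ge0.
Qed.

Let i_light2 k1 k2 x : integrableR P
  (fun t => light (Num.sqrt N%:R) (form_of k1 k2 x t ^+ 4) ^+ 2).
Proof.
apply: (@integrableR_bounded _ _ _ _ _ (Num.sqrt N%:R ^+ 2)).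
  exact: join_measurable_meas (@jm_light2 k1 k2 x).
move=> t; rewrite ger0_norm ?sqr_ge0//; apply: lerXn2r; rewrite ?nnegrE ?light_le//.
by rewrite light_ge0 ?sqrtr_ge0.
Qed.

Let jma_pow l n : jm [set ia l] (fun t => a l t ^+ n).
Proof. exact: join_measurable_comp (mpow n) (@jma l). Qed.

Let i_heavy_term k1 k2 (x : cell) : integrableR P
  (fun t => a x.2 t ^+ 4 * heavy (Num.sqrt N%:R) (form_of k1 k2 x t ^+ 4)).
Proof.
by apply: (indep_integrableM GI GT Gm indG (ia_iz x.2) (@jma_pow x.2 4)
  (@jm_heavy k1 k2 x)) => //; exact: coef_pow_integrable.
Qed.

Let card_cell : #|{: cell}|%:R = 4 * r%:R :> R.
Proof. by rewrite !card_prod card_bool card_ord natrM. Qed.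

Lemma heavy_part_integrable k1 k2 : integrableR P (heavy_part k1 k2).
Proof. by apply: integrableRZ; apply: integrableR_sum. Qed.

Lemma heavy_part_mean k1 k2 :
  'Er_P[heavy_part k1 k2] <= 8 * r%:R ^+ 4 * c * K * q.
Proof.
rewrite ErZ; last exact: integrableR_sum.
rewrite Er_sum//.
apply: (@le_trans _ _ (r%:R ^+ 3 * \sum_(x : cell) 2 * c * (K * q))); last first.
  by rewrite sumr_const -[X in _ * X <= _]mulr_natl card_cell; lra.
rewrite ler_wpM2l ?exprn_ge0//; apply: ler_sum => x _.
rewrite (indep_ErM GI GT Gm indG (ia_iz x.2) (@jma_pow x.2 4) (@jm_heavy k1 k2 x)) //;
  last exact: coef_pow_integrable.
apply: ler_pM; rewrite ?m4_ge0 ?m4_le//.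
- by apply: Er_ge0 => t; exact: heavy_ge0.
- by apply: (box_form_heavy N0 dim0 (bZ x.2)) => i; exact: trig_le.
Qed.

(** Cauchy-Schwarz over the [4 r] cells, times the square of [r^3]; the coefficients are raised to
    the eighth power. *)
Let light_part_sqr_le k1 k2 t : light_part k1 k2 t ^+ 2 <= 4 * r%:R ^+ 7 *
  \sum_(x : cell) a x.2 t ^+ 8 * light (Num.sqrt N%:R) (form_of k1 k2 x t ^+ 4) ^+ 2.
Proof.
have := cauchy_weighted (index_enum {: cell}) (fun x => a x.2 t ^+ 4 *
  light (Num.sqrt N%:R) (form_of k1 k2 x t ^+ 4)) (p := fun=> 1) (fun _ => ler01).
under eq_bigr do rewrite mul1r.
under [X in _ <= _ * X]eq_bigr do rewrite mul1r exprMn -exprM.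
rewrite sumr_const card_cell => h; rewrite /light_part exprMn.
apply: (le_trans (ler_wpM2l (sqr_ge0 _) h)).
by rewrite le_eqVlt; apply/orP; left; apply/eqP; ring.
Qed.

Let i_light_term k1 k2 (x : cell) : integrableR P
  (fun t => a x.2 t ^+ 8 * light (Num.sqrt N%:R) (form_of k1 k2 x t ^+ 4) ^+ 2).
Proof.
by apply: (indep_integrableM GI GT Gm indG (ia_iz x.2) (@jma_pow x.2 8)
  (@jm_light2 k1 k2 x)).
Qed.

Let i_light_bound k1 k2 : integrableR P (fun t => 4 * r%:R ^+ 7 *
  \sum_(x : cell) a x.2 t ^+ 8 * light (Num.sqrt N%:R) (form_of k1 k2 x t ^+ 4) ^+ 2).
Proof. by apply: integrableRZ; exact: integrableR_sum. Qed.

Lemma light_part_sqr_integrable k1 k2 :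
  integrableR P (fun t => light_part k1 k2 t ^+ 2).
Proof.
apply: integrableR_le (i_light_bound k1 k2) _.
  apply: measurable_funX; apply: measurable_funM => //; apply: measurable_sum => x.
  apply: measurable_funM; first by apply: measurable_funX; exact: ma.
  apply: join_measurable_meas (join_measurable_comp (measurable_light _)
    (join_measurable_comp (mpow 4) (@jmF k1 k2 x))); exact: Gm.
by move=> t; rewrite ger0_norm ?sqr_ge0.
Qed.

Lemma light_part_sqr_mean k1 k2 :
  'Er_P[fun t => light_part k1 k2 t ^+ 2] <= 16 * r%:R ^+ 8 * c * K.
Proof.
apply: (le_trans (le_Er (light_part_sqr_integrable k1 k2) (i_light_bound k1 k2)
  (light_part_sqr_le k1 k2))).
rewrite ErZ; last exact: integrableR_sum.
rewrite Er_sum//.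
apply: (@le_trans _ _ (4 * r%:R ^+ 7 * \sum_(x : cell) c * K)); last first.
  by rewrite sumr_const -[X in _ * X <= _]mulr_natl card_cell; lra.
rewrite ler_wpM2l ?mulr_ge0 ?exprn_ge0//; apply: ler_sum => x _.
rewrite (indep_ErM GI GT Gm indG (ia_iz x.2) (@jma_pow x.2 8) (@jm_light2 k1 k2 x)) //.
apply: ler_pM => //.
- by apply: Er_ge0 => t; rewrite (exprM _ 4 2) sqr_ge0.
- by apply: Er_ge0 => t; exact: sqr_ge0.
- by apply: (box_form_light N0 dim0 (bZ x.2)) => i; exact: trig_le.
Qed.

Lemma periodogram_measurable k : jm (\bigcup_l component_sites l) (Ph k).
Proof.
rewrite (_ : Ph k = fun t => \sum_b X (trig b k) t ^+ 2); last first.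
  by apply/funext => t; exact: periodogram_mixture.
apply: join_measurable_sum => b.
exact: join_measurable_comp (mpow 2) (mixture_form_measurable _).
Qed.

Lemma periodogram_ge0 k t : 0 <= Ph k t.
Proof. by rewrite /= periodogram_mixture sumr_ge0// => b _; exact: sqr_ge0. Qed.

Lemma periodogram_product_integrable k1 k2 :
  integrableR P (fun t => Ph k1 t * Ph k2 t).
Proof. exact: iPhPh. Qed.

(** [periodogram_product_le] at equal frequencies, with the light part bounded by [1] plus its
    square; the resulting bound is uniform in [N]. *)
Lemma periodogram_sqr_mean k : 'Er_P[fun t => Ph k t ^+ 2] <=
  8 * r%:R ^+ 4 * c * K + 1 + 16 * r%:R ^+ 8 * c * K.
Proof.
have iB : integrableR P (fun t => heavy_part k k t + (1 + light_part k k t ^+ 2)).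
  apply: integrableRD (heavy_part_integrable k k) _.
  exact: integrableRD (integrableR_cst P 1) (light_part_sqr_integrable k k).
apply: (@le_trans _ _ 'Er_P[fun t => heavy_part k k t + (1 + light_part k k t ^+ 2)]).
  apply: le_Er => //.
    by apply: eq_integrableR (iPhPh k k) => t; rewrite expr2.
  move=> t; rewrite expr2; apply: (le_trans (periodogram_product_le k k t)).
  by rewrite lerD2l; have := sqr_ge0 (light_part k k t - 1 / 2); lra.
rewrite (ErD (heavy_part_integrable k k)); last first.
  exact: integrableRD (integrableR_cst P 1) (light_part_sqr_integrable k k).
rewrite (ErD (integrableR_cst P 1) (light_part_sqr_integrable k k)) Er_cst.
rewrite -addrA; apply: lerD; last first.
  by rewrite lerD2l; exact: light_part_sqr_mean.
apply: (le_trans (heavy_part_mean k k)).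
rewrite ler_piMr//.
(* [1 <= K] is known only through a component, so the empty mixture is treated apart. *)
have [r0|l] := eqVneq r 0; first by rewrite r0 expr0n /= mulr0 !mul0r.
have /K1 K1' : 'I_r by case: (r) l => // n _; exact: ord0.
by rewrite !mulr_ge0 ?exprn_ge0//; lra.
Qed.

End Sample.

(** * Errors of sample means and of the sample covariance *)

Section SampleAverages.
Context {R : realType} {d : measure_display} {T : measurableType d}.
Variables (P : probability T R) (I : choiceType) (F : I -> set_system T).
Hypothesis FI : forall i, setI_closed (F i).
Hypothesis FT : forall i, F i setT.
Hypothesis Fm : forall i, F i `<=` measurable.
Hypothesis indF : mutually_independent P F.
Variables (n : nat) (n0 : (0 < n)%N) (J : 'I_n -> set I).
Hypothesis Jdisj : forall s s', s != s' -> J s `&` J s' = set0.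
Local Notation jm := (join_measurable F).
Implicit Type Y : 'I_n -> T -> R.

Definition sample_mean Y (t : T) : R := n%:R^-1 * \sum_(s < n) Y s t.

Let NR0 : 0 < n%:R :> R. Proof. by rewrite ltr0n. Qed.

Lemma sample_mean_bias Y m e t : (forall s, `|'Er_P[Y s] - m| <= e) ->
  `|sample_mean Y t - m| <= `|centred_mean P Y t| + e.
Proof.
move=> be.
have -> : sample_mean Y t - m =
    centred_mean P Y t + n%:R^-1 * \sum_(s < n) ('Er_P[Y s] - m).
  rewrite /sample_mean /centred_mean -mulrDr -big_split /=.
  rewrite [in RHS](eq_bigr (fun s => Y s t - m)); last by move=> s _; ring.
  rewrite sumrB sumr_const card_ord -[m *+ n]mulr_natl mulrBr mulrA mulVf ?gt_eqF//.
  by rewrite mul1r.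
apply: (le_trans (ler_normD _ _)); rewrite lerD2l.
rewrite normrM gtr0_norm ?invr_gt0// ler_pdivrMl//.
apply: (le_trans (ler_norm_sum _ _ _)).
apply: (@le_trans _ _ (\sum_(s < n) e)); first exact: ler_sum.
by rewrite sumr_const card_ord mulr_natl.
Qed.

Let sample_mean_measurable Y : (forall s, measurable_fun setT (Y s)) ->
  measurable_fun setT (sample_mean Y).
Proof. by move=> mY; apply: measurable_funM => //; exact: measurable_sum. Qed.

Lemma sample_mean_error Y (V m e : R) :
  (forall s, jm (J s) (Y s)) -> (forall s, integrableR P (fun t => Y s t ^+ 2)) ->
  (forall s, 'Er_P[fun t => Y s t ^+ 2] <= V) ->
  (forall s, `|'Er_P[Y s] - m| <= e) ->
  integrableR P (fun t => `|sample_mean Y t - m|) /\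
  'Er_P[fun t => `|sample_mean Y t - m|] <= (V + 1) / Num.sqrt n%:R + e.
Proof.
move=> mY iY2 EY2 be.
have [iA EA] := centred_mean_abs FI FT Fm indF n0 Jdisj mY iY2 EY2.
have iB := integrableRD iA (integrableR_cst P e).
have le t := @sample_mean_bias Y m e t be.
have iD : integrableR P (fun t => `|sample_mean Y t - m|).
  apply: integrableR_le iB _ => [|t]; last by rewrite normr_id; exact: le.
  apply: measurableT_comp => //; apply: measurable_funB => //.
  by apply: sample_mean_measurable => s; exact: join_measurable_meas (@mY s).
split => //; apply: (le_trans (le_Er iD iB le)).
by rewrite (ErD iA (integrableR_cst P e)) Er_cst lerD2r.
Qed.

Lemma sample_mean_error_sqr Y (V m e : R) :
  (forall s, jm (J s) (Y s)) -> (forall s, integrableR P (fun t => Y s t ^+ 2)) ->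
  (forall s, 'Er_P[fun t => Y s t ^+ 2] <= V) ->
  (forall s, `|'Er_P[Y s] - m| <= e) ->
  integrableR P (fun t => (sample_mean Y t - m) ^+ 2) /\
  'Er_P[fun t => (sample_mean Y t - m) ^+ 2] <= 2 * V / n%:R + 2 * e ^+ 2.
Proof.
move=> mY iY2 EY2 be.
have [iA EA] := centred_mean_sqr FI FT Fm indF n0 Jdisj mY iY2 EY2.
have iB := integrableRD (integrableRZ 2 iA) (integrableR_cst P (2 * e ^+ 2)).
have le t : (sample_mean Y t - m) ^+ 2 <= 2 * centred_mean P Y t ^+ 2 + 2 * e ^+ 2.
  have h := @sample_mean_bias Y m e t be.
  rewrite -(ger0_norm (sqr_ge0 (_ - m))) normrX.
  apply: (@le_trans _ _ ((`|centred_mean P Y t| + e) ^+ 2)).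
    by apply: lerXn2r => //; rewrite nnegrE// (le_trans _ h).
  rewrite -[in leRHS](ger0_norm (sqr_ge0 (centred_mean P Y t))) normrX.
  by have := sqr_ge0 (`|centred_mean P Y t| - e); lra.
have iD : integrableR P (fun t => (sample_mean Y t - m) ^+ 2).
  apply: integrableR_le iB _ => [|t]; last by rewrite ger0_norm ?sqr_ge0//; exact: le.
  apply: measurable_funX; apply: measurable_funB => //.
  by apply: sample_mean_measurable => s; exact: join_measurable_meas (@mY s).
split => //; apply: (le_trans (le_Er iD iB le)).
rewrite (ErD (integrableRZ 2 iA) (integrableR_cst P _)) (ErZ _ iA) Er_cst lerD2r.
by rewrite -mulrA ler_pM2l.
Qed.

Variables (Y1 Y2 U L : 'I_n -> T -> R) (m1 m2 w D B V e1 e2 eU K : R).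
Hypotheses (jm1 : forall s, jm (J s) (Y1 s)) (jm2 : forall s, jm (J s) (Y2 s)).
Hypotheses (iY1 : forall s, integrableR P (fun t => Y1 s t ^+ 2))
  (iY2 : forall s, integrableR P (fun t => Y2 s t ^+ 2)).
Hypotheses (EY1 : forall s, 'Er_P[fun t => Y1 s t ^+ 2] <= V)
  (EY2 : forall s, 'Er_P[fun t => Y2 s t ^+ 2] <= V).
Hypotheses (Y1_bias : forall s, `|'Er_P[Y1 s] - m1| <= e1)
  (Y2_bias : forall s, `|'Er_P[Y2 s] - m2| <= e1).
Hypotheses (m1_le : `|m1| <= B) (m2_le : `|m2| <= B).
Hypothesis iY12 : forall s, integrableR P (fun t => Y1 s t * Y2 s t).
Hypotheses (D1 : 1 <= D)
  (Y12_bias : forall s, `|'Er_P[fun t => Y1 s t * Y2 s t] - D * (m1 * m2 + w)| <= e2).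
Hypotheses (Y1_ge0 : forall s t, 0 <= Y1 s t) (Y2_ge0 : forall s t, 0 <= Y2 s t).
Hypotheses (U_ge0 : forall s t, 0 <= U s t) (L_ge0 : forall s t, 0 <= L s t).
Hypothesis Y12_le : forall s t, Y1 s t * Y2 s t <= U s t + L s t.
Hypotheses (iU : forall s, integrableR P (U s))
  (iL : forall s, integrableR P (fun t => L s t ^+ 2)).
Hypotheses (EU : forall s, 'Er_P[U s] <= eU)
  (EL : forall s, 'Er_P[fun t => L s t ^+ 2] <= K).

(** Expanding the product of the sample means around [m1 * m2] leaves [d1 d2 + m2 d1 + m1 d2]. The
    quadratic term is at most half the sum of the squares, which is why mean square errors are kept
    beside mean absolute ones; [Y12] itself is only available through truncation. *)
Lemma sample_covariance_error :
  let err t := D^-1 * sample_mean (fun s t => Y1 s t * Y2 s t) t -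
    sample_mean Y1 t * sample_mean Y2 t - w in
  integrableR P (fun t => `|err t|) /\
  'Er_P[fun t => `|err t|] <=
    (4 * eU + (4 * K + 1) / Num.sqrt n%:R + e2) + (2 * V / n%:R + 2 * e1 ^+ 2) +
    2 * B * ((V + 1) / Num.sqrt n%:R + e1).
Proof.
move=> err; pose Y12 s t := Y1 s t * Y2 s t.
have jm12 s : jm (J s) (Y12 s) by exact: join_measurableM (@jm1 s) (@jm2 s).
have Y12_ge0 s t : 0 <= Y12 s t by rewrite mulr_ge0.
have [i12 E12] := centred_mean_truncated FI FT Fm indF n0 Jdisj jm12 iY12 iU iL
  Y12_ge0 U_ge0 L_ge0 Y12_le EU EL.
have [i1 E1] := sample_mean_error jm1 iY1 EY1 Y1_bias.
have [i2 E2] := sample_mean_error jm2 iY2 EY2 Y2_bias.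
have [j1 F1] := sample_mean_error_sqr jm1 iY1 EY1 Y1_bias.
have [j2 F2] := sample_mean_error_sqr jm2 iY2 EY2 Y2_bias.
pose d1 t := sample_mean Y1 t - m1; pose d2 t := sample_mean Y2 t - m2.
have D0 : 0 < D by exact: lt_le_trans D1.
have le t : `|err t| <= (`|centred_mean P Y12 t| + e2) +
    (2^-1 * (d1 t ^+ 2 + d2 t ^+ 2) + (B * `|d1 t| + B * `|d2 t|)).
  have -> : err t = D^-1 * (sample_mean Y12 t - D * (m1 * m2 + w)) -
      (d1 t * d2 t + (m2 * d1 t + m1 * d2 t)).
    by rewrite /err /d1 /d2; field; rewrite gt_eqF.
  apply: (le_trans (ler_normB _ _)); apply: lerD.
    rewrite normrM gtr0_norm ?invr_gt0//.
    apply: (le_trans _ (@sample_mean_bias Y12 _ _ t Y12_bias)).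
    by rewrite ler_piMl// invf_le1.
  apply: (le_trans (ler_normD _ _)); apply: lerD.
    have := (sqr_ge0 (d1 t - d2 t), sqr_ge0 (d1 t + d2 t)) => -[? ?].
    by rewrite ler_norml; apply/andP; split; lra.
  apply: (le_trans (ler_normD _ _)); rewrite !normrM.
  by apply: lerD; apply: ler_wpM2r.
have k1 := integrableRD i12 (integrableR_cst P e2).
have k2 := integrableRZ 2^-1 (integrableRD j1 j2).
have k3 := integrableRD (integrableRZ B i1) (integrableRZ B i2).
have iB := integrableRD k1 (integrableRD k2 k3).
have mT Y : (forall s, jm (J s) (Y s)) -> measurable_fun setT (sample_mean Y).
  move=> mY; apply: sample_mean_measurable => s.
  exact: join_measurable_meas (@mY s).
have ie : integrableR P (fun t => `|err t|).
  apply: integrableR_le iB _ => [|t]; last by rewrite normr_id; exact: le.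
  apply: measurableT_comp => //; apply: measurable_funB => //.
  apply: measurable_funB.
    by apply: measurable_funM => //; exact: mT jm12.
  by apply: measurable_funM; [exact: mT jm1|exact: mT jm2].
split => //; apply: (le_trans (le_Er ie iB le)).
rewrite (ErD k1 (integrableRD k2 k3)) (ErD k2 k3) (ErD i12 (integrableR_cst P e2)).
rewrite (ErZ _ (integrableRD j1 j2)) (ErD j1 j2).
rewrite (ErD (integrableRZ B i1) (integrableRZ B i2)) (ErZ _ i1) (ErZ _ i2) Er_cst.
have B0 : 0 <= B by exact: le_trans m1_le.
have := ler_wpM2l B0 E1; have := ler_wpM2l B0 E2.
by lra.
Qed.

End SampleAverages.

(** * Copies *)

Section FieldsCoefs.
Context {R : realType} {d : measure_display} {T : measurableType d}.
Variables (P : probability T R) (L : choiceType) (S : Type).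
Variables (Z : L -> S -> T -> R) (a : L -> T -> R).
Hypothesis mZ : forall l i, measurable_fun setT (Z l i).
Hypothesis ma : forall l, measurable_fun setT (a l).

(** The family of sigma-algebras inside [fields_coefs_independent], named so that the results on
    independent sources apply to that hypothesis by conversion. *)
Definition fields_coefs_sigma (x : (L + L)%type) : set_system T :=
  match x with
  | inl l => g_sigma_algebra_preimage (realization (Z l))
  | inr l => g_sigma_algebra_preimage (a l)
  end.

Lemma fields_coefs_sigmaI x : setI_closed (fields_coefs_sigma x).
Proof. by case: x => l; [exact: (@preimage_sigmaI _ _ _ _ _ (fun l => realization (Z l))
  l)|exact: preimage_sigmaI]. Qed.

Lemma fields_coefs_sigmaT x : fields_coefs_sigma x setT.
Proof. by case: x => l; [exact: (preimage_sigmaT (fun=> realization (Z l)) tt)|exact: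
  preimage_sigmaT]. Qed.

Lemma fields_coefs_sigma_sub x : fields_coefs_sigma x `<=` measurable.
Proof.
case: x => l; last exact: preimage_sigma_sub.
by apply: (@preimage_sigma_sub _ _ unit _ _ (fun=> realization (Z l)) _ tt) => _;
  exact: measurable_realization.
Qed.

Lemma field_join_measurable l i :
  join_measurable fields_coefs_sigma [set inl l] (Z l i).
Proof.
apply: join_measurable1 => B mB /=; exists (fun y => B (y i)).
  by have := measurable_coordinate i measurableT mB; rewrite setTI.
by rewrite setTI.
Qed.

Lemma coef_join_measurable l :
  join_measurable fields_coefs_sigma [set inr l] (a l).
Proof. by apply: join_measurable1 => B mB /=; exists B => //; rewrite setTI. Qed.

End FieldsCoefs.

Section Transfer.
Context {R : realType} {dim : nat}.
Context {d : measure_display} {T : measurableType d} (P : probability T R).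
Context {d' : measure_display} {T' : measurableType d'} (P' : probability T' R).

Lemma same_distribution_Er (X : {RV P >-> R}) (X' : {RV P' >-> R}) (m : nat) :
  (forall B, measurable B -> distribution P' X' B = distribution P X B) ->
  integrableR P (fun t => X t ^+ m) ->
  integrableR P' (fun t => X' t ^+ m) /\
  'Er_P'[fun t => X' t ^+ m] = 'Er_P[fun t => X t ^+ m].
Proof.
move=> law iX; have mp : measurable_fun setT (fun x : R => x ^+ m) by exact: measurable_funX.
by have [i ->] := @distribution_Er _ _ _ _ _ P _ _ P' X X' _ (fun A mA => esym (law A mA)) mp iX.
Qed.

End Transfer.

Lemma sqrt_inv_bounds {R : realType} (n : nat) : (0 < n)%N ->
  let p : R := (Num.sqrt n%:R)^-1 in [/\ 0 <= p, p ^+ 2 <= p & n%:R^-1 <= p].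
Proof.
move=> n0 p; have s1 : 1 <= Num.sqrt n%:R :> R by rewrite -[leLHS]sqrtr1 ler_wsqrtr// ler1n.
have p0 : 0 <= p by rewrite invr_ge0 sqrtr_ge0.
have p1 : p <= 1 by rewrite invf_le1 ?(lt_le_trans _ s1).
have pp : p ^+ 2 <= p by rewrite expr2 ler_piMr.
split => //; apply: le_trans pp; rewrite /p exprVn sqr_sqrtr ?ler0n//.
Qed.

Lemma product_error_ge0 {R : realFieldType} (x c K : R) : 0 <= x -> 0 <= c -> 0 <= K ->
  0 <= 4 * (x * (2 * c * (K + 72 * K ^+ 2) + 288 * c ^+ 2 * K ^+ 2) +
            288 * x ^+ 2 * c ^+ 2 * K ^+ 2).
Proof.
move=> x0 c0 K0.
have [[K2 c2] x2] := (sqr_ge0 K, sqr_ge0 c, sqr_ge0 x).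
have h1 := mulr_ge0 x0 (mulr_ge0 c0 K0); have h2 := mulr_ge0 x0 (mulr_ge0 c0 K2).
have h3 := mulr_ge0 x0 (mulr_ge0 c2 K2); have h4 := mulr_ge0 x2 (mulr_ge0 c2 K2).
lra.
Qed.

(* The eighth moments make the sampling error of the a_l^4 of order n^(-1/2). *)
Theorem theorem1 (R : realType) (dim r : nat) (dim_gt0 : (0 < dim)%N)
    (r_gt0 : (0 < r)%N)
    (d0 : measure_display) (T0 : measurableType d0) (P0 : probability T0 R)
    (Z0 : 'I_r -> 'rV[int]_dim -> {RV P0 >-> R}) (a0 : 'I_r -> {RV P0 >-> R})
    (Z0_linear : forall l, linear_field (Z0 l))
    (Z0a0_indep : fields_coefs_independent P0 (fun l i => Z0 l i)
                    (fun l => a0 l))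
    (a0_moment8 : forall l, ('E_P0[fun t => (`|a0 l t| ^+ 8)%R] < +oo)%E) :
  exists C : R,
    forall (n N : nat) (n_gt0 : (0 < n)%N) (N_gt0 : (0 < N)%N)
      (M : set 'rV[int]_dim) (M_half : half_box N M)
      (d : measure_display) (T : measurableType d) (P : probability T R)
      (Z : 'I_n -> 'I_r -> 'rV[int]_dim -> {RV P >-> R})
      (a : 'I_n -> 'I_r -> {RV P >-> R})
      (Za_copies : iid_copies Z0 a0 Z a),
    let X0 := mixture (fun l => a0 l) (fun l i => Z0 l i) in
    let X := fun s : 'I_n => mixture (fun l => a s l) (fun l i => Z s l i) in
    let mu := mean_periodogram N X in
    let Cn := second_moment_periodogram N X in
    let PXa := fun (k : 'rV[int]_dim) (t : T0) =>
      cond_power_spectrum P0 (fun l i => Z0 l i) (fun l => a0 l t)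
        (grid_freq N k) in
    let eps1 := fun k t => mu k t - power_spectrum P0 X0 (grid_freq N k) in
    let eps2 := fun k1 k2 t =>
      (1 + deltaN N k1 k2)^-1 * Cn k1 k2 t - mu k1 t * mu k2 t
        - fine (covariance P0 (PXa k1) (PXa k2)) in
    let rate := C * ((Num.sqrt n%:R)^-1 + (Num.sqrt N%:R)^-1) in
    (forall k, M k -> ('E_P[fun t => (`|eps1 k t|)%R] <= rate%:E)%E) /\
    (forall k1 k2, M k1 -> M k2 ->
       ('E_P[fun t => (`|eps2 k1 k2 t|)%R] <= rate%:E)%E).
Proof.
have [Kf bZf] := choice (fun l => linear_field_bounds (Z0_linear l)).
pose K := \sum_l Kf l.
have bZ0 l : field_bounds P0 (fun i => Z0 l i) K.
  apply: field_bounds_le (bZf l); rewrite /K (bigD1 l)//= lerDl sumr_ge0// => l' _.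
  exact: le_trans (field_bound_ge1 (bZf l')).
have K0 : 0 <= K.
  by have := field_bound_ge1 (bZ0 (Ordinal r_gt0)); exact: le_trans.
have ia0 l : integrableR P0 (fun t => a0 l t ^+ 8).
  have m8 : measurable_fun setT (fun t => `|a0 l t| ^+ 8).
    by apply: measurable_funX; exact: measurableT_comp.
  apply: eq_integrableR (integrableR_ge0 m8 _ (a0_moment8 l)) => t.
    by rewrite -normrX ger0_norm// (exprM _ 4 2) sqr_ge0.
  exact: exprn_ge0.
pose c := 1 + \sum_l 'Er_P0[fun t => a0 l t ^+ 8].
have Ea8_ge0 l : 0 <= 'Er_P0[fun t => a0 l t ^+ 8].
  by apply: Er_ge0 => t; rewrite (exprM _ 4 2) sqr_ge0.
have c1 : 1 <= c by rewrite lerDl sumr_ge0.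
have c0 : 0 <= c by exact: le_trans c1.
have Ea0 l : 'Er_P0[fun t => a0 l t ^+ 8] <= c.
  by rewrite /c (bigD1 l)//= addrCA lerDl addr_ge0// sumr_ge0.
pose cb := 12 * r%:R * c * K.
pose V := 8 * r%:R ^+ 4 * c * K + 1 + 16 * r%:R ^+ 8 * c * K.
pose cU := 8 * r%:R ^+ 4 * c * K.
pose KL := 16 * r%:R ^+ 8 * c * K.
pose cp := 4 * (r%:R * (2 * c * (K + 72 * K ^+ 2) + 288 * c ^+ 2 * K ^+ 2) +
       288 * r%:R ^+ 2 * c ^+ 2 * K ^+ 2).
pose B := 2 * r%:R * c * K.
have cb0 : 0 <= cb by rewrite !mulr_ge0.
have cU0 : 0 <= cU by rewrite !mulr_ge0// exprn_ge0.
have KL0 : 0 <= KL by rewrite !mulr_ge0// exprn_ge0.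
have V0 : 0 <= V by rewrite !addr_ge0.
have B0 : 0 <= B by rewrite !mulr_ge0.
have cp0 : 0 <= cp.
  exact: product_error_ge0.
(* The sum of all coefficients of the two error bounds, once [1 / n] and [1 / N] are replaced by
   their square roots. It depends on [r] and on the laws of the fields and coefficients, but not on
   [n], [N] or the copies. *)
exists ((V + 1) + cb + 4 * cU + (4 * KL + 1) + cp + 2 * V + 2 * cb ^+ 2 +
        2 * (B * (V + 1)) + 2 * (B * cb)).
move=> n N n_gt0 N_gt0 M M_half d T P Z a [lawZ lawa indep] X0 X mu Cn PXa eps1 eps2 rate.
pose G0 := fields_coefs_sigma (fun l i => Z0 l i : T0 -> R) (fun l => a0 l : T0 -> R).
pose G := fields_coefs_sigma (fun sl : 'I_n * 'I_r => fun i => Z sl.1 sl.2 i : T -> R)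
  (fun sl => a sl.1 sl.2 : T -> R).
have G0I x : setI_closed (G0 x) by exact: fields_coefs_sigmaI.
have G0T x : G0 x setT by exact: fields_coefs_sigmaT.
have G0m x : G0 x `<=` measurable by exact: fields_coefs_sigma_sub.
have GI x : setI_closed (G x) by exact: fields_coefs_sigmaI.
have GT x : G x setT by exact: fields_coefs_sigmaT.
have Gm x : G x `<=` measurable by exact: fields_coefs_sigma_sub.
have indG0 : mutually_independent P0 G0 by exact: Z0a0_indep.
have indG : mutually_independent P G by exact: indep.
have bZ s l : field_bounds P (fun i => Z s l i) K.
  apply: (field_bounds_same_law _ _ _ _ (bZ0 l)) => //.
  - by move=> A mA; exact: esym (lawZ s l A mA).
  - by move=> i; exact: field_L4 (bZ0 l) i.
have jmZ0 l i : join_measurable G0 [set inl l] (Z0 l i) by exact: field_join_measurable.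
have jma0 l : join_measurable G0 [set inr l] (a0 l).
  exact: (@coef_join_measurable _ _ _ _ _ (fun l i => Z0 l i : T0 -> R)).
have mom m s l : (m <= 8)%N -> integrableR P (fun t => a s l t ^+ m) /\
    coef_moment P (fun l => a s l) m l = coef_moment P0 (fun l => a0 l) m l.
  move=> m8; apply: same_distribution_Er (lawa s l) _.
  exact: (coef_pow_integrable G0m jma0 ia0).
have ia s l : integrableR P (fun t => a s l t ^+ 8) by have [] := mom 8 s l isT.
have Ea s l : 'Er_P[fun t => a s l t ^+ 8] <= c.
  by have [_] := mom 8 s l isT; rewrite /coef_moment => ->.
pose iz s (l : 'I_r) : ('I_n * 'I_r + 'I_n * 'I_r)%type := inl (s, l).
pose ja s (l : 'I_r) : ('I_n * 'I_r + 'I_n * 'I_r)%type := inr (s, l).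
have iz_inj s : injective (iz s) by move=> l l' [].
have ja_inj s : injective (ja s) by move=> l l' [].
have izja s l l' : iz s l != ja s l' by [].
have jmZ s l i : join_measurable G [set iz s l] (Z s l i).
  exact: (@field_join_measurable _ _ _ _ _ (fun sl i => Z sl.1 sl.2 i : T -> R) _ (s, l) i).
have jma s l : join_measurable G [set ja s l] (a s l).
  exact: (@coef_join_measurable _ _ _ _ _ _ (fun sl => a sl.1 sl.2 : T -> R) (s, l)).
pose J s : set ('I_n * 'I_r + 'I_n * 'I_r)%type :=
  \bigcup_l component_sites (iz s) (ja s) l.
have Jdisj s s' : s != s' -> J s `&` J s' = set0.
  move=> ss'; rewrite -subset0 => x [[l _ hl] [l' _ hl']].
  by move: ss'; case: hl hl' => -> [] // [->]; rewrite eqxx.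
(* Autocovariances and coefficient moments depend on the laws alone, so the limits [lm] and [lv] are
   common to all samples and belong to the original fields. *)
have acE s l : autocovariance P (fun i => Z s l i) = autocovariance P0 (fun i => Z0 l i).
  apply/funext => j; rewrite /autocovariance; symmetry.
  apply: (@same_law_cov2 _ _ _ _ P0 _ _ P (fun i => Z0 l i : T0 -> R) (fun i => Z s l i : T ->
    R)) => //.
  by move=> A mA; exact: esym (lawZ s l A mA).
by move=> i; exact: field_L4 (bZ0 l) i.
pose lm k := limit_mean P0 (fun l i => Z0 l i : T0 -> R) (fun l => a0 l : T0 -> R) N k.
pose lv k1 k2 := limit_variance P0 (fun l i => Z0 l i : T0 -> R) (fun l => a0 l : T0 -> R) N k1 k2.
have lmE s k : limit_mean P (fun l i => Z s l i : T -> R) (fun l => a s l : T -> R) N k = lm k.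
  by apply: eq_bigr => l _; rewrite acE; have [_ ->] := mom 2 s l isT.
have lvE s k1 k2 : limit_variance P (fun l i => Z s l i : T -> R) (fun l => a s l : T -> R) N k1
  k2 =
    lv k1 k2.
  apply: eq_bigr => l _; rewrite acE; have [_ ->] := mom 2 s l isT.
  by have [_ ->] := mom 4 s l isT.
pose Y k s t := periodogram N (fun i => X s i t) k.
have jmY k s : join_measurable G (J s) (Y k s) by exact: periodogram_measurable (@jmZ s) (@jma
  s) N k.
have YY k1 k2 s : integrableR P (fun t => Y k1 s t * Y k2 s t).
  have h := periodogram_product_integrable GI GT Gm indG (@izja s) (@jmZ s) (@jma s) (bZ s) (ia
    s) N k1 k2.
  exact: h.
have iY2 k s : integrableR P (fun t => Y k s t ^+ 2).
  by apply: eq_integrableR (YY k k s) => t; rewrite expr2.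
have EY2 k s : 'Er_P[fun t => Y k s t ^+ 2] <= V.
  have h := periodogram_sqr_mean GI GT Gm indG (@izja s) (@jmZ s) (@jma s) (bZ s) (ia s) c1 (Ea
    s) N_gt0 dim_gt0 k.
  exact: h.
pose q : R := (Num.sqrt N%:R)^-1; pose p : R := (Num.sqrt n%:R)^-1.
have [q0 qq _] := @sqrt_inv_bounds R N N_gt0.
have [p0 _ np] := @sqrt_inv_bounds R n n_gt0.
have bias k s : `|'Er_P[Y k s] - lm k| <= cb * q.
  rewrite -(lmE s).
  have h := periodogram_mean GI GT Gm indG (@iz_inj s) (@ja_inj s) (@izja s) (@jmZ s) (@jma s)
    (bZ s) (ia s) c1 (Ea s) N_gt0 k.
  exact: h.
have inl_inj : injective (@inl 'I_r 'I_r) by move=> l l' [].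
have inr_inj : injective (@inr 'I_r 'I_r) by move=> l l' [].
have inlr (l l' : 'I_r) : inl l != inr l' :> ('I_r + 'I_r)%type by [].
have X0E k : power_spectrum P0 X0 (grid_freq N k) = lm k.
  have h := mixture_power_spectrum G0I G0T G0m indG0 inl_inj inr_inj inlr jmZ0 jma0 bZ0 ia0
    (grid_freq N k).
  exact: h.
have covE k1 k2 : fine (covariance P0 (PXa k1) (PXa k2)) = lv k1 k2.
  have PXaE k : PXa k = fun t => \sum_l a0 l t ^+ 2 *
      spectrum (autocovariance P0 (fun i => Z0 l i)) (grid_freq N k).
    apply/funext => t.
    by rewrite /PXa (frozen_power_spectrum G0I G0T G0m indG0 inl_inj jmZ0 bZ0).
  by rewrite !PXaE (coef_square_covariance G0I G0T G0m indG0 inr_inj jma0 ia0).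
have lm_le k : `|lm k| <= B.
  exact: (limit_mean_le G0m jma0 bZ0 ia0 c1 Ea0).
have B1 := mulr_ge0 B0 V0; have B2 := mulr_ge0 B0 cb0; have cb2 := sqr_ge0 cb.
rewrite /rate -/p -/q; split.
- move=> k Mk.
  have [i e] := sample_mean_error GI GT Gm indG n_gt0 Jdisj (jmY k) (iY2 k) (EY2 k) (bias k).
  rewrite /eps1 X0E integrableR_fin; last exact: i.
  rewrite lee_fin; apply: (le_trans e).
  set C := (X in _ <= X * _).
  have V1C : V + 1 <= C by rewrite /C; lra.
  have cbC : cb <= C by rewrite /C; lra.
  by rewrite mulrDr; apply: lerD; exact: ler_wpM2r.
move=> k1 k2 M1 M2.
have D1 : 1 <= 1 + deltaN N k1 k2 :> R.
  by rewrite lerDl /deltaN; case: ifP => // _; case: ifP.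
have YY_bias s : `|'Er_P[fun t => Y k1 s t * Y k2 s t] -
    (1 + deltaN N k1 k2) * (lm k1 * lm k2 + lv k1 k2)| <= cp * q.
  rewrite -!(lmE s) -(lvE s).
  have h := periodogram_product_mean GI GT Gm indG (@iz_inj s) (@ja_inj s) (@izja s) (@jmZ s)
    (@jma s) (bZ s) (ia s) c1 (Ea s) N_gt0 dim_gt0 M_half M1 M2.
  exact: h.
pose U s := heavy_part (fun l i => Z s l i : T -> R) (fun l => a s l : T -> R) N k1 k2.
pose L s := light_part (fun l i => Z s l i : T -> R) (fun l => a s l : T -> R) N k1 k2.
have iU s : integrableR P (U s).
  have h := heavy_part_integrable GI GT Gm indG (@izja s) (@jmZ s) (@jma s) (bZ s) (ia s) N k1 k2.
  exact: h.
have iL s : integrableR P (fun t => L s t ^+ 2).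
  have h := light_part_sqr_integrable GI GT Gm indG (@izja s) (@jmZ s) (@jma s) (ia s) N k1 k2.
  exact: h.
have EU s : 'Er_P[U s] <= cU * q.
  have h := heavy_part_mean GI GT Gm indG (@izja s) (@jmZ s) (@jma s) (bZ s) (ia s) c1 (Ea s)
    N_gt0 dim_gt0 k1 k2.
  exact: h.
have EL s : 'Er_P[fun t => L s t ^+ 2] <= KL.
  have h := light_part_sqr_mean GI GT Gm indG (@izja s) (@jmZ s) (@jma s) (bZ s) (ia s) (Ea s)
    N_gt0 dim_gt0 k1 k2.
  exact: h.
have Y_ge0 k s t : 0 <= Y k s t by exact: periodogram_ge0.
have U_ge0 s t : 0 <= U s t by exact: heavy_part_ge0.
have L_ge0 s t : 0 <= L s t by exact: light_part_ge0.
have YUL s t : Y k1 s t * Y k2 s t <= U s t + L s t by exact: periodogram_product_le.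
have [i e] := sample_covariance_error GI GT Gm indG n_gt0 Jdisj (jmY k1) (jmY k2)
  (iY2 k1) (iY2 k2) (EY2 k1) (EY2 k2) (bias k1) (bias k2) (lm_le k1) (lm_le k2)
  (YY k1 k2) D1 YY_bias (Y_ge0 k1) (Y_ge0 k2) U_ge0 L_ge0 YUL iU iL EU EL.
rewrite /eps2 covE integrableR_fin; last exact: i.
rewrite lee_fin; apply: (le_trans e).
rewrite -/p -/q exprMn.
(* [h1] and [h2] replace [1 / n] and [q^2] by the rates; the other facts are the nonnegativity of
   each constant times the rate that its error term lacks. The goal is then linear in these
   products. *)
have h1 := ler_wpM2l V0 np; have h2 := ler_wpM2l cb2 qq.
have [[h3 h4] h5] := (mulr_ge0 V0 q0, mulr_ge0 cb0 p0, mulr_ge0 cU0 p0).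
have [[h6 h7] h8] := (mulr_ge0 KL0 q0, mulr_ge0 cp0 p0, mulr_ge0 cb2 p0).
have [h9 h10] := (mulr_ge0 B1 q0, mulr_ge0 B2 p0).
have [[h11 h12] h13] := (mulr_ge0 B0 q0, mulr_ge0 V0 p0, mulr_ge0 cb0 q0).
move: h1 h2 h3 h4 h5 h6 h7 h8 h9 h10 h11 h12 h13 (q0) (p0).
rewrite -/p -/q; move: (n%:R^-1 : R) (p) (q) (V) (cb) (cU) (KL) (cp) (B) => *.
lra.
Qed.
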